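(* The category $\mathbf{LeibConf2}$ of Leibniz conformal $2$-algebras and their homomorphisms is equivalent to the category $\mathbf{2Leib_\infty Conf}$ of $2$-term $Leib_\infty$-conformal algebras and their homomorphisms.
   Context: Tensor products are over $\mathbb{C}$; $\partial$ acts coefficientwise on formal power series, and maps are extended coefficientwise to power series arguments. For $\mathbb{C}[\partial]$-modules, a $\mathbb{C}$-linear map $\varphi:M_1\otimes\cdots\otimes M_n\to N[[\lambda_1,\ldots,\lambda_{n-1}]]$ is conformal sesquilinear if $\varphi_{\lambda_1,\ldots,\lambda_{n-1}}(x_1,\ldots,\partial x_i,\ldots,x_n)=-\lambda_i\varphi_{\lambda_1,\ldots,\lambda_{n-1}}(x_1,\ldots,x_n)$ for $1\le i\le n-1$ and $\varphi_{\lambda_1,\ldots,\lambda_{n-1}}(x_1,\ldots,x_{n-1},\partial x_n)=(\partial+\lambda_1+\cdots+\lambda_{n-1})\varphi_{\lambda_1,\ldots,\lambda_{n-1}}(x_1,\ldots,x_n)$. **The category $\mathbf{2Leib_\infty Conf}$.** A $2$-term $Leib_\infty$-conformal algebra $(\mathcal{G}_1\xrightarrow{d}\mathcal{G}_0,\rho_2,\rho_3)$ consists of a complex of $\mathbb{C}[\partial]$-modules $\mathcal{G}_1\xrightarrow{d}\mathcal{G}_0$, conformal sesquilinear maps $\rho_2:\mathcal{G}_i\otimes\mathcal{G}_j\to\mathcal{G}_{i+j}[[\lambda]]$ for $0\le i,j,i+j\le1$, and a conformal sesquilinear map $\rho_3:\mathcal{G}_0^{\otimes3}\to\mathcal{G}_1[[\lambda,\mu]]$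 such that for all $x,y,z,w\in\mathcal{G}_0$, $u,v\in\mathcal{G}_1$: (i) $(\rho_2)_\lambda(u,v)=0$ (i.e. $\rho_2$ is zero on $\mathcal{G}_1\otimes\mathcal{G}_1$); (ii) $d((\rho_2)_\lambda(x,u))=(\rho_2)_\lambda(x,du)$; (iii) $d((\rho_2)_\lambda(u,x))=(\rho_2)_\lambda(du,x)$; (iv) $(\rho_2)_\lambda(du,v)=(\rho_2)_\lambda(u,dv)$; (v) $d((\rho_3)_{\lambda,\mu}(x,y,z))=(\rho_2)_\lambda(x,(\rho_2)_\mu(y,z))-(\rho_2)_{\lambda+\mu}((\rho_2)_\lambda(x,y),z)-(\rho_2)_\mu(y,(\rho_2)_\lambda(x,z))$; (vi) $(\rho_3)_{\lambda,\mu}(x,y,dv)=(\rho_2)_\lambda(x,(\rho_2)_\mu(y,v))-(\rho_2)_{\lambda+\mu}((\rho_2)_\lambda(x,y),v)-(\rho_2)_\mu(y,(\rho_2)_\lambda(x,v))$; (vii) $(\rho_3)_{\lambda,\mu}(x,dv,y)=(\rho_2)_\lambda(x,(\rho_2)_\mu(v,y))-(\rho_2)_{\lambda+\mu}((\rho_2)_\lambda(x,v),y)-(\rho_2)_\mu(v,(\rho_2)_\lambda(x,y))$; (viii) $(\rho_3)_{\lambda,\mu}(dv,x,y)=(\rho_2)_\lambda(v,(\rho_2)_\mu(x,y))-(\rho_2)_{\lambda+\mu}((\rho_2)_\lambda(v,x),y)-(\rho_2)_\mu(x,(\rho_2)_\lambda(v,y))$; (ix) $(\rho_2)_\lambda(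x,(\rho_3)_{\mu,\nu}(y,z,w))-(\rho_2)_\mu(y,(\rho_3)_{\lambda,\nu}(x,z,w))+(\rho_2)_\nu(z,(\rho_3)_{\lambda,\mu}(x,y,w))+(\rho_2)_{\lambda+\mu+\nu}((\rho_3)_{\lambda,\mu}(x,y,z),w)-(\rho_3)_{\lambda+\mu,\nu}((\rho_2)_\lambda(x,y),z,w)-(\rho_3)_{\mu,\lambda+\nu}(y,(\rho_2)_\lambda(x,z),w)-(\rho_3)_{\mu,\nu}(y,z,(\rho_2)_\lambda(x,w))+(\rho_3)_{\lambda,\mu+\nu}(x,(\rho_2)_\mu(y,z),w)+(\rho_3)_{\lambda,\nu}(x,z,(\rho_2)_\mu(y,w))-(\rho_3)_{\lambda,\mu}(x,y,(\rho_2)_\nu(z,w))=0$. A homomorphism $\mathcal{G}\to\mathcal{G}'$ is a triple $(f_0,f_1,f_2)$ with $f_0:\mathcal{G}_0\to\mathcal{G}'_0$, $f_1:\mathcal{G}_1\to\mathcal{G}'_1$ $\mathbb{C}[\partial]$-linear and $f_2:\mathcal{G}_0\otimes\mathcal{G}_0\to\mathcal{G}'_1[[\lambda]]$ conformal sesquilinear such that $d'f_1=f_0d$; $(\rho'_2)_\lambda(f_0(x),f_0(y))-f_0((\rho_2)_\lambda(x,y))=d'((f_2)_\lambda(x,y))$; $(\rho'_2)_\lambda(f_0(x),f_1(v))-f_1((\rho_2)_\lambda(x,v))=(f_2)_\lambda(x,dv)$; $(\rho'_2)_\lambda(f_1(v),f_0(x))-f_1((\rho_2)_\lambda(v,x))=(f_2)_\lambda(dv,x)$;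 $(\rho'_3)_{\lambda,\mu}(f_0(x),f_0(y),f_0(z))-f_1((\rho_3)_{\lambda,\mu}(x,y,z))=(\rho'_2)_\lambda(f_0(x),(f_2)_\mu(y,z))-(\rho'_2)_{\lambda+\mu}((f_2)_\lambda(x,y),f_0(z))-(\rho'_2)_\mu(f_0(y),(f_2)_\lambda(x,z))+(f_2)_\lambda(x,(\rho_2)_\mu(y,z))-(f_2)_{\lambda+\mu}((\rho_2)_\lambda(x,y),z)-(f_2)_\mu(y,(\rho_2)_\lambda(x,z))$. Composition: $(g_0,g_1,g_2)\circ(f_0,f_1,f_2)=(g_0f_0,g_1f_1,g_2\circ(f_0\otimes f_0)+g_1\circ f_2)$; identities $(\mathrm{id},\mathrm{id},0)$. **The category $\mathbf{LeibConf2}$.** A $2$-vector space in the category of $\mathbb{C}[\partial]$-modules is a category $C=(C_1\rightrightarrows C_0)$ internal to $\mathbb{C}[\partial]$-modules: $C_0$ (objects) and $C_1$ (morphisms) are $\mathbb{C}[\partial]$-modules and source $s$, target $t$, identity $x\mapsto1_x$ and composition $C_1\times_{C_0}C_1\to C_1$ are $\mathbb{C}[\partial]$-linear. A $\mathbb{C}[\partial]$-linear functor $F=(F_0,F_1):C\to C'$ is a pair of $\mathbb{C}[\partial]$-linear maps $F_i:C_i\to C'_i$ commuting with $s,t$, identities and composition. $C[[\lambda]]$ denotes $(C_1[[\lambda]]\rightrightarrows C_0[[\lambda]])$ with coefficientwise structure, similarly in several variables. A conformal sesquilinear functor $[\cdot_\lambda\cdot]:C\otimes C\to C[[\lambda]]$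 consists of conformal sesquilinear maps $C_i\otimes C_i\to C_i[[\lambda]]$ ($i=0,1$) that are functorial in the pair of arguments (compatible with $s$, $t$, identities and composition). When an object $x$ is bracketed with a morphism, $x$ stands for $1_x$. A Leibniz conformal $2$-algebra is a triple $(C,[\cdot_\lambda\cdot],\mathcal{L})$ with $C$ a $2$-vector space in the category of $\mathbb{C}[\partial]$-modules, $[\cdot_\lambda\cdot]:C\otimes C\to C[[\lambda]]$ a conformal sesquilinear functor, and $\mathcal{L}$ a conformal sesquilinear natural isomorphism $$\mathcal{L}_{x,y,z}=\mathcal{L}^{\lambda,\mu}_{x,y,z}:[x_\lambda[y_\mu z]]\to[[x_\lambda y]_{\lambda+\mu}z]+[y_\mu[x_\lambda z]]$$ (so $\mathcal{L}$ is given by a conformal sesquilinear map $C_0^{\otimes3}\to C_1[[\lambda,\mu]]$, natural in $x,y,z$) such that for all $x,y,z,w\in C_0$ the following two composites of morphisms from $[x_\lambda[y_\mu[z_\nu w]]]$ to $[[[x_\lambda y]_{\lambda+\mu}z]_{\lambda+\mu+\nu}w]+[z_\nu[[x_\lambda y]_{\lambda+\mu}w]]+[[y_\mu[x_\lambda z]]_{\lambda+\mu+\nu}w]+[[x_\lambda z]_{\lambda+\nu}[y_\mu w]]+[[y_\mu z]_{\mu+\nu}[x_\lambda w]]+[z_\nu[y_\mu[x_\lambda w]]]$ are equal (maps listed in order of application): first: $[x_\lambda\mathcal{L}^{\mu,\nu}_{y,z,w}]$, then $\mathcal{L}^{\lambda,\mu+\nu}_{x,[y_\mu z],w}+\mathcal{L}^{\lambda,\nu}_{x,z,[y_\mu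 w]}$, then $[(\mathcal{L}^{\lambda,\mu}_{x,y,z})_{\lambda+\mu+\nu}w]+1+1+[z_\nu\mathcal{L}^{\lambda,\mu}_{x,y,w}]$ (the identities being on $[[y_\mu z]_{\mu+\nu}[x_\lambda w]]$ and $[[x_\lambda z]_{\lambda+\nu}[y_\mu w]]$); second: $\mathcal{L}^{\lambda,\mu}_{x,y,[z_\nu w]}$, then $1+[y_\mu\mathcal{L}^{\lambda,\nu}_{x,z,w}]$ (the identity being on $[[x_\lambda y]_{\lambda+\mu}[z_\nu w]]$), then $\mathcal{L}^{\lambda+\mu,\nu}_{[x_\lambda y],z,w}+\mathcal{L}^{\mu,\lambda+\nu}_{y,[x_\lambda z],w}+\mathcal{L}^{\mu,\nu}_{y,z,[x_\lambda w]}$. A homomorphism $(C,[\cdot_\lambda\cdot],\mathcal{L})\to(C',[\cdot_\lambda\cdot]',\mathcal{L}')$ is a pair $(F,F_2)$ with $F=(F_0,F_1):C\to C'$ a $\mathbb{C}[\partial]$-linear functor and $F_2$ a (conformal sesquilinear) natural isomorphism $(F_2)^{x,y}=(F_2)^{x,y}_\lambda:[F_0(x)_\lambda F_0(y)]'\to F_0[x_\lambda y]$ (an element of $C'_1[[\lambda]]$) such that for all $x,y,z\in C_0$ the following composites from $[F_0(x)_\lambda[F_0(y)_\mu F_0(z)]']'$ to $F_0([[x_\lambda y]_{\lambda+\mu}z]+[y_\mu[x_\lambda z]])$ agree (in order of application): first: $\mathcal{L}'_{F_0(x),F_0(y),F_0(z)}$, then $[((F_2)^{x,y}_\lambda)_{\lambda+\mu}F_0(z)]'+[F_0(y)_\mu(F_2)^{x,z}_\lambda]'$,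 then $(F_2)^{[x_\lambda y],z}_{\lambda+\mu}+(F_2)^{y,[x_\lambda z]}_\mu$; second: $[F_0(x)_\lambda(F_2)^{y,z}_\mu]'$, then $(F_2)^{x,[y_\mu z]}_\lambda$, then $F_1(\mathcal{L}_{x,y,z})$. Composition of $(F,F_2)$ with $(G,G_2)$ is $(G\circ F,(G\circ F)_2)$, where $(G\circ F)_2^{x,y}$ is $(G_2)^{F_0(x),F_0(y)}$ followed by $G_1((F_2)^{x,y})$; the identity homomorphism is the identity functor with identity natural isomorphism. *)

(* Defs.v *)
From HB Require Import structures.
From mathcomp Require Import all_boot all_order all_algebra.
From mathcomp Require Import boolp functions reals complex.

Set Implicit Arguments.
Unset Strict Implicit.
Unset Printing Implicit Defensive.

Import GRing.Theory.
Local Open Scope ring_scope.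

Record category := Category {
  obj :> Type;
  hom : obj -> obj -> Type;
  idm : forall a, hom a a;
  compm : forall a b c, hom b c -> hom a b -> hom a c;
  compm1 : forall a b (f : hom a b), compm f (idm a) = f;
  comp1m : forall a b (f : hom a b), compm (idm b) f = f;
  compmA : forall a b c d (h : hom c d) (g : hom b c) (f : hom a b),
    compm h (compm g f) = compm (compm h g) f }.
Arguments idm {_} a.
Arguments compm {_ a b c} g f.

Record functor (A B : category) := Functor {
  fobj :> A -> B;
  fmap : forall a b, hom a b -> hom (fobj a) (fobj b);
  fmap1 : forall a, fmap (idm a) = idm (fobj a);
  fmapM : forall a b c (g : hom b c) (f : hom a b),
    fmap (compm g f) = compm (fmap g) (fmap f) }.

Program Definition functor_id (A : category) : functor A A :=
  @Functor A A (fun a => a) (fun a b f => f) _ _.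

Program Definition functor_comp (A B C : category)
    (G : functor B C) (F : functor A B) : functor A C :=
  @Functor A C (fun a => G (F a)) (fun a b f => fmap G (fmap F f)) _ _.
Next Obligation. by move=> *; rewrite !fmap1. Qed.
Next Obligation. by move=> *; rewrite !fmapM. Qed.

Definition isomorphism (A : category) (a b : A) (f : hom a b) : Prop :=
  exists g : hom b a, compm g f = idm a /\ compm f g = idm b.

Definition naturally_isomorphic (A B : category) (F G : functor A B) : Prop :=
  exists eta : forall a, hom (F a) (G a),
    (forall a b (f : hom a b),
       compm (eta b) (fmap F f) = compm (fmap G f) (eta a)) /\
    (forall a, isomorphism (eta a)).

Definition equivalent_categories (A B : category) : Prop :=
  exists (F : functor A B) (G : functor B A),
    naturally_isomorphic (functor_comp G F) (functor_id A) /\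
    naturally_isomorphic (functor_comp F G) (functor_id B).

(** * Formal power series with coefficients in a module

  [M[[lambda]]] is [nat -> M], [M[[lambda,mu]]] is [nat -> nat -> M] and
  [M[[lambda,mu,nu]]] is [nat -> nat -> nat -> M]; the module structure on
  functions is pointwise, hence coefficientwise on series.  Identities in
  two or three variables are all written in [M[[lambda,mu,nu]]], which
  contains [M[[lambda,mu]]] as the series not involving [nu]. *)

Definition ps1 (M : Type) := nat -> M.
Definition ps2 (M : Type) := nat -> nat -> M.
Definition ps3 (M : Type) := nat -> nat -> nat -> M.

HB.instance Definition _ (M : Type) := gen_eqMixin (ps1 M).
HB.instance Definition _ (M : Type) := gen_choiceMixin (ps1 M).
HB.instance Definition _ (M : zmodType) := GRing.isZmodule.Build (ps1 M)
  (@addrA (nat -> M)) (@addrC (nat -> M))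
  (@add0r (nat -> M)) (@addNr (nat -> M)).
HB.instance Definition _ (R : pzRingType) (M : lmodType R) :=
  GRing.Zmodule_isLmodule.Build R (ps1 M)
    (@scalerA R (nat -> M)) (@scale1r R (nat -> M))
    (@scalerDr R (nat -> M))
    (fun v a b => @scalerDl R (nat -> M) v a b).
HB.instance Definition _ (M : Type) := gen_eqMixin (ps2 M).
HB.instance Definition _ (M : Type) := gen_choiceMixin (ps2 M).
HB.instance Definition _ (M : zmodType) := GRing.isZmodule.Build (ps2 M)
  (@addrA (nat -> nat -> M)) (@addrC (nat -> nat -> M))
  (@add0r (nat -> nat -> M)) (@addNr (nat -> nat -> M)).
HB.instance Definition _ (R : pzRingType) (M : lmodType R) :=
  GRing.Zmodule_isLmodule.Build R (ps2 M)
    (@scalerA R (nat -> nat -> M)) (@scale1r R (nat -> nat -> M))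
    (@scalerDr R (nat -> nat -> M))
    (fun v a b => @scalerDl R (nat -> nat -> M) v a b).
HB.instance Definition _ (M : Type) := gen_eqMixin (ps3 M).
HB.instance Definition _ (M : Type) := gen_choiceMixin (ps3 M).
HB.instance Definition _ (M : zmodType) := GRing.isZmodule.Build (ps3 M)
  (@addrA (nat -> nat -> nat -> M)) (@addrC (nat -> nat -> nat -> M))
  (@add0r (nat -> nat -> nat -> M)) (@addNr (nat -> nat -> nat -> M)).
HB.instance Definition _ (R : pzRingType) (M : lmodType R) :=
  GRing.Zmodule_isLmodule.Build R (ps3 M)
    (@scalerA R (nat -> nat -> nat -> M)) (@scale1r R (nat -> nat -> nat -> M))
    (@scalerDr R (nat -> nat -> nat -> M))
    (fun v a b => @scalerDl R (nat -> nat -> nat -> M) v a b).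

(* multiplication by the variable; on iterated series, by the outermost one *)
Definition mulX (M : zmodType) (a : ps1 M) : ps1 M :=
  fun n => if n is n'.+1 then a n' else 0.

Definition cps (M : zmodType) (x : M) : ps3 M :=
  fun i j k => if (i + j + k == 0)%N then x else 0.
Notation "x %:S" := (cps x) (at level 1, left associativity, format "x %:S").

Definition map_ps (M N : Type) (f : M -> N) (a : ps3 M) : ps3 N :=
  fun i j k => f (a i j k).

(* [(p, q, r)] is the linear form [p lambda + q mu + r nu]; the addition of
   linear forms is that of [nat * nat * nat] *)
Definition linform := (nat * nat * nat)%type.
Definition lam : linform := (1, 0, 0)%N.
Definition mu : linform := (0, 1, 0)%N.
Definition nu : linform := (0, 0, 1)%N.

Definition mul_form (M : zmodType) (l : linform) (a : ps3 M) : ps3 M :=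
  fun i j k => mulX a i j k *+ l.1.1 + mulX (a i) j k *+ l.1.2
               + mulX (a i j) k *+ l.2.

(* Cauchy products along a bilinear, resp. trilinear, map *)
Definition conv2 (M1 M2 : Type) (N : zmodType) (phi : M1 -> M2 -> N)
    (a : ps1 M1) (b : ps1 M2) : ps1 N :=
  fun n => \sum_(i < n.+1) phi (a i) (b (n - i)%N).

Definition conv3 (M1 M2 M3 : Type) (N : zmodType) (phi : M1 -> M2 -> M3 -> N)
    (a : ps1 M1) (b : ps1 M2) (c : ps1 M3) : ps1 N :=
  fun n => \sum_(i < n.+1) \sum_(j < (n - i).+1)
    phi (a i) (b j) (c (n - i - j)%N).

(* [at2 phi l a b] is the series phi_l (a, b) = sum_k l^k phi_k (a, b), phi
   being extended coefficientwise to series.  As l is homogeneous of degree 1,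
   only k <= p + q + r contributes to the coefficient of index (p, q, r). *)
Definition at2 (M1 M2 : Type) (N : zmodType) (phi : M1 -> M2 -> ps1 N)
    (l : linform) (a : ps3 M1) (b : ps3 M2) : ps3 N :=
  fun p q r => \sum_(k < (p + q + r).+1)
    iter k (mul_form l)
      (conv2 (conv2 (conv2 (fun x y => phi x y k))) a b) p q r.

(* likewise, [at3 phi l m a b c] is phi_{l,m} (a, b, c) *)
Definition at3 (M1 M2 M3 : Type) (N : zmodType)
    (phi : M1 -> M2 -> M3 -> ps2 N) (l m : linform)
    (a : ps3 M1) (b : ps3 M2) (c : ps3 M3) : ps3 N :=
  fun p q r => \sum_(k < (p + q + r).+1) \sum_(h < (p + q + r).+1)
    iter k (mul_form l) (iter h (mul_form m)
      (conv3 (conv3 (conv3 (fun x y z => phi x y z k h))) a b c)) p q r.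

(** * Conformal sesquilinear maps

  A C[d]-module is an [lmodType {poly K}] (K is later specialized to the
  complex numbers): [d] acts as ['X *: _] and the scalar [c] as
  [c%:P *: _].  Linear maps out of a tensor product over K are given as
  K-multilinear maps. *)

Section ConformalSesquilinear.
Variable K : fieldType.

Record is_csesq2 (M1 M2 N : lmodType {poly K}) (phi : M1 -> M2 -> ps1 N) :
    Prop := IsCSesq2 {
  csesq2_linl : forall c x x' y,
    phi (c%:P *: x + x') y = c%:P *: phi x y + phi x' y;
  csesq2_linr : forall c x y y',
    phi x (c%:P *: y + y') = c%:P *: phi x y + phi x y';
  csesq2_dl : forall x y, phi ('X *: x) y = - mulX (phi x y);
  csesq2_dr : forall x y, phi x ('X *: y) = 'X *: phi x y + mulX (phi x y) }.

Record csesq2 (M1 M2 N : lmodType {poly K}) := CSesq2 {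
  csesq2_fun :> M1 -> M2 -> ps1 N;
  csesq2P : is_csesq2 csesq2_fun }.

Record is_csesq3 (M1 M2 M3 N : lmodType {poly K})
    (phi : M1 -> M2 -> M3 -> ps2 N) : Prop := IsCSesq3 {
  csesq3_lin1 : forall c x x' y z,
    phi (c%:P *: x + x') y z = c%:P *: phi x y z + phi x' y z;
  csesq3_lin2 : forall c x y y' z,
    phi x (c%:P *: y + y') z = c%:P *: phi x y z + phi x y' z;
  csesq3_lin3 : forall c x y z z',
    phi x y (c%:P *: z + z') = c%:P *: phi x y z + phi x y z';
  csesq3_d1 : forall x y z, phi ('X *: x) y z = - mulX (phi x y z);
  csesq3_d2 : forall x y z,
    phi x ('X *: y) z = - (fun i => mulX (phi x y z i));
  csesq3_d3 : forall x y z, phi x y ('X *: z) =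
    'X *: phi x y z + mulX (phi x y z) + (fun i => mulX (phi x y z i)) }.

Record csesq3 (M1 M2 M3 N : lmodType {poly K}) := CSesq3 {
  csesq3_fun :> M1 -> M2 -> M3 -> ps2 N;
  csesq3P : is_csesq3 csesq3_fun }.

End ConformalSesquilinear.

Section TwoTermLeibInfty.
Variable K : fieldType.

(* rho_2 is split according to the degrees of its arguments; its component on
   G1 * G1 would have degree 2, hence is zero and is not part of the data. *)
Record leib_infty_axioms (G1 G0 : lmodType {poly K}) (d : {linear G1 -> G0})
    (r00 : csesq2 G0 G0 G0) (r01 : csesq2 G0 G1 G1) (r10 : csesq2 G1 G0 G1)
    (r3 : csesq3 G0 G0 G0 G1) : Prop := LeibInftyAxioms {
  li_d01 : forall x u, d \o r01 x u = r00 x (d u);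
  li_d10 : forall u x, d \o r10 u x = r00 (d u) x;
  li_11 : forall u v, r01 (d u) v = r10 u (d v);
  li_jac : forall x y z,
    map_ps d (at3 r3 lam mu x%:S y%:S z%:S) =
      at2 r00 lam x%:S (at2 r00 mu y%:S z%:S)
    - at2 r00 (lam + mu) (at2 r00 lam x%:S y%:S) z%:S
    - at2 r00 mu y%:S (at2 r00 lam x%:S z%:S);
  li_jac3 : forall x y v,
    at3 r3 lam mu x%:S y%:S (d v)%:S =
      at2 r01 lam x%:S (at2 r01 mu y%:S v%:S)
    - at2 r01 (lam + mu) (at2 r00 lam x%:S y%:S) v%:S
    - at2 r01 mu y%:S (at2 r01 lam x%:S v%:S);
  li_jac2 : forall x v y,
    at3 r3 lam mu x%:S (d v)%:S y%:S =
      at2 r01 lam x%:S (at2 r10 mu v%:S y%:S)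
    - at2 r10 (lam + mu) (at2 r01 lam x%:S v%:S) y%:S
    - at2 r10 mu v%:S (at2 r00 lam x%:S y%:S);
  li_jac1 : forall v x y,
    at3 r3 lam mu (d v)%:S x%:S y%:S =
      at2 r10 lam v%:S (at2 r00 mu x%:S y%:S)
    - at2 r10 (lam + mu) (at2 r10 lam v%:S x%:S) y%:S
    - at2 r01 mu x%:S (at2 r10 lam v%:S y%:S);
  li_coh : forall x y z w,
      at2 r01 lam x%:S (at3 r3 mu nu y%:S z%:S w%:S)
    - at2 r01 mu y%:S (at3 r3 lam nu x%:S z%:S w%:S)
    + at2 r01 nu z%:S (at3 r3 lam mu x%:S y%:S w%:S)
    + at2 r10 (lam + mu + nu) (at3 r3 lam mu x%:S y%:S z%:S) w%:S
    - at3 r3 (lam + mu) nu (at2 r00 lam x%:S y%:S) z%:S w%:S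
    - at3 r3 mu (lam + nu) y%:S (at2 r00 lam x%:S z%:S) w%:S
    - at3 r3 mu nu y%:S z%:S (at2 r00 lam x%:S w%:S)
    + at3 r3 lam (mu + nu) x%:S (at2 r00 mu y%:S z%:S) w%:S
    + at3 r3 lam nu x%:S z%:S (at2 r00 mu y%:S w%:S)
    - at3 r3 lam mu x%:S y%:S (at2 r00 nu z%:S w%:S) = 0 }.

Record leib_infty := LeibInfty {
  li1 : lmodType {poly K};
  li0 : lmodType {poly K};
  lid : {linear li1 -> li0};
  r00 : csesq2 li0 li0 li0;
  r01 : csesq2 li0 li1 li1;
  r10 : csesq2 li1 li0 li1;
  r3 : csesq3 li0 li0 li0 li1;
  leib_inftyP : leib_infty_axioms lid r00 r01 r10 r3 }.
Arguments lid {l}.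
Arguments r00 {l}.
Arguments r01 {l}.
Arguments r10 {l}.
Arguments r3 {l}.

Record li_hom_axioms (G G' : leib_infty) (f0 : {linear li0 G -> li0 G'})
    (f1 : {linear li1 G -> li1 G'}) (f2 : csesq2 (li0 G) (li0 G) (li1 G')) :
    Prop := LiHomAxioms {
  lih_d : forall u, lid (f1 u) = f0 (lid u);
  lih_00 : forall x y, r00 (f0 x) (f0 y) - (f0 \o r00 x y) = lid \o f2 x y;
  lih_01 : forall x v, r01 (f0 x) (f1 v) - (f1 \o r01 x v) = f2 x (lid v);
  lih_10 : forall v x, r10 (f1 v) (f0 x) - (f1 \o r10 v x) = f2 (lid v) x;
  lih_coh : forall x y z,
      at3 r3 lam mu (f0 x)%:S (f0 y)%:S (f0 z)%:S
    - map_ps f1 (at3 r3 lam mu x%:S y%:S z%:S) =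
      at2 r01 lam (f0 x)%:S (at2 f2 mu y%:S z%:S)
    - at2 r10 (lam + mu) (at2 f2 lam x%:S y%:S) (f0 z)%:S
    - at2 r01 mu (f0 y)%:S (at2 f2 lam x%:S z%:S)
    + at2 f2 lam x%:S (at2 r00 mu y%:S z%:S)
    - at2 f2 (lam + mu) (at2 r00 lam x%:S y%:S) z%:S
    - at2 f2 mu y%:S (at2 r00 lam x%:S z%:S) }.

Record li_hom (G G' : leib_infty) := LiHom {
  lih0 : {linear li0 G -> li0 G'};
  lih1 : {linear li1 G -> li1 G'};
  lih2 : csesq2 (li0 G) (li0 G) (li1 G');
  li_homP : li_hom_axioms lih0 lih1 lih2 }.

End TwoTermLeibInfty.

Section LeibnizTwoAlgebras.
Variable K : fieldType.

(* [vcmp f g] is f followed by g; only its values on composable pairs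
   (tgt f = src g) are constrained or used. *)
Record two_vect_axioms (C0 C1 : lmodType {poly K}) (src tgt : {linear C1 -> C0})
    (idn : {linear C0 -> C1}) (cmp : C1 -> C1 -> C1) : Prop := TwoVectAxioms {
  tv_src1 : forall x, src (idn x) = x;
  tv_tgt1 : forall x, tgt (idn x) = x;
  tv_src : forall f g, tgt f = src g -> src (cmp f g) = src f;
  tv_tgt : forall f g, tgt f = src g -> tgt (cmp f g) = tgt g;
  tv_1f : forall f, cmp (idn (src f)) f = f;
  tv_f1 : forall f, cmp f (idn (tgt f)) = f;
  tv_A : forall f g h, tgt f = src g -> tgt g = src h ->
    cmp f (cmp g h) = cmp (cmp f g) h;
  tv_linear : forall (p : {poly K}) f g f' g',
    tgt f = src g -> tgt f' = src g' ->
    cmp (p *: f + f') (p *: g + g') = p *: cmp f g + cmp f' g' }.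

Record two_vect := TwoVect {
  vob : lmodType {poly K};
  vmor : lmodType {poly K};
  vsrc : {linear vmor -> vob};
  vtgt : {linear vmor -> vob};
  vid : {linear vob -> vmor};
  vcmp : vmor -> vmor -> vmor;
  two_vectP : two_vect_axioms vsrc vtgt vid vcmp }.
Arguments vsrc {t}.
Arguments vtgt {t}.
Arguments vid {t}.
Arguments vcmp {t} f g.

Definition composable (C : two_vect) (f g : vmor C) := vtgt f = vsrc g.

Definition inverse_morphisms (C : two_vect) (f g : vmor C) : Prop :=
  [/\ composable f g, composable g f,
      vcmp f g = vid (vsrc f) & vcmp g f = vid (vsrc g)].

Definition cmp_ps (C : two_vect) (a b : ps3 (vmor C)) : ps3 (vmor C) :=
  fun i j k => vcmp (a i j k) (b i j k).
Local Notation "a ';;' b" := (cmp_ps a b) (at level 52, left associativity).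

Definition id_ps (C : two_vect) (a : ps3 (vob C)) : ps3 (vmor C) :=
  map_ps vid a.

Record is_functor (C C' : two_vect) (F0 : {linear vob C -> vob C'})
    (F1 : {linear vmor C -> vmor C'}) : Prop := IsFunctor {
  fun_src : forall f, vsrc (F1 f) = F0 (vsrc f);
  fun_tgt : forall f, vtgt (F1 f) = F0 (vtgt f);
  fun_id : forall x, F1 (vid x) = vid (F0 x);
  fun_cmp : forall f g, composable f g ->
    F1 (vcmp f g) = vcmp (F1 f) (F1 g) }.

Record bracket_functor (C : two_vect) (b0 : csesq2 (vob C) (vob C) (vob C))
    (b1 : csesq2 (vmor C) (vmor C) (vmor C)) : Prop := BracketFunctor {
  br_src : forall f g, vsrc \o b1 f g = b0 (vsrc f) (vsrc g);
  br_tgt : forall f g, vtgt \o b1 f g = b0 (vtgt f) (vtgt g);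
  br_id : forall x y, b1 (vid x) (vid y) = vid \o b0 x y;
  br_cmp : forall f f' g g', composable f f' -> composable g g' ->
    forall k, b1 (vcmp f f') (vcmp g g') k = vcmp (b1 f g k) (b1 f' g' k) }.

Record leibnizator_axioms (C : two_vect) (b0 : csesq2 (vob C) (vob C) (vob C))
    (b1 : csesq2 (vmor C) (vmor C) (vmor C))
    (L : csesq3 (vob C) (vob C) (vob C) (vmor C)) : Prop := LeibnizatorAxioms {
  lz_src : forall x y z,
    map_ps vsrc (at3 L lam mu x%:S y%:S z%:S) =
      at2 b0 lam x%:S (at2 b0 mu y%:S z%:S);
  lz_tgt : forall x y z,
    map_ps vtgt (at3 L lam mu x%:S y%:S z%:S) =
      at2 b0 (lam + mu) (at2 b0 lam x%:S y%:S) z%:S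
    + at2 b0 mu y%:S (at2 b0 lam x%:S z%:S);
  lz_nat : forall f g h : vmor C,
    at2 b1 lam f%:S (at2 b1 mu g%:S h%:S)
      ;; at3 L lam mu (vtgt f)%:S (vtgt g)%:S (vtgt h)%:S =
    at3 L lam mu (vsrc f)%:S (vsrc g)%:S (vsrc h)%:S
      ;; (at2 b1 (lam + mu) (at2 b1 lam f%:S g%:S) h%:S
          + at2 b1 mu g%:S (at2 b1 lam f%:S h%:S));
  lz_iso : forall x y z, exists L' : ps2 (vmor C),
    forall i j, inverse_morphisms (L x y z i j) (L' i j);
  lz_coh : forall x y z w : vob C,
    at2 b1 lam (vid x)%:S (at3 L mu nu y%:S z%:S w%:S)
      ;; (at3 L lam (mu + nu) x%:S (at2 b0 mu y%:S z%:S) w%:S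
          + at3 L lam nu x%:S z%:S (at2 b0 mu y%:S w%:S))
      ;; (at2 b1 (lam + mu + nu) (at3 L lam mu x%:S y%:S z%:S) (vid w)%:S
          + id_ps (at2 b0 (mu + nu) (at2 b0 mu y%:S z%:S)
                                    (at2 b0 lam x%:S w%:S))
          + id_ps (at2 b0 (lam + nu) (at2 b0 lam x%:S z%:S)
                                     (at2 b0 mu y%:S w%:S))
          + at2 b1 nu (vid z)%:S (at3 L lam mu x%:S y%:S w%:S)) =
    at3 L lam mu x%:S y%:S (at2 b0 nu z%:S w%:S)
      ;; (id_ps (at2 b0 (lam + mu) (at2 b0 lam x%:S y%:S)
                                   (at2 b0 nu z%:S w%:S))
          + at2 b1 mu (vid y)%:S (at3 L lam nu x%:S z%:S w%:S))
      ;; (at3 L (lam + mu) nu (at2 b0 lam x%:S y%:S) z%:S w%:S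
          + at3 L mu (lam + nu) y%:S (at2 b0 lam x%:S z%:S) w%:S
          + at3 L mu nu y%:S z%:S (at2 b0 lam x%:S w%:S)) }.

Record leib2 := Leib2 {
  l2C :> two_vect;
  b0 : csesq2 (vob l2C) (vob l2C) (vob l2C);
  b1 : csesq2 (vmor l2C) (vmor l2C) (vmor l2C);
  lz : csesq3 (vob l2C) (vob l2C) (vob l2C) (vmor l2C);
  b_functor : bracket_functor b0 b1;
  lzP : leibnizator_axioms b0 b1 lz }.
Arguments b0 {l}.
Arguments b1 {l}.
Arguments lz {l}.

Record l2_hom_axioms (C C' : leib2) (F0 : {linear vob C -> vob C'})
    (F1 : {linear vmor C -> vmor C'}) (F2 : csesq2 (vob C) (vob C) (vmor C')) :
    Prop := L2HomAxioms {
  l2h_functor : is_functor F0 F1;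
  l2h_src : forall x y, vsrc \o F2 x y = b0 (F0 x) (F0 y);
  l2h_tgt : forall x y, vtgt \o F2 x y = F0 \o b0 x y;
  l2h_nat : forall (f g : vmor C) k,
    vcmp (b1 (F1 f) (F1 g) k) (F2 (vtgt f) (vtgt g) k) =
    vcmp (F2 (vsrc f) (vsrc g) k) (F1 (b1 f g k));
  l2h_iso : forall x y, exists F2' : ps1 (vmor C'),
    forall k, inverse_morphisms (F2 x y k) (F2' k);
  l2h_coh : forall x y z,
    at3 lz lam mu (F0 x)%:S (F0 y)%:S (F0 z)%:S
      ;; (at2 b1 (lam + mu) (at2 F2 lam x%:S y%:S) (vid (F0 z))%:S
          + at2 b1 mu (vid (F0 y))%:S (at2 F2 lam x%:S z%:S))
      ;; (at2 F2 (lam + mu) (at2 b0 lam x%:S y%:S) z%:S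
          + at2 F2 mu y%:S (at2 b0 lam x%:S z%:S)) =
    at2 b1 lam (vid (F0 x))%:S (at2 F2 mu y%:S z%:S)
      ;; at2 F2 lam x%:S (at2 b0 mu y%:S z%:S)
      ;; map_ps F1 (at3 lz lam mu x%:S y%:S z%:S) }.

Record l2_hom (C C' : leib2) := L2Hom {
  l2h0 : {linear vob C -> vob C'};
  l2h1 : {linear vmor C -> vmor C'};
  l2h2 : csesq2 (vob C) (vob C) (vmor C');
  l2_homP : l2_hom_axioms l2h0 l2h1 l2h2 }.

End LeibnizTwoAlgebras.

Arguments lid {K l}.
Arguments r00 {K l}.
Arguments r01 {K l}.
Arguments r10 {K l}.
Arguments r3 {K l}.
Arguments vsrc {K t}.
Arguments vtgt {K t}.
Arguments vid {K t}.
Arguments vcmp {K t} f g.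
Arguments b0 {K l}.
Arguments b1 {K l}.
Arguments lz {K l}.
Arguments lih0 {K G G'} _.
Arguments lih1 {K G G'} _.
Arguments lih2 {K G G'} _.
Arguments l2h0 {K C C'} _.
Arguments l2h1 {K C C'} _.
Arguments l2h2 {K C C'} _.

Section ZmodEquations.
Variable M : zmodType.

Inductive zterm :=
  | Zvar of nat | Zero | Zadd of zterm & zterm | Zopp of zterm.

Fixpoint zeval (e : seq M) (t : zterm) : M :=
  match t with
  | Zvar n => e`_n
  | Zero => 0
  | Zadd t u => zeval e t + zeval e u
  | Zopp t => - zeval e t
  end.

Fixpoint zcoef (t : zterm) (n : nat) : int :=
  match t with
  | Zvar m => if m == n then 1 else 0
  | Zero => 0
  | Zadd t u => zcoef t n + zcoef u n
  | Zopp t => - zcoef t n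
  end.

Lemma zevalE e t : zeval e t = \sum_(i < size e) e`_i *~ zcoef t i.
Proof.
elim: t => [n||t IHt u IHu|t IHt] /=.
- case: (ltnP n (size e)) => le_n.
    rewrite (bigD1 (Ordinal le_n)) //= eqxx mulr1z big1 ?addr0 // => i ne_in.
    by rewrite -val_eqE /= eq_sym in ne_in; rewrite (negbTE ne_in).
  rewrite nth_default // big1 // => i _; case: eqP => // n_i.
  by have := ltn_ord i; rewrite -n_i ltnNge le_n.
- by rewrite big1.
- by rewrite IHt IHu -big_split; apply: eq_bigr => i _; rewrite mulrzDr.
- by rewrite IHt -sumrN; apply: eq_bigr => i _; rewrite mulrNz.
Qed.

Lemma zevalP e t u :
  all (fun i => zcoef t i == zcoef u i) (iota 0 (size e)) ->
  zeval e t = zeval e u.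
Proof.
move=> /allP eq_tu; rewrite !zevalE; apply: eq_bigr => i _; congr (_ *~ _).
by apply/eqP/eq_tu; rewrite mem_iota add0n /=.
Qed.
End ZmodEquations.
#[global] Strategy expand [zeval nth].

Ltac zmod_index_syntactic x e :=
  match e with
  | x :: _ => constr:(0%N)
  | _ :: ?e' => let n := zmod_index_syntactic x e' in constr:(S n)
  end.
Ltac zmod_index_unify x e :=
  match e with
  | ?y :: _ => let _ := lazymatch goal with _ => unify x y end in constr:(0%N)
  | _ :: ?e' => let n := zmod_index_unify x e' in constr:(S n)
  end.
Ltac zmod_index x e :=
  match e with
  | _ => zmod_index_syntactic x e
  | _ => zmod_index_unify x e
  end.
Ltac zmod_atoms t e :=
  lazymatch t with
  | (?a + ?b)%R => let e' := zmod_atoms a e in zmod_atoms b e'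
  | (- ?a)%R => zmod_atoms a e
  | (0)%R => e
  | ?x => match e with
          | _ => let n := zmod_index x e in e
          | _ => constr:(x :: e)
          end
  end.
Ltac zmod_reify t e :=
  lazymatch t with
  | (?a + ?b)%R =>
      let a' := zmod_reify a e in let b' := zmod_reify b e in
      constr:(Zadd a' b')
  | (- ?a)%R => let a' := zmod_reify a e in constr:(Zopp a')
  | (0)%R => constr:(Zero)
  | ?x => let n := zmod_index x e in constr:(Zvar n)
  end.
Ltac zmod :=
  lazymatch goal with
  | |- @eq ?T ?l ?r =>
      let e := zmod_atoms l (@nil T) in
      let e := zmod_atoms r e in
      let l' := zmod_reify l e in
      let r' := zmod_reify r e in
      let H := fresh in
      pose proof (@zevalP _ e l' r' (erefl true)) as H;
      cbn [zeval nth] in H; exact: H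
  end.

Section Series.
Implicit Types (M N : zmodType).

Lemma ps1DE M (a b : ps1 M) n : (a + b) n = a n + b n.
Proof. by []. Qed.

Lemma ps3DE M (a b : ps3 M) p q r : (a + b) p q r = a p q r + b p q r.
Proof. by []. Qed.

Lemma ps3BE M (a b : ps3 M) p q r : (a - b) p q r = a p q r - b p q r.
Proof. by []. Qed.

Lemma ps3P M (a b : ps3 M) : (forall p q r, a p q r = b p q r) -> a = b.
Proof.
by move=> ab; apply/funext=> p; apply/funext=> q; apply/funext=> r.
Qed.

Lemma mul_formB M l (a b : ps3 M) :
  mul_form l (a - b) = mul_form l a - mul_form l b.
Proof.
apply: ps3P => p q r; rewrite ps3BE /mul_form.
have -> : mulX (a - b) p q r = mulX a p q r - mulX b p q r.
  by case: p => [|p] //=; rewrite -[RHS]/(0 - 0 : M) subrr.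
have -> : mulX ((a - b) p) q r = mulX (a p) q r - mulX (b p) q r.
  by case: q => [|q] //=; rewrite -[RHS]/(0 - 0 : M) subrr.
have -> : mulX ((a - b) p q) r = mulX (a p q) r - mulX (b p q) r.
  by case: r => [|r] //=; rewrite subrr.
by rewrite !mulrnBl; zmod.
Qed.

Lemma iter_mul_formB M l k (a b : ps3 M) :
  iter k (mul_form l) (a - b) = iter k (mul_form l) a - iter k (mul_form l) b.
Proof. by elim: k => //= k ->; rewrite mul_formB. Qed.

Lemma map_mul_form M N (h : {additive M -> N}) l k (a : ps3 M) :
  map_ps h (iter k (mul_form l) a) = iter k (mul_form l) (map_ps h a).
Proof.
elim: k => //= k <-; set b := iter k _ a.
apply: ps3P => p q r.
rewrite /map_ps /mul_form !raddfD !raddfMn.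
by congr (_ *+ _ + _ *+ _ + _ *+ _);
  [case: p | case: q | case: r] => // *; rewrite /= raddf0.
Qed.

Lemma conv2Br (M1 M2 : zmodType) N (phi : M1 -> M2 -> N) :
  (forall x y y', phi x (y - y') = phi x y - phi x y') ->
  forall a b b', conv2 phi a (b - b') = conv2 phi a b - conv2 phi a b'.
Proof.
move=> phiB a b b'; apply/funext=> n; rewrite [RHS]/= /conv2.
by under eq_bigr => i _ do rewrite phiB; rewrite sumrB.
Qed.

Lemma conv2Bl (M1 M2 : zmodType) N (phi : M1 -> M2 -> N) :
  (forall x x' y, phi (x - x') y = phi x y - phi x' y) ->
  forall a a' b, conv2 phi (a - a') b = conv2 phi a b - conv2 phi a' b.
Proof.
move=> phiB a b b'; apply/funext=> n; rewrite [RHS]/= /conv2.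
by under eq_bigr => i _ do rewrite phiB; rewrite sumrB.
Qed.

Lemma conv2Bf (M1 M2 : Type) N (phi psi : M1 -> M2 -> N) :
  conv2 (phi - psi) = conv2 phi - conv2 psi.
Proof.
by apply/funext=> a; apply/funext=> b; apply/funext=> n; rewrite /conv2 sumrB.
Qed.

Lemma map_conv2 (M1 M2 : Type) N N' (h : N -> N') (phi : M1 -> M2 -> N) :
  h 0 = 0 -> (forall x y, h (x + y) = h x + h y) ->
  forall a b, h \o conv2 phi a b = conv2 (fun x y => h (phi x y)) a b.
Proof.
move=> h0 hD a b; apply/funext=> n; rewrite /conv2 /=.
exact: (big_morph h hD h0).
Qed.

Variables (M1 M2 : zmodType) (N : zmodType).
Implicit Types (phi psi : M1 -> M2 -> ps1 N) (l : linform).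

Lemma at2Br phi l a b b' :
  (forall x y y', phi x (y - y') = phi x y - phi x y') ->
  at2 phi l a (b - b') = at2 phi l a b - at2 phi l a b'.
Proof.
move=> phiB; apply: ps3P => p q r.
rewrite ps3BE /at2 -sumrB; apply: eq_bigr => k _.
rewrite -ps3BE -iter_mul_formB; congr (iter k _ _ _ _ _).
by rewrite !conv2Br // => *; rewrite ?conv2Br // => *;
  rewrite ?conv2Br // => *; rewrite phiB.
Qed.

Lemma at2Bl phi l a a' b :
  (forall x x' y, phi (x - x') y = phi x y - phi x' y) ->
  at2 phi l (a - a') b = at2 phi l a b - at2 phi l a' b.
Proof.
move=> phiB; apply: ps3P => p q r.
rewrite ps3BE /at2 -sumrB; apply: eq_bigr => k _.
rewrite -ps3BE -iter_mul_formB; congr (iter k _ _ _ _ _).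
by rewrite !conv2Bl // => *; rewrite ?conv2Bl // => *;
  rewrite ?conv2Bl // => *; rewrite phiB.
Qed.

Lemma at2Bf phi psi l a b :
  at2 (fun x y => phi x y - psi x y) l a b = at2 phi l a b - at2 psi l a b.
Proof.
apply: ps3P => p q r.
rewrite ps3BE /at2 -sumrB; apply: eq_bigr => k _.
rewrite -ps3BE -iter_mul_formB; congr (iter k _ _ _ _ _).
by rewrite -[fun x y => _]/((fun x y => phi x y k) - (fun x y => psi x y k))
  !conv2Bf.
Qed.

Lemma at2_0f l a b : at2 (fun (_ : M1) (_ : M2) => 0 : ps1 N) l a b = 0.
Proof.
set z := (X in at2 X).
have -> : z = fun x y => z x y - z x y.
  by apply/funext=> x; apply/funext=> y; rewrite subrr.
by rewrite at2Bf subrr.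
Qed.

Lemma at2Df phi psi l a b :
  at2 (fun x y => phi x y + psi x y) l a b = at2 phi l a b + at2 psi l a b.
Proof.
have -> : (fun x y => phi x y + psi x y) = (fun x y => phi x y - (0 - psi x y)).
  by apply/funext=> x; apply/funext=> y; zmod.
by rewrite !at2Bf at2_0f; zmod.
Qed.

Lemma at2_0r phi l a :
  (forall x y y', phi x (y - y') = phi x y - phi x y') -> at2 phi l a 0 = 0.
Proof.
by move=> phiB; have := at2Br l a 0 0 phiB; rewrite !subrr.
Qed.

Lemma at2_0l phi l b :
  (forall x x' y, phi (x - x') y = phi x y - phi x' y) -> at2 phi l 0 b = 0.
Proof.
by move=> phiB; have := at2Bl l 0 0 b phiB; rewrite !subrr.
Qed.

Lemma at2Dr phi l a b b' :
  (forall x y y', phi x (y - y') = phi x y - phi x y') ->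
  at2 phi l a (b + b') = at2 phi l a b + at2 phi l a b'.
Proof.
move=> phiB; have -> : b + b' = b - (0 - b') by zmod.
by rewrite !at2Br // at2_0r //; zmod.
Qed.

Lemma at2Dl phi l a a' b :
  (forall x x' y, phi (x - x') y = phi x y - phi x' y) ->
  at2 phi l (a + a') b = at2 phi l a b + at2 phi l a' b.
Proof.
move=> phiB; have -> : a + a' = a - (0 - a') by zmod.
by rewrite !at2Bl // at2_0l //; zmod.
Qed.

Lemma map_at2 (N' : zmodType) (h : {additive N -> N'}) phi l a b :
  map_ps h (at2 phi l a b) = at2 (fun x y => h \o phi x y) l a b.
Proof.
apply: ps3P => p q r.
rewrite /map_ps /at2 raddf_sum; apply: eq_bigr => k _.
rewrite -[LHS]/(map_ps h _ p q r) map_mul_form; congr (iter k _ _ _ _ _).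
pose h1 (a : ps1 N) : ps1 N' := h \o a.
pose h2 (a : ps2 N) : ps2 N' := fun i => h1 (a i).
have h10 : h1 0 = 0 by apply/funext=> i; rewrite /h1 /= raddf0.
have h1D x y : h1 (x + y) = h1 x + h1 y.
  by apply/funext=> i; rewrite /h1 /= raddfD.
have h20 : h2 0 = 0 by apply/funext=> i; exact: h10.
have h2D x y : h2 (x + y) = h2 x + h2 y by apply/funext=> i; exact: h1D.
rewrite -[LHS]/(h2 \o conv2 (conv2 (conv2 (fun x y => phi x y k))) a b).
rewrite map_conv2 //; congr (conv2 _ a b).
apply/funext=> x; apply/funext=> y.
rewrite -[LHS]/(h1 \o conv2 (conv2 (fun x y => phi x y k)) x y).
rewrite map_conv2 //; congr (conv2 _ x y).
apply/funext=> x'; apply/funext=> y'.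
by rewrite -[LHS]/(h \o conv2 (fun x y => phi x y k) x' y')
  map_conv2 ?raddf0 //; exact: raddfD.
Qed.

Lemma at2_map (M1' M2' : Type) (f : M1' -> M1) (g : M2' -> M2) phi l a b :
  at2 phi l (map_ps f a) (map_ps g b) = at2 (fun x y => phi (f x) (g y)) l a b.
Proof. by []. Qed.

Lemma at2_mapl (M1' : Type) (f : M1' -> M1) phi l a b :
  at2 phi l (map_ps f a) b = at2 (fun x y => phi (f x) y) l a b.
Proof. by []. Qed.

Lemma at2_mapr (M2' : Type) (g : M2' -> M2) phi l a b :
  at2 phi l a (map_ps g b) = at2 (fun x y => phi x (g y)) l a b.
Proof. by []. Qed.

Lemma map_cps (h : {additive M1 -> N}) x : map_ps h x%:S = (h x)%:S.
Proof.
apply: ps3P => p q r.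
by rewrite /map_ps /cps; case: ifP => // _; rewrite raddf0.
Qed.

Lemma map_psB (h : {additive M1 -> N}) a b :
  map_ps h (a - b) = map_ps h a - map_ps h b.
Proof.
by apply: ps3P => p q r; exact: raddfB.
Qed.

Lemma map_psD (h : {additive M1 -> N}) a b :
  map_ps h (a + b) = map_ps h a + map_ps h b.
Proof.
by apply: ps3P => p q r; exact: raddfD.
Qed.

End Series.

Section CSesqTheory.
Variable K : fieldType.
Implicit Types (M N : lmodType {poly K}).

Lemma linear_ext M N (f g : {linear M -> N}) : f =1 g -> f = g.
Proof.
case: f => f [[f1] [f2]]; case: g => g [[g1] [g2]] /= /funext fg; subst g.
by congr GRing.Linear.Pack; congr GRing.Linear.Class;
  [congr Algebra.isNmodMorphism.Axioms_ | congr GRing.isScalable.Axioms_];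
  exact: Prop_irrelevance.
Qed.

Lemma csesq2_ext (M1 M2 N : lmodType {poly K}) (phi psi : csesq2 M1 M2 N) :
  (forall x y k, phi x y k = psi x y k) -> phi = psi.
Proof.
case: phi psi => phi phiP [psi psiP] /= eq_pp.
have eq_f : phi = psi.
  by apply/funext=> x; apply/funext=> y; apply/funext=> k.
by subst psi; congr CSesq2; exact: Prop_irrelevance.
Qed.

Lemma csesq2Bl (M1 M2 N : lmodType {poly K}) (phi : csesq2 M1 M2 N) x x' y :
  phi (x - x') y = phi x y - phi x' y.
Proof.
rewrite addrC -scaleN1r -polyCN (csesq2_linl (csesq2P phi)) polyCN.
by rewrite scaleN1r addrC.
Qed.

Lemma csesq2Br (M1 M2 N : lmodType {poly K}) (phi : csesq2 M1 M2 N) x y y' :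
  phi x (y - y') = phi x y - phi x y'.
Proof.
rewrite addrC -scaleN1r -polyCN (csesq2_linr (csesq2P phi)) polyCN.
by rewrite scaleN1r addrC.
Qed.

Lemma mulX_comp M N (h : {linear M -> N}) (a : ps1 M) :
  h \o mulX a = mulX (h \o a).
Proof. by apply/funext=> -[|n] //=; rewrite linear0. Qed.

Lemma is_csesq2_0 M1 M2 N : @is_csesq2 K M1 M2 N 0.
Proof.
have E x y : (0 : M1 -> M2 -> ps1 N) x y = 0 by [].
have mulX0 : mulX (0 : ps1 N) = 0 by apply/funext=> -[|n].
by split=> *; rewrite !E ?mulX0 ?scaler0 ?oppr0 ?addr0.
Qed.

Lemma is_csesq2D M1 M2 N (phi psi : M1 -> M2 -> ps1 N) :
  is_csesq2 phi -> is_csesq2 psi ->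
  is_csesq2 (fun x y => phi x y + psi x y).
Proof.
case=> h1 h2 h3 h4 [g1 g2 g3 g4].
have mulXD (a b : ps1 N) : mulX (a + b) = mulX a + mulX b.
  by apply/funext=> -[|n]; rewrite -[RHS]/(mulX a _ + mulX b _) /= ?addr0.
split=> *.
- by rewrite h1 g1 scalerDr addrACA.
- by rewrite h2 g2 scalerDr addrACA.
- by rewrite h3 g3 mulXD opprD.
- by rewrite h4 g4 mulXD scalerDr addrACA.
Qed.

Lemma is_csesq2_pre M1 M2 M1' M2' N (f : {linear M1 -> M1'})
    (g : {linear M2 -> M2'}) (phi : M1' -> M2' -> ps1 N) :
  is_csesq2 phi -> is_csesq2 (fun x y => phi (f x) (g y)).
Proof.
case=> h1 h2 h3 h4.
by split=> *; rewrite ?linearP ?linearZ /= ?h1 ?h2 ?h3 ?h4.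
Qed.

Lemma is_csesq2_post M1 M2 N N' (h : {linear N -> N'})
    (phi : M1 -> M2 -> ps1 N) :
  is_csesq2 phi -> is_csesq2 (fun x y => h \o phi x y).
Proof.
case=> h1 h2 h3 h4; split=> *; rewrite ?h1 ?h2 ?h3 ?h4 -?mulX_comp;
  by apply/funext=> k; rewrite !fctE /= ?linearD ?linearN ?linearZ.
Qed.

Lemma is_csesq2_eq M1 M2 N (phi psi : M1 -> M2 -> ps1 N) :
  (forall x y k, phi x y k = psi x y k) -> is_csesq2 psi -> is_csesq2 phi.
Proof.
move=> eq_pp; suff -> : phi = psi by [].
by apply/funext=> x; apply/funext=> y; apply/funext=> k.
Qed.

End CSesqTheory.

Section TwoLeibInftyCategory.
Variable K : fieldType.

Definition li_id_2 (G : leib_infty K) : csesq2 (li0 G) (li0 G) (li1 G) :=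
  CSesq2 (is_csesq2_0 (li0 G) (li0 G) (li1 G)).

Lemma li_id_subproof (G : leib_infty K) :
  li_hom_axioms (G := G) (G' := G) idfun idfun (li_id_2 G).
Proof.
split=> //.
- by move=> x y; rewrite subrr; apply/funext=> k; rewrite /= linear0.
- by move=> x v; rewrite subrr.
- by move=> v x; rewrite subrr.
move=> x y z; rewrite !at2_0f subrr.
rewrite (at2_0r _ _ (csesq2Br r01)) (at2_0l _ _ (csesq2Bl r10)).
by rewrite (at2_0r _ _ (csesq2Br r01)); zmod.
Qed.

Definition li_id (G : leib_infty K) : li_hom G G := LiHom (li_id_subproof G).

Section LiComp.
Variables (G G' G'' : leib_infty K) (g : li_hom G' G'') (f : li_hom G G').

Definition li_comp_0 : {linear li0 G -> li0 G''} := lih0 g \o lih0 f.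
Definition li_comp_1 : {linear li1 G -> li1 G''} := lih1 g \o lih1 f.

Lemma li_comp_2_subproof :
  is_csesq2 (fun x y : li0 G =>
    lih2 g (lih0 f x) (lih0 f y) + (lih1 g \o lih2 f x y)).
Proof.
by apply: is_csesq2D; [apply: is_csesq2_pre | apply: is_csesq2_post];
  exact: csesq2P.
Qed.
Definition li_comp_2 := CSesq2 li_comp_2_subproof.

Lemma li_comp_subproof : li_hom_axioms li_comp_0 li_comp_1 li_comp_2.
Proof.
have [gd g00 g01 g10 gc] := li_homP g; have [fd f00 f01 f10 fc] := li_homP f.
split.
- by move=> u; rewrite /li_comp_1 /li_comp_0 /= gd fd.
- move=> x y; apply/funext=> k.
  have := congr1 (fun h => h k) (g00 (lih0 f x) (lih0 f y)).
  have := congr1 (fun h => h k) (f00 x y).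
  rewrite !fctE /= ps1DE /= linearD /= gd => <-; rewrite linearB /= => <-.
  by zmod.
- move=> x v; apply/funext=> k.
  have := congr1 (fun h => h k) (g01 (lih0 f x) (lih1 f v)).
  have := congr1 (fun h => h k) (f01 x v).
  by rewrite !fctE /= ps1DE /= fd => <-; rewrite linearB /= => <-; zmod.
- move=> v x; apply/funext=> k.
  have := congr1 (fun h => h k) (g10 (lih1 f v) (lih0 f x)).
  have := congr1 (fun h => h k) (f10 v x).
  by rewrite !fctE /= ps1DE /= fd => <-; rewrite linearB /= => <-; zmod.
have E2 l a b : at2 li_comp_2 l a b =
    at2 (lih2 g) l (map_ps (lih0 f) a) (map_ps (lih0 f) b)
    + map_ps (lih1 g) (at2 (lih2 f) l a b).
  by rewrite map_at2 at2_map -at2Df.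
have E00 l a b : map_ps (lih0 f) (at2 r00 l a b) =
    at2 r00 l (map_ps (lih0 f) a) (map_ps (lih0 f) b)
    - map_ps lid (at2 (lih2 f) l a b).
  rewrite !map_at2 at2_map -at2Bf.
  congr (at2 _ _ _ _); apply/funext=> x; apply/funext=> y.
  by rewrite -f00 /=; zmod.
have E01 l a b : at2 r01 l (map_ps (lih0 g) a) (map_ps (lih1 g) b) =
    at2 (lih2 g) l a (map_ps lid b) + map_ps (lih1 g) (at2 r01 l a b).
  rewrite !map_at2 at2_map at2_mapr -at2Df.
  congr (at2 _ _ _ _); apply/funext=> x; apply/funext=> y.
  by rewrite -g01 /=; zmod.
have E10 l a b : at2 r10 l (map_ps (lih1 g) a) (map_ps (lih0 g) b) =
    at2 (lih2 g) l (map_ps lid a) b + map_ps (lih1 g) (at2 r10 l a b).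
  rewrite !map_at2 at2_map at2_mapl -at2Df.
  congr (at2 _ _ _ _); apply/funext=> x; apply/funext=> y.
  by rewrite -g10 /=; zmod.
move=> x y z.
have := congr1 (map_ps (lih1 g)) (fc x y z).
have := gc (lih0 f x) (lih0 f y) (lih0 f z).
rewrite !(map_psB, map_psD) /=.
rewrite -[(li_comp_0 x)%:S]/((lih0 g (lih0 f x))%:S).
rewrite -[(li_comp_0 y)%:S]/((lih0 g (lih0 f y))%:S).
rewrite -[(li_comp_0 z)%:S]/((lih0 g (lih0 f z))%:S).
rewrite -[map_ps li_comp_1 _]/(map_ps (lih1 g) (map_ps (lih1 f) _)).
rewrite -!(map_cps (lih0 g)) -!(map_cps (lih0 f)) !E2.
rewrite !(at2Dr _ _ _ _ (csesq2Br r01)) !(at2Dl _ _ _ _ (csesq2Bl r10)).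
rewrite !E01 !E10 !E00 !(at2Br _ _ _ _ (csesq2Br (lih2 g))).
rewrite !(at2Bl _ _ _ _ (csesq2Bl (lih2 g))).
have subr_split (V : zmodType) (A B C X Y : V) :
  A - B = X -> B - C = Y -> A - C = X + Y by move=> <- <-; zmod.
by move=> /subr_split gE /gE ->; zmod.
Qed.

Definition li_comp : li_hom G G'' := LiHom li_comp_subproof.
End LiComp.

Lemma li_hom_ext (G G' : leib_infty K) (f g : li_hom G G') :
  lih0 f =1 lih0 g -> lih1 f =1 lih1 g ->
  (forall x y k, lih2 f x y k = lih2 g x y k) -> f = g.
Proof.
case: f g => f0 f1 f2 fP [g0 g1 g2 gP] /=.
move=> /linear_ext fg0 /linear_ext fg1 /csesq2_ext fg2; subst g0 g1 g2.
by congr LiHom; exact: Prop_irrelevance.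
Qed.

Lemma li_comp1 (G G' : leib_infty K) (f : li_hom G G') : li_comp f (li_id G) = f.
Proof.
by apply: li_hom_ext => // x y k; rewrite /= ps1DE /= linear0 addr0.
Qed.

Lemma li_1comp (G G' : leib_infty K) (f : li_hom G G') : li_comp (li_id G') f = f.
Proof. by apply: li_hom_ext => // x y k; rewrite /= ps1DE add0r. Qed.

Lemma li_compA (G1 G2 G3 G4 : leib_infty K) (h : li_hom G3 G4) (g : li_hom G2 G3)
  (f : li_hom G1 G2) : li_comp h (li_comp g f) = li_comp (li_comp h g) f.
Proof.
by apply: li_hom_ext => // x y k; rewrite /= !ps1DE /= ps1DE linearD addrA.
Qed.

Definition TwoLeibInftyConf : category :=
  Category li_comp1 li_1comp li_compA.

End TwoLeibInftyCategory.

Section LeibConf2Category.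
Variable K : fieldType.

Section TwoVectTheory.
Variable C : two_vect K.
Implicit Types f g : vmor C.

Lemma vsrc_vid x : vsrc (vid x : vmor C) = x.
Proof. exact: tv_src1 (two_vectP C) x. Qed.

Lemma vtgt_vid x : vtgt (vid x : vmor C) = x.
Proof. exact: tv_tgt1 (two_vectP C) x. Qed.

Lemma vcmpE f g : composable f g -> vcmp f g = f + g - vid (vtgt f).
Proof.
have [s1 t1 sc tc c1f cf1 cA cL] := two_vectP C => fg.
have /= := cL 1 f (vid (vtgt f)) 0 (g - vid (vtgt f)).
rewrite s1 linear0 linearB /= s1 -fg subrr => /(_ erefl erefl).
rewrite !scale1r addr0 addrC subrK cf1 => ->.
have := c1f (g - vid (vtgt f)).
by rewrite linearB /= s1 -fg subrr linear0 => ->; rewrite addrA.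
Qed.

Lemma map_src_id (a : ps3 (vob C)) : map_ps vsrc (id_ps a) = a.
Proof. by apply: ps3P => p q r; exact: vsrc_vid. Qed.

Lemma map_tgt_id (a : ps3 (vob C)) : map_ps vtgt (id_ps a) = a.
Proof. by apply: ps3P => p q r; exact: vtgt_vid. Qed.

Lemma cmp_psE (a b : ps3 (vmor C)) : map_ps vtgt a = map_ps vsrc b ->
  cmp_ps a b = a + b - id_ps (map_ps vtgt a).
Proof.
move=> ab; apply: ps3P => p q r; apply: vcmpE.
exact: (congr1 (fun h : ps3 _ => h p q r) ab).
Qed.

Lemma map_tgt_cmp (a b : ps3 (vmor C)) : map_ps vtgt a = map_ps vsrc b ->
  map_ps vtgt (cmp_ps a b) = map_ps vtgt b.
Proof.
move=> ab; apply: ps3P => p q r; apply: (tv_tgt (two_vectP C)).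
exact: (congr1 (fun h : ps3 _ => h p q r) ab).
Qed.

Lemma inverse_morphismsP f :
  inverse_morphisms f (vid (vsrc f) + vid (vtgt f) - f).
Proof.
have c1 : composable f (vid (vsrc f) + vid (vtgt f) - f).
  by rewrite /composable !linearB !linearD /= !vsrc_vid; zmod.
have c2 : composable (vid (vsrc f) + vid (vtgt f) - f) f.
  by rewrite /composable !linearB !linearD /= !vtgt_vid; zmod.
split=> //; rewrite vcmpE // ?c2 -?c1; zmod.
Qed.
End TwoVectTheory.

Section L2Identity.
Variable C : leib2 K.

Lemma l2_id_2_subproof : is_csesq2 (fun x y : vob C => vid \o b0 x y).
Proof. by apply: is_csesq2_post; exact: csesq2P. Qed.
Definition l2_id_2 := CSesq2 l2_id_2_subproof.

Lemma l2_id_subproof : l2_hom_axioms (C := C) (C' := C) idfun idfun l2_id_2.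
Proof.
have [s1 t1 sc tc c1f cf1 cA cL] := two_vectP C.
have [bs bt bi bc] := b_functor C; have [zs zt zn zi zc] := lzP C.
split=> //.
- by move=> x y; apply/funext=> k; rewrite /= s1.
- by move=> x y; apply/funext=> k; rewrite /= t1.
- move=> f g k; rewrite -[LHS]/(vcmp (b1 f g k) (vid (b0 (vtgt f) (vtgt g) k))).
  rewrite -[RHS]/(vcmp (vid (b0 (vsrc f) (vsrc g) k)) (b1 f g k)).
  by rewrite -bs -bt /= cf1 c1f.
- move=> x y; eexists => k; exact: inverse_morphismsP.
move=> x y z.
have E0 l (a b : ps3 (vob C)) : at2 l2_id_2 l a b = id_ps (at2 b0 l a b).
  by rewrite /id_ps map_at2.
have E1 l (a b : ps3 (vob C)) :
    at2 b1 l (id_ps a) (id_ps b) = id_ps (at2 b0 l a b).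
  rewrite /id_ps map_at2 at2_map; congr (at2 _ _ _ _).
  by apply/funext=> u; apply/funext=> v; rewrite bi.
rewrite !E0 /= -!(map_cps vid) !E1.
have psC1 (a : ps3 (vmor C)) b : map_ps vtgt a = b -> cmp_ps a (id_ps b) = a.
  by move=> <-; apply: ps3P => p q r; exact: cf1.
have ps1C (a : ps3 (vmor C)) b : map_ps vsrc a = b -> cmp_ps (id_ps b) a = a.
  by move=> <-; apply: ps3P => p q r; exact: c1f.
rewrite -!map_psD !psC1 ?ps1C //.
  exact: zs.
exact: map_tgt_id.
Qed.

Definition l2_id : l2_hom C C := L2Hom l2_id_subproof.
End L2Identity.

Section L2Comp.
Variables (C C' C'' : leib2 K) (G : l2_hom C' C'') (F : l2_hom C C').

Definition l2_comp_0 : {linear vob C -> vob C''} := l2h0 G \o l2h0 F.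
Definition l2_comp_1 : {linear vmor C -> vmor C''} := l2h1 G \o l2h1 F.
Definition l2_comp_2_fun (x y : vob C) : ps1 (vmor C'') := fun k =>
  vcmp (l2h2 G (l2h0 F x) (l2h0 F y) k) (l2h1 G (l2h2 F x y k)).

Lemma l2_comp_composable x y k :
  composable (l2h2 G (l2h0 F x) (l2h0 F y) k) (l2h1 G (l2h2 F x y k)).
Proof.
have [Gf Gs Gt _ _ _] := l2_homP G; have [Ff Fs Ft _ _ _] := l2_homP F.
rewrite /composable (fun_src Gf).
have := congr1 (fun h : ps1 _ => h k) (Gt (l2h0 F x) (l2h0 F y)).
have := congr1 (fun h : ps1 _ => h k) (Fs x y).
by rewrite /= => -> ->.
Qed.

Lemma l2_comp_2E x y k : l2_comp_2_fun x y k =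
  l2h2 G (l2h0 F x) (l2h0 F y) k + l2h1 G (l2h2 F x y k)
  + vid (- l2h0 G (b0 (l2h0 F x) (l2h0 F y) k)).
Proof.
rewrite /l2_comp_2_fun vcmpE; last exact: l2_comp_composable.
have [_ _ Gt _ _ _] := l2_homP G.
have := congr1 (fun h : ps1 _ => h k) (Gt (l2h0 F x) (l2h0 F y)).
by rewrite /= => ->; rewrite linearN.
Qed.

Lemma l2_comp_2_subproof : is_csesq2 l2_comp_2_fun.
Proof.
pose h : {linear vob C' -> vmor C''} := vid \o (-%R \o l2h0 G).
apply: (@is_csesq2_eq _ _ _ _ _ (fun x y =>
  (fun x y => (fun x y => l2h2 G (l2h0 F x) (l2h0 F y)) x y
    + (l2h1 G \o l2h2 F x y)) x y
  + (h \o (fun x y => b0 (l2h0 F x) (l2h0 F y)) x y)) l2_comp_2E).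
apply: is_csesq2D; last by apply/is_csesq2_post/is_csesq2_pre/csesq2P.
apply: is_csesq2D; last by apply/is_csesq2_post/csesq2P.
by apply/is_csesq2_pre/csesq2P.
Qed.

Definition l2_comp_2 := CSesq2 l2_comp_2_subproof.

Lemma coh_linear (A B : leib2 K) (F0 : {linear vob A -> vob B})
    (F1 : {linear vmor A -> vmor B}) (F2 : csesq2 (vob A) (vob A) (vmor B))
    (x y z : vob A) :
  is_functor F0 F1 ->
  (forall x y, vsrc \o F2 x y = b0 (F0 x) (F0 y)) ->
  (forall x y, vtgt \o F2 x y = F0 \o b0 x y) ->
  let X := x%:S in let Y := y%:S in let Z := z%:S in
  let FX := map_ps F0 X in let FY := map_ps F0 Y in let FZ := map_ps F0 Z in
  (cmp_ps (cmp_ps (at3 lz lam mu FX FY FZ)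
    (at2 b1 (lam + mu) (at2 F2 lam X Y) (id_ps FZ)
          + at2 b1 mu (id_ps FY) (at2 F2 lam X Z)))
    (at2 F2 (lam + mu) (at2 b0 lam X Y) Z + at2 F2 mu Y (at2 b0 lam X Z)) =
   cmp_ps (cmp_ps (at2 b1 lam (id_ps FX) (at2 F2 mu Y Z))
     (at2 F2 lam X (at2 b0 mu Y Z)))
     (map_ps F1 (at3 lz lam mu X Y Z))) <->
  at3 lz lam mu FX FY FZ
  + (at2 b1 (lam + mu) (at2 F2 lam X Y) (id_ps FZ)
     + at2 b1 mu (id_ps FY) (at2 F2 lam X Z))
  - id_ps (at2 b0 (lam + mu) (at2 b0 lam FX FY) FZ
           + at2 b0 mu FY (at2 b0 lam FX FZ))
  + (at2 F2 (lam + mu) (at2 b0 lam X Y) Z + at2 F2 mu Y (at2 b0 lam X Z))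
  - id_ps (at2 b0 (lam + mu) (map_ps F0 (at2 b0 lam X Y)) FZ
           + at2 b0 mu FY (map_ps F0 (at2 b0 lam X Z))) =
  at2 b1 lam (id_ps FX) (at2 F2 mu Y Z)
  + at2 F2 lam X (at2 b0 mu Y Z)
  - id_ps (at2 b0 lam FX (map_ps F0 (at2 b0 mu Y Z)))
  + map_ps F1 (at3 lz lam mu X Y Z)
  - id_ps (map_ps F0 (at2 b0 lam X (at2 b0 mu Y Z))).
Proof.
move=> Ff Fs Ft X Y Z FX FY FZ.
have [bs bt bi bc] := b_functor B; have [zs zt zn zi zc] := lzP B.
have [zs' _ _ _ _] := lzP A.
have sF2 l (a b : ps3 (vob A)) : map_ps vsrc (at2 F2 l a b) =
    at2 b0 l (map_ps F0 a) (map_ps F0 b).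
  rewrite map_at2 at2_map; congr (at2 _ _ _ _).
  by apply/funext=> u; apply/funext=> v; rewrite Fs.
have tF2 l (a b : ps3 (vob A)) : map_ps vtgt (at2 F2 l a b) =
    map_ps F0 (at2 b0 l a b).
  rewrite !map_at2; congr (at2 _ _ _ _).
  by apply/funext=> u; apply/funext=> v; rewrite Ft.
have sb1 l (a b : ps3 (vmor B)) : map_ps vsrc (at2 b1 l a b) =
    at2 b0 l (map_ps vsrc a) (map_ps vsrc b).
  rewrite map_at2 at2_map; congr (at2 _ _ _ _).
  by apply/funext=> u; apply/funext=> v; rewrite bs.
have tb1 l (a b : ps3 (vmor B)) : map_ps vtgt (at2 b1 l a b) =
    at2 b0 l (map_ps vtgt a) (map_ps vtgt b).
  rewrite map_at2 at2_map; congr (at2 _ _ _ _).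
  by apply/funext=> u; apply/funext=> v; rewrite bt.
have tL : map_ps vtgt (at3 lz lam mu FX FY FZ) =
    at2 b0 (lam + mu) (at2 b0 lam FX FY) FZ + at2 b0 mu FY (at2 b0 lam FX FZ).
  by rewrite /FX /FY /FZ !map_cps zt.
have sFL : map_ps vsrc (map_ps F1 (at3 lz lam mu X Y Z)) =
    map_ps F0 (at2 b0 lam X (at2 b0 mu Y Z)).
  rewrite -zs'; apply: ps3P => p q r; exact: (fun_src Ff).
have c1 : map_ps vtgt (at3 lz lam mu FX FY FZ) = map_ps vsrc
    (at2 b1 (lam + mu) (at2 F2 lam X Y) (id_ps FZ)
     + at2 b1 mu (id_ps FY) (at2 F2 lam X Z)).
  by rewrite map_psD !sb1 !sF2 !map_src_id tL.
have t1 : map_ps vtgt (at2 b1 (lam + mu) (at2 F2 lam X Y) (id_ps FZ)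
     + at2 b1 mu (id_ps FY) (at2 F2 lam X Z)) =
    at2 b0 (lam + mu) (map_ps F0 (at2 b0 lam X Y)) FZ
    + at2 b0 mu FY (map_ps F0 (at2 b0 lam X Z)).
  by rewrite map_psD !tb1 !tF2 !map_tgt_id.
have c2 : map_ps vtgt (cmp_ps (at3 lz lam mu FX FY FZ)
    (at2 b1 (lam + mu) (at2 F2 lam X Y) (id_ps FZ)
          + at2 b1 mu (id_ps FY) (at2 F2 lam X Z))) = map_ps vsrc
    (at2 F2 (lam + mu) (at2 b0 lam X Y) Z + at2 F2 mu Y (at2 b0 lam X Z)).
  by rewrite map_tgt_cmp // t1 map_psD !sF2.
have d1 : map_ps vtgt (at2 b1 lam (id_ps FX) (at2 F2 mu Y Z)) =
    map_ps vsrc (at2 F2 lam X (at2 b0 mu Y Z)).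
  by rewrite tb1 sF2 tF2 map_tgt_id.
have d2 : map_ps vtgt (cmp_ps (at2 b1 lam (id_ps FX) (at2 F2 mu Y Z))
     (at2 F2 lam X (at2 b0 mu Y Z))) =
    map_ps vsrc (map_ps F1 (at3 lz lam mu X Y Z)).
  by rewrite map_tgt_cmp // tF2 sFL.
rewrite (cmp_psE c2) (cmp_psE d2) (map_tgt_cmp c1) (map_tgt_cmp d1).
by rewrite (cmp_psE c1) (cmp_psE d1) t1 tL tF2 d1 sF2.
Qed.

Lemma l2_comp_subproof : l2_hom_axioms l2_comp_0 l2_comp_1 l2_comp_2.
Proof.
have [Gf Gs Gt Gn _ Gc] := l2_homP G; have [Ff Fs Ft Fn _ Fc] := l2_homP F.
have [Gfs Gft Gfi Gfc] := Gf; have [Ffs Fft Ffi Ffc] := Ff.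
have [bs bt bi bc] := b_functor C''.
have [bs' bt' bi' bc'] := b_functor C'.
have [bs'' bt'' _ _] := b_functor C.
have [s1 t1 sc tc c1f cf1 cA cL] := two_vectP C''.
have Gsk x y k : vsrc (l2h2 G x y k) = b0 (l2h0 G x) (l2h0 G y) k.
  by have := congr1 (fun h : ps1 _ => h k) (Gs x y).
have Gtk x y k : vtgt (l2h2 G x y k) = l2h0 G (b0 x y k).
  by have := congr1 (fun h : ps1 _ => h k) (Gt x y).
have Fsk x y k : vsrc (l2h2 F x y k) = b0 (l2h0 F x) (l2h0 F y) k.
  by have := congr1 (fun h : ps1 _ => h k) (Fs x y).
have Ftk x y k : vtgt (l2h2 F x y k) = l2h0 F (b0 x y k).
  by have := congr1 (fun h : ps1 _ => h k) (Ft x y).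
have bsk f g k : vsrc (b1 f g k : vmor C) = b0 (vsrc f) (vsrc g) k.
  by have := congr1 (fun h : ps1 _ => h k) (bs'' f g).
have btk f g k : vtgt (b1 f g k : vmor C'') = b0 (vtgt f) (vtgt g) k.
  by have := congr1 (fun h : ps1 _ => h k) (bt f g).
have bsk' f g k : vsrc (b1 f g k : vmor C') = b0 (vsrc f) (vsrc g) k.
  by have := congr1 (fun h : ps1 _ => h k) (bs' f g).
have btk' f g k : vtgt (b1 f g k : vmor C') = b0 (vtgt f) (vtgt g) k.
  by have := congr1 (fun h : ps1 _ => h k) (bt' f g).
have HF : is_functor l2_comp_0 l2_comp_1.
  split=> [f|f|x|f g fg]; rewrite /l2_comp_0 /l2_comp_1 /=.
  - by rewrite Gfs Ffs.
  - by rewrite Gft Fft.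
  - by rewrite Ffi Gfi.
  - by rewrite Ffc // Gfc // /composable Fft Ffs fg.
have Hs x y : vsrc \o l2_comp_2 x y = b0 (l2_comp_0 x) (l2_comp_0 y).
  by apply/funext=> k; rewrite /= sc ?Gsk //; exact: l2_comp_composable.
have Ht x y : vtgt \o l2_comp_2 x y = l2_comp_0 \o b0 x y.
  apply/funext=> k; rewrite /= tc ?Gft ?Ftk //; exact: l2_comp_composable.
split=> //.
- move=> f g k.
  rewrite -[l2_comp_2 _ _ _]/(vcmp (l2h2 G _ _ k) (l2h1 G (l2h2 F _ _ k))).
  rewrite -[l2_comp_2 _ _ _]/(vcmp (l2h2 G _ _ k) (l2h1 G (l2h2 F _ _ k))).
  rewrite /l2_comp_1 /=.
  rewrite cA; last exact: l2_comp_composable.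
    have := Gn (l2h1 F f) (l2h1 F g) k; rewrite !Fft !Ffs => ->.
    rewrite -!cA.
    + rewrite -!Gfc ?Fn //; rewrite /composable.
        by rewrite Ftk Ffs bsk.
      by rewrite btk' !Fft Fsk.
    + exact: l2_comp_composable.
    + by rewrite Gft Ftk !Gfs Ffs bsk.
    + by rewrite Gtk Gfs bsk' !Ffs.
    + by rewrite Gft Gfs btk' Fsk !Fft.
  by rewrite btk Gsk !Gft !Fft.
- by move=> x y; eexists => k; exact: inverse_morphismsP.
move=> x y z.
have E1 (B : leib2 K) l (a b : ps3 (vob B)) :
    at2 b1 l (id_ps a) (id_ps b) = id_ps (at2 b0 l a b).
  rewrite /id_ps map_at2 at2_map; congr (at2 _ _ _ _).
  by apply/funext=> u; apply/funext=> v; rewrite (br_id (b_functor B)).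
have sF2 l (a b : ps3 (vob C)) : map_ps vsrc (at2 (l2h2 F) l a b) =
    at2 b0 l (map_ps (l2h0 F) a) (map_ps (l2h0 F) b).
  rewrite map_at2 at2_map; congr (at2 _ _ _ _).
  by apply/funext=> u; apply/funext=> v; rewrite Fs.
have tF2 l (a b : ps3 (vob C)) : map_ps vtgt (at2 (l2h2 F) l a b) =
    map_ps (l2h0 F) (at2 b0 l a b).
  rewrite !map_at2; congr (at2 _ _ _ _).
  by apply/funext=> u; apply/funext=> v; rewrite Ft.
have EH l (a b : ps3 (vob C)) : at2 l2_comp_2 l a b =
    at2 (l2h2 G) l (map_ps (l2h0 F) a) (map_ps (l2h0 F) b)
    + map_ps (l2h1 G) (at2 (l2h2 F) l a b)
    - id_ps (map_ps (l2h0 G) (at2 b0 l (map_ps (l2h0 F) a) (map_ps (l2h0 F) b))).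
  rewrite /id_ps !map_at2 !at2_map -at2Df -at2Bf; congr (at2 _ _ _ _).
  apply/funext=> u; apply/funext=> v; apply/funext=> k.
  by rewrite -[LHS]/(l2_comp_2_fun u v k) l2_comp_2E linearN.
have EN l (f g : ps3 (vmor C')) :
    at2 b1 l (map_ps (l2h1 G) f) (map_ps (l2h1 G) g) =
    at2 (l2h2 G) l (map_ps vsrc f) (map_ps vsrc g)
    + map_ps (l2h1 G) (at2 b1 l f g)
    - id_ps (map_ps (l2h0 G) (at2 b0 l (map_ps vsrc f) (map_ps vsrc g)))
    - at2 (l2h2 G) l (map_ps vtgt f) (map_ps vtgt g)
    + id_ps (at2 b0 l (map_ps (l2h0 G) (map_ps vtgt f))
                      (map_ps (l2h0 G) (map_ps vtgt g))).
  rewrite /id_ps !map_at2 !at2_map -at2Df -!at2Bf -at2Df; congr (at2 _ _ _ _).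
  apply/funext=> u; apply/funext=> v; apply/funext=> k.
  have := Gn u v k; rewrite !vcmpE; first last.
  - by rewrite /composable btk Gsk !Gft.
  - by rewrite /composable Gtk Gfs bsk'.
  rewrite btk !Gft Gtk => /(canRL (subrK _)) /(canRL (addrK _)) ->.
  rewrite -[RHS]/(l2h2 G (vsrc u) (vsrc v) k + l2h1 G (b1 u v k)
    - vid (l2h0 G (b0 (vsrc u) (vsrc v) k)) - l2h2 G (vtgt u) (vtgt v) k
    + vid (b0 (l2h0 G (vtgt u)) (l2h0 G (vtgt v)) k)).
  by zmod.
have G1id (a : ps3 (vob C')) :
    map_ps (l2h1 G) (id_ps a) = id_ps (map_ps (l2h0 G) a).
  by apply: ps3P => p q r; exact: Gfi.
rewrite -!(map_cps vid) -!(map_cps l2_comp_0).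
apply/(coh_linear x y z HF Hs Ht).
have /= Fl := proj1 (coh_linear x y z Ff Fs Ft).
have /= Gl := proj1
  (coh_linear (l2h0 F x) (l2h0 F y) (l2h0 F z) Gf Gs Gt).
move: (Fc x y z); rewrite -!(map_cps vid) -!(map_cps (l2h0 F)).
move=> /Fl /(congr1 (map_ps (l2h1 G))).
move: (Gc (l2h0 F x) (l2h0 F y) (l2h0 F z)).
rewrite -!(map_cps vid) -!(map_cps (l2h0 G)) => /Gl.
rewrite -!(map_cps (l2h0 F)).
have EM0 a : map_ps l2_comp_0 a = map_ps (l2h0 G) (map_ps (l2h0 F) a) by [].
have EM1 a : map_ps l2_comp_1 a = map_ps (l2h1 G) (map_ps (l2h1 F) a) by [].
have id_psD (a b : ps3 (vob C'')) : id_ps (a + b) = id_ps a + id_ps b.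
  exact: map_psD.
rewrite !EM0 !EM1 !EH !(at2Br _ _ _ _ (csesq2Br b1)).
rewrite !(at2Bl _ _ _ _ (csesq2Bl b1)) !(at2Dr _ _ _ _ (csesq2Br b1)).
rewrite !(at2Dl _ _ _ _ (csesq2Bl b1)) !E1.
rewrite !(map_psB, map_psD) !G1id !(map_psD, id_psD).
rewrite -!G1id.
rewrite !EN !sF2 !tF2 !map_src_id !map_tgt_id !G1id.
have eq_comb (V : zmodType) (A1 A2 B1 B2 X Y : V) :
    A1 = A2 -> B1 = B2 -> X + (A2 + B2) = Y + (A1 + B1) -> X = Y.
  by move=> -> -> /addIr.
by move=> /eq_comb HG /HG; apply; zmod.
Qed.

Definition l2_comp : l2_hom C C'' := L2Hom l2_comp_subproof.
End L2Comp.

Lemma l2_hom_ext (C C' : leib2 K) (f g : l2_hom C C') :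
  l2h0 f =1 l2h0 g -> l2h1 f =1 l2h1 g ->
  (forall x y k, l2h2 f x y k = l2h2 g x y k) -> f = g.
Proof.
case: f g => f0 f1 f2 fP [g0 g1 g2 gP] /=.
move=> /linear_ext fg0 /linear_ext fg1 /csesq2_ext fg2; subst g0 g1 g2.
by congr L2Hom; exact: Prop_irrelevance.
Qed.

Lemma l2_comp1 (C C' : leib2 K) (F : l2_hom C C') : l2_comp F (l2_id C) = F.
Proof.
apply: l2_hom_ext => // x y k; rewrite /= /l2_comp_2_fun /=.
have [Ff _ Ft _ _ _] := l2_homP F; rewrite (fun_id Ff).
have := congr1 (fun h : ps1 _ => h k) (Ft x y); rewrite /= => <-.
exact: (tv_f1 (two_vectP C')).
Qed.

Lemma l2_1comp (C C' : leib2 K) (F : l2_hom C C') : l2_comp (l2_id C') F = F.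
Proof.
apply: l2_hom_ext => // x y k; rewrite /= /l2_comp_2_fun /=.
have [_ Fs _ _ _ _] := l2_homP F.
have := congr1 (fun h : ps1 _ => h k) (Fs x y); rewrite /= => <-.
exact: (tv_1f (two_vectP C')).
Qed.

Lemma l2_compA (C1 C2 C3 C4 : leib2 K) (H : l2_hom C3 C4) (G : l2_hom C2 C3)
  (F : l2_hom C1 C2) : l2_comp H (l2_comp G F) = l2_comp (l2_comp H G) F.
Proof.
apply: l2_hom_ext => // x y k; rewrite /= /l2_comp_2_fun /= /l2_comp_2_fun.
have [Hf _ _ _ _ _] := l2_homP H.
have FG := l2_comp_composable G F x y k.
have GH := l2_comp_composable H G (l2h0 F x) (l2h0 F y) k.
rewrite (fun_cmp Hf) // (tv_A (two_vectP C4)) //.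
by rewrite /composable (fun_src Hf) (fun_tgt Hf) FG.
Qed.

Definition LeibConf2 : category := Category l2_comp1 l2_1comp l2_compA.

End LeibConf2Category.

(* Main.v *)
Require Import Defs.
From HB Require Import structures.
From mathcomp Require Import all_boot all_order all_algebra.
From mathcomp Require Import boolp functions reals complex.

(* A 2-vector space is determined by its objects and by the kernel of its
   source map: a morphism f is the identity of its source plus its arrow part
   f - 1_(s f), which lies in that kernel, and the composite of f and g is
   f + g - 1_(t f).  Taking the kernel of s with the target map as d, the
   arrow part of the bracket as rho_2, and minus the arrow part of the
   Leibnizator as rho_3 turns commutative diagrams of morphisms into linear
   identities between arrow parts: naturality becomes (vi)-(viii) and the
   coherence diagram becomes (ix).  In the same way F_2 corresponds to f_2,
   minus its arrow part, and this is a bijection on homomorphisms, so the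
   functor to 2-term algebras is fully faithful.  It is essentially surjective
   because G_0 * G_1, with source x and target x + d u at (x, u), is a Leibniz
   conformal 2-algebra with kernel G_1.

   The axioms only concern the variables lambda, mu, nu and constant
   arguments, while composability in the coherence diagrams needs the source
   and target of the Leibnizator at other linear forms and at power series.
   They follow by substituting linear forms for the variables. *)

Set Implicit Arguments.
Unset Strict Implicit.
Unset Printing Implicit Defensive.

Import GRing.Theory Defs.
Local Open Scope ring_scope.

(** * Power series *)

(** The signs come from orientation. Target minus source of a morphism is [d] of its arrow part; for
    the Leibnizator this difference is the opposite of the right-hand side of (v), and for F_2 it is
    the opposite of the difference that d' f_2 must equal. Linearity alone does not describe the
    bracket of two morphisms, because bilinear expansion leaves a term with an arrow part in both
    arguments. The interchange law absorbs this term into a bracket with the target of one argument,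
    and the two ways of doing so give axiom (iv). The same cross term returns when naturality in
    three morphisms is rebuilt from (vi)-(viii), each of which moves a single argument, and when the
    bracket on pairs is shown to preserve composition. On the side of series, [at2] and [at3] are
    sums truncated coefficient by coefficient. They are handled through a Horner recursion whose
    solution is unique, since multiplication by a linear form raises the degree; this replaces every
    convergence argument. *)

Section PowerSeries.
Implicit Types (M N : zmodType) (l m : linform).

Lemma mul_form0 M l : mul_form l (0 : ps3 M) = 0.
Proof. by have := mul_formB l (0 : ps3 M) 0; rewrite !subrr. Qed.

Lemma mul_formD M l (a b : ps3 M) :
  mul_form l (a + b) = mul_form l a + mul_form l b.
Proof.
have -> : a + b = a - (0 - b) by zmod.
by rewrite !mul_formB mul_form0; zmod.
Qed.

Lemma mul_0form M (a : ps3 M) : mul_form 0 a = 0.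
Proof. by apply: ps3P => p q r; rewrite /mul_form !mulr0n !addr0. Qed.

Lemma mul_formDl M l m (a : ps3 M) :
  mul_form (l + m) a = mul_form l a + mul_form m a.
Proof.
by apply: ps3P => p q r; rewrite ps3DE /mul_form /= !mulrnDr; zmod.
Qed.

Lemma mul_formMnl M l n (a : ps3 M) : mul_form (l *+ n) a = mul_form l a *+ n.
Proof.
elim: n => [|n IHn]; first by rewrite !mulr0n mul_0form.
by rewrite !mulrS mul_formDl IHn.
Qed.

Lemma ps3MnE M (a : ps3 M) n p q r : (a *+ n) p q r = a p q r *+ n.
Proof. by elim: n => // n IHn; rewrite !mulrS ps3DE IHn. Qed.

Lemma mul_formE M l (a : ps3 M) :
  mul_form l a = mul_form lam a *+ l.1.1 + mul_form mu a *+ l.1.2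
                 + mul_form nu a *+ l.2.
Proof.
apply: ps3P => p q r; rewrite !ps3DE !ps3MnE /mul_form /= !mulr0n !mulr1n.
by rewrite !(addr0, add0r).
Qed.

(** Congruence modulo terms of total degree at least [d]: the filtration by which infinite sums are
    compared. *)
Definition agree M d (a b : ps3 M) :=
  forall p q r, (p + q + r < d)%N -> a p q r = b p q r.

Lemma agree_mul_form M l d (a b : ps3 M) :
  agree d a b -> agree d.+1 (mul_form l a) (mul_form l b).
Proof.
move=> ab p q r lt_d; rewrite /mul_form; congr (_ *+ _ + _ *+ _ + _ *+ _).
- by case: p lt_d => //= p lt_d; apply: ab.
- by case: q lt_d => //= q lt_d; apply: ab; rewrite addnS addSn in lt_d.
- by case: r lt_d => //= r lt_d; apply: ab; rewrite addnS in lt_d.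
Qed.

Lemma mul_formC M l m (a : ps3 M) :
  mul_form l (mul_form m a) = mul_form m (mul_form l a).
Proof.
case: l => [[l1 l2] l3]; case: m => [[m1 m2] m3].
apply: ps3P => p q r; rewrite /mul_form /=.
by case: p => [|p]; case: q => [|q]; case: r => [|r] /=;
  rewrite ?mul0rn ?addr0 ?add0r ?mulrnDl -?mulrnA
    ?(mulnC m1) ?(mulnC m2) ?(mulnC m3) //; zmod.
Qed.

(* Multiplication by a linear form raises degrees, so the recursion
   [T f = c f + l * T (s f)] determines [T]. *)
Lemma ps3_corec (F : Type) N l (c : F -> ps3 N) (s : F -> F)
    (T T' : F -> ps3 N) :
  (forall f, T f = c f + mul_form l (T (s f))) ->
  (forall f, T' f = c f + mul_form l (T' (s f))) -> T =1 T'.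
Proof.
move=> TE T'E f; suff aT d : forall f, agree d (T f) (T' f).
  by apply: ps3P => p q r; apply: (aT (p + q + r).+1).
elim: d => [|d IHd] {}f p q r // lt_d.
by rewrite TE T'E !ps3DE; congr (_ + _); apply: agree_mul_form lt_d.
Qed.

(** Each nonconstant monomial is divided by the first variable occurring in it; the tests on the
    indices keep it from being counted twice. *)
Lemma ps3_decomp M (a : ps3 M) : a = (a 0%N 0%N 0%N)%:S
  + mul_form lam (fun i j k => a i.+1 j k)
  + mul_form mu (fun i j k => if i == 0%N then a 0%N j.+1 k else 0)
  + mul_form nu (fun i j k => if (i + j == 0)%N then a 0%N 0%N k.+1 else 0).
Proof.
apply: ps3P => p q r; rewrite !ps3DE /mul_form /cps /= ?mulr0n ?mulr1n.
by case: p => [|p]; case: q => [|q]; case: r => [|r] /=;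
  rewrite ?(mul0rn, mulr0n, mulr1n, addr0, add0r).
Qed.

(* The monomials in [lam], [mu], [nu] generate the power series, so additive
   maps sending multiplication by these to multiplication by the linear forms
   [l1], [l2], [l3] are determined by their values on constants. *)
Lemma ps3_ext_const M N l1 l2 l3 (T T' : ps3 M -> ps3 N) :
  {morph T : a b / a - b} -> {morph T' : a b / a - b} ->
  (forall a, T (mul_form lam a) = mul_form l1 (T a)) ->
  (forall a, T (mul_form mu a) = mul_form l2 (T a)) ->
  (forall a, T (mul_form nu a) = mul_form l3 (T a)) ->
  (forall a, T' (mul_form lam a) = mul_form l1 (T' a)) ->
  (forall a, T' (mul_form mu a) = mul_form l2 (T' a)) ->
  (forall a, T' (mul_form nu a) = mul_form l3 (T' a)) ->
  (forall x, T x%:S = T' x%:S) -> T =1 T'.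
Proof.
move=> TB T'B T1 T2 T3 T'1 T'2 T'3 TT' a.
have D (U : ps3 M -> ps3 N) x b c d : {morph U : a b / a - b} ->
    U (x + b + c + d) = U x + U b + U c + U d.
  move=> UB; have := UB 0 0; rewrite !subrr => U0.
  have -> : x + b + c + d = x - (0 - b) - (0 - c) - (0 - d) by zmod.
  by rewrite !UB U0; zmod.
suff aT d : forall a, agree d (T a) (T' a).
  by apply: ps3P => p q r; apply: (aT (p + q + r).+1).
elim: d => [|d IHd] {}a p q r // lt_d; rewrite (ps3_decomp a).
rewrite (D _ _ _ _ _ TB) (D _ _ _ _ _ T'B) T1 T2 T3 T'1 T'2 T'3 TT' !ps3DE.
by congr (_ + _ + _ + _); apply: agree_mul_form lt_d.
Qed.

Definition psum M l (A : nat -> ps3 M) : ps3 M :=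
  fun p q r => \sum_(k < (p + q + r).+1) iter k (mul_form l) (A k) p q r.

(** Horner's rule. The truncation bounds match because multiplication by a variable lowers one index
    by one, and contributes nothing when that index is 0. *)
Lemma psumE M l (A : nat -> ps3 M) :
  psum l A = A 0%N + mul_form l (psum l (fun k => A k.+1)).
Proof.
apply: ps3P => p q r; rewrite ps3DE /psum big_ord_recl; congr (_ + _).
have -> : \sum_(i < p + q + r)
    iter (lift ord0 i) (mul_form l) (A (lift ord0 i)) p q r =
  \sum_(i < p + q + r) mul_form l (iter i (mul_form l) (A i.+1)) p q r by [].
rewrite /mul_form !big_split /= !sumrMnl; congr (_ + _ + _).
- case: p => [|p] /=; last by rewrite addSn.
  by rewrite big1 ?mul0rn // => i _; rewrite mul0rn.
- case: q => [|q] /=; last by rewrite addnS addSn.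
  by rewrite big1 ?mul0rn // => i _; rewrite mul0rn.
- case: r => [|r] /=; last by rewrite addnS.
  by rewrite big1 ?mul0rn // => i _; rewrite mul0rn.
Qed.

Lemma psumB M l (A B : nat -> ps3 M) :
  psum l (fun k => A k - B k) = psum l A - psum l B.
Proof.
apply: ps3P => p q r; rewrite ps3BE /psum -sumrB; apply: eq_bigr => k _.
by rewrite iter_mul_formB.
Qed.

Lemma psum0 M l : psum l (fun _ => 0 : ps3 M) = 0.
Proof.
have := psumB l (fun _ => 0 : ps3 M) (fun _ => 0).
by under eq_fun do rewrite subrr; rewrite [RHS]subrr.
Qed.

Lemma psumD M l (A B : nat -> ps3 M) :
  psum l (fun k => A k + B k) = psum l A + psum l B.
Proof.
have -> : (fun k => A k + B k) = (fun k => A k - (0 - B k)).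
  by apply/funext => k; zmod.
by rewrite !psumB psum0; zmod.
Qed.

(** No continuity of [T] is assumed: both sides solve the same Horner recursion for [m], whose
    solution is unique by [ps3_corec]. *)
Lemma psum_morph M N l m (T : ps3 M -> ps3 N) (A : nat -> ps3 M) :
  {morph T : a b / a + b} -> (forall a, T (mul_form l a) = mul_form m (T a)) ->
  T (psum l A) = psum m (fun k => T (A k)).
Proof.
move=> TD Tl.
apply: (@ps3_corec (nat -> ps3 M) N m (fun A => T (A 0%N)) (fun A k => A k.+1)
  (fun A => T (psum l A)) (fun A => psum m (fun k => T (A k)))) => {}A.
- by rewrite psumE TD Tl.
- by rewrite psumE.
Qed.

Lemma psum_mul_form M l m (A : nat -> ps3 M) :
  psum l (fun k => mul_form m (A k)) = mul_form m (psum l A).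
Proof.
rewrite (psum_morph (T := mul_form m) (m := l)) // => [a b|a].
  exact: mul_formD.
exact: mul_formC.
Qed.

(** Exchanging the two infinite sums is again uniqueness of the solution of a recursion, here the
    one in [l]. *)
Lemma psumC M l m (A : nat -> nat -> ps3 M) :
  psum l (fun k => psum m (A k)) = psum m (fun h => psum l (fun k => A k h)).
Proof.
apply: (@ps3_corec (nat -> nat -> ps3 M) M l (fun A => psum m (A 0%N))
  (fun A k => A k.+1) (fun A => psum l (fun k => psum m (A k)))
  (fun A => psum m (fun h => psum l (fun k => A k h)))) => {}A.
- by rewrite psumE.
- under [in LHS](eq_fun) do rewrite psumE.
  by rewrite psumD psum_mul_form.
Qed.

Lemma map_psum M N (h : {additive M -> N}) l (A : nat -> ps3 M) :
  map_ps h (psum l A) = psum l (fun k => map_ps h (A k)).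
Proof.
apply: psum_morph => [a b|a]; first exact: map_psD.
exact: (map_mul_form h l 1).
Qed.

Lemma psum_agree M l (A : nat -> ps3 M) d :
  agree d (psum l A) (\sum_(k < d) iter k (mul_form l) (A k)).
Proof.
elim: d A => // d IHd A p q r lt_d.
rewrite psumE big_ord_recl !ps3DE; congr (_ + _).
have -> : \sum_(i < d) iter (lift ord0 i) (mul_form l) (A (lift ord0 i)) =
   mul_form l (\sum_(i < d) iter i (mul_form l) (A i.+1)).
  by rewrite (big_morph (mul_form l) (@mul_formD _ l) (@mul_form0 _ l)).
exact: agree_mul_form (IHd _) _ _ _ lt_d.
Qed.

End PowerSeries.

(** * Cauchy products and multiplication by a variable *)

Section Convolution.
Variables (M1 M2 N : zmodType).
Implicit Types phi : M1 -> M2 -> N.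

Definition additive_l phi := forall x x' y, phi (x - x') y = phi x y - phi x' y.
Definition additive_r phi := forall x y y', phi x (y - y') = phi x y - phi x y'.

Lemma additive_l0 phi y : additive_l phi -> phi 0 y = 0.
Proof. by move=> phiB; have := phiB 0 0 y; rewrite !subrr. Qed.

Lemma additive_r0 phi x : additive_r phi -> phi x 0 = 0.
Proof. by move=> phiB; have := phiB x 0 0; rewrite !subrr. Qed.

Lemma conv2_mulXl phi a b :
  (forall y, phi 0 y = 0) -> conv2 phi (mulX a) b = mulX (conv2 phi a b).
Proof.
move=> phi0; apply/funext => -[|n]; rewrite /conv2 /=.
  by rewrite big_ord1 phi0.
by rewrite big_ord_recl /= phi0 add0r.
Qed.

Lemma conv2_mulXr phi a b :
  (forall x, phi x 0 = 0) -> conv2 phi a (mulX b) = mulX (conv2 phi a b).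
Proof.
move=> phi0; apply/funext => -[|n]; rewrite /conv2 /=.
  by rewrite big_ord1 phi0.
rewrite big_ord_recr /= subnn phi0 addr0; apply: eq_bigr => i _.
by rewrite subSn // -ltnS ltn_ord.
Qed.

End Convolution.

Section Conv3.
Variables (M1 M2 M3 N : zmodType).
Implicit Types phi : M1 -> M2 -> M3 -> N.

Lemma conv3E phi a b c n :
  conv3 phi a b c n = \sum_(i < n.+1) conv2 (phi (a i)) b c (n - i)%N.
Proof. by []. Qed.

Lemma conv3_mulX1 phi a b c : (forall y z, phi 0 y z = 0) ->
  conv3 phi (mulX a) b c = mulX (conv3 phi a b c).
Proof.
move=> phi0; apply/funext => -[|n]; rewrite /conv3 /=.
  by rewrite big_ord1 big1 // => i _; rewrite phi0.
by rewrite big_ord_recl /= big1 ?add0r.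
Qed.

Lemma conv3_mulX2 phi a b c : (forall x z, phi x 0 z = 0) ->
  conv3 phi a (mulX b) c = mulX (conv3 phi a b c).
Proof.
move=> phi0; apply/funext => n; rewrite conv3E.
under eq_bigr => i _ do rewrite conv2_mulXl //.
case: n => [|n]; first by rewrite big_ord1.
rewrite big_ord_recr /= subnn addr0; apply: eq_bigr => i _.
by rewrite subSn // -ltnS ltn_ord.
Qed.

Lemma conv3_mulX3 phi a b c : (forall x y, phi x y 0 = 0) ->
  conv3 phi a b (mulX c) = mulX (conv3 phi a b c).
Proof.
move=> phi0; apply/funext => n; rewrite conv3E.
under eq_bigr => i _ do rewrite conv2_mulXr //.
case: n => [|n]; first by rewrite big_ord1.
rewrite big_ord_recr /= subnn addr0; apply: eq_bigr => i _.
by rewrite subSn // -ltnS ltn_ord.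
Qed.

Definition additive1 phi :=
  forall y z, {morph (fun x => phi x y z) : x x' / x - x'}.
Definition additive2 phi :=
  forall x z, {morph (fun y => phi x y z) : y y' / y - y'}.
Definition additive3 phi :=
  forall x y, {morph (fun z => phi x y z) : z z' / z - z'}.

End Conv3.

Lemma conv3_additive1 (M1 M2 M3 N : zmodType) (phi : M1 -> M2 -> M3 -> N) :
  additive1 phi -> @additive1 (ps1 M1) (ps1 M2) (ps1 M3) (ps1 N) (conv3 phi).
Proof.
move=> phiB b c a a'; apply/funext => n.
rewrite -[RHS]/(_ - _ : N) /conv3 -sumrB.
apply: eq_bigr => i _; rewrite -sumrB; apply: eq_bigr => j _; exact: phiB.
Qed.

Lemma conv3_additive2 (M1 M2 M3 N : zmodType) (phi : M1 -> M2 -> M3 -> N) :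
  additive2 phi -> @additive2 (ps1 M1) (ps1 M2) (ps1 M3) (ps1 N) (conv3 phi).
Proof.
move=> phiB b c a a'; apply/funext => n.
rewrite -[RHS]/(_ - _ : N) /conv3 -sumrB.
apply: eq_bigr => i _; rewrite -sumrB; apply: eq_bigr => j _; exact: phiB.
Qed.

Lemma conv3_additive3 (M1 M2 M3 N : zmodType) (phi : M1 -> M2 -> M3 -> N) :
  additive3 phi -> @additive3 (ps1 M1) (ps1 M2) (ps1 M3) (ps1 N) (conv3 phi).
Proof.
move=> phiB b c a a'; apply/funext => n.
rewrite -[RHS]/(_ - _ : N) /conv3 -sumrB.
apply: eq_bigr => i _; rewrite -sumrB; apply: eq_bigr => j _; exact: phiB.
Qed.

Lemma mulX0 (M : zmodType) : mulX (0 : ps1 M) = 0.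
Proof. by apply/funext => -[]. Qed.

Lemma mulXD (M : zmodType) (a b : ps1 M) : mulX (a + b) = mulX a + mulX b.
Proof.
by apply/funext => -[|i]; rewrite -[RHS]/(mulX a _ + mulX b _) /= ?addr0.
Qed.

Lemma map_conv3 (M1 M2 M3 N N' : zmodType) (h : N -> N')
    (phi : M1 -> M2 -> M3 -> N) :
  h 0 = 0 -> (forall x y, h (x + y) = h x + h y) ->
  forall a b c, h \o conv3 phi a b c = conv3 (fun x y z => h (phi x y z)) a b c.
Proof.
move=> h0 hD a b c; apply/funext => n; rewrite /conv3 /= (big_morph h hD h0).
by apply: eq_bigr => i _; rewrite (big_morph h hD h0).
Qed.

Lemma mul_form_lam (M : zmodType) (a : ps3 M) :
  mul_form lam a = mulX (a : ps1 (ps1 (ps1 M))).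
Proof.
apply: ps3P => p q r; rewrite /mul_form /= mulr1n !mulr0n !addr0.
by case: p.
Qed.

Lemma mul_form_mu (M : zmodType) (a : ps3 M) :
  mul_form mu a = fun i => mulX (a i : ps1 (ps1 M)).
Proof.
apply: ps3P => p q r; rewrite /mul_form /= mulr1n !mulr0n !addr0 add0r.
by case: q.
Qed.

Lemma mul_form_nu (M : zmodType) (a : ps3 M) :
  mul_form nu a = fun i j => mulX (a i j : ps1 M).
Proof.
by apply: ps3P => p q r; rewrite /mul_form /= mulr1n !mulr0n !add0r.
Qed.

(** A linear form is a combination of the three variables with natural coefficients, so additivity
    of [T] reduces the claim to the variables. *)
Lemma mul_form_morph (M N : zmodType) (T : ps3 M -> ps3 N) l :
  {morph T : a b / a - b} ->
  (forall a, T (mul_form lam a) = mul_form lam (T a)) ->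
  (forall a, T (mul_form mu a) = mul_form mu (T a)) ->
  (forall a, T (mul_form nu a) = mul_form nu (T a)) ->
  forall a, T (mul_form l a) = mul_form l (T a).
Proof.
move=> TB T1 T2 T3 a.
have T0 : T 0 = 0 by have := TB 0 0; rewrite !subrr.
have TD : {morph T : a b / a + b}.
  move=> {}a b; have -> : a + b = a - (0 - b) by zmod.
  by rewrite !TB T0; zmod.
have TMn b n : T (b *+ n) = T b *+ n.
  by elim: n => [|n IHn]; rewrite ?mulr0n // !mulrS TD IHn.
by rewrite mul_formE [RHS]mul_formE -T1 -T2 -T3 -!TMn -!TD.
Qed.

Section ConvMulForm.
Variables (M1 M2 M3 N : zmodType).

Definition ps3conv2 (phi : M1 -> M2 -> N) : ps3 M1 -> ps3 M2 -> ps3 N :=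
  conv2 (conv2 (conv2 phi)).

Definition ps3conv3 (phi : M1 -> M2 -> M3 -> N) :
    ps3 M1 -> ps3 M2 -> ps3 M3 -> ps3 N :=
  conv3 (conv3 (conv3 phi)).

Lemma ps3conv2_additive_l phi :
  additive_l phi -> @additive_l (ps3 M1) (ps3 M2) (ps3 N) (ps3conv2 phi).
Proof.
by move=> phiB a a' b; exact: (conv2Bl (conv2Bl (conv2Bl phiB)) a a' b).
Qed.

Lemma ps3conv2_additive_r phi :
  additive_r phi -> @additive_r (ps3 M1) (ps3 M2) (ps3 N) (ps3conv2 phi).
Proof.
by move=> phiB a a' b; exact: (conv2Br (conv2Br (conv2Br phiB)) a a' b).
Qed.

(** Carries an identity about coefficients through one level of convolution. In an iterated series
    [mu] and [nu] are inner variables, so they are reached by applying this once or twice. *)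
Lemma conv2_lift (A1 A2 A : zmodType) (phi : A1 -> A2 -> A) f1 f2 (g : A -> A) :
  g 0 = 0 -> {morph g : x y / x + y} ->
  (forall x y, phi (f1 x) (f2 y) = g (phi x y)) ->
  forall a b, conv2 phi (f1 \o a) (f2 \o b) = g \o conv2 phi a b.
Proof.
move=> g0 gD phig a b; rewrite (map_conv2 _ g0 gD).
rewrite -[LHS]/(conv2 (fun x y => phi (f1 x) (f2 y)) a b).
by congr (conv2 _ a b); apply/funext => x; apply/funext => y.
Qed.

Lemma conv3_lift (A1 A2 A3 A : zmodType) (phi : A1 -> A2 -> A3 -> A)
    f1 f2 f3 (g : A -> A) :
  g 0 = 0 -> {morph g : x y / x + y} ->
  (forall x y z, phi (f1 x) (f2 y) (f3 z) = g (phi x y z)) ->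
  forall a b c,
    conv3 phi (f1 \o a) (f2 \o b) (f3 \o c) = g \o conv3 phi a b c.
Proof.
move=> g0 gD phig a b c; rewrite (map_conv3 _ g0 gD).
rewrite -[LHS]/(conv3 (fun x y z => phi (f1 x) (f2 y) (f3 z)) a b c).
congr (conv3 _ a b c).
by apply/funext => x; apply/funext => y; apply/funext => z.
Qed.

Lemma comp_mulX0 (A : zmodType) : mulX (M := A) \o 0 = 0 :> ps1 (ps1 A).
Proof. by apply/funext => i; exact: mulX0. Qed.

Lemma comp_mulXD (A : zmodType) :
  {morph (fun f : ps1 (ps1 A) => mulX (M := A) \o f) : f g / f + g}.
Proof. by move=> f g; apply/funext => i; exact: mulXD. Qed.

Lemma ps3conv2_mul_forml phi l a b : additive_l phi ->
  ps3conv2 phi (mul_form l a) b = mul_form l (ps3conv2 phi a b).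
Proof.
move=> phiB; have phiB1 : additive_l (conv2 phi) by exact: conv2Bl.
have phiB2 : additive_l (conv2 (conv2 phi)) by exact: conv2Bl.
apply: (mul_form_morph (T := fun a => ps3conv2 phi a b)) => [x y|{}a|{}a|{}a].
- exact: ps3conv2_additive_l.
- by rewrite !mul_form_lam; apply: conv2_mulXl => y; apply: additive_l0.
- rewrite !mul_form_mu.
  apply: (conv2_lift (f1 := @mulX _) (f2 := idfun) (g := @mulX _)
    (mulX0 _) (@mulXD _)) => x y.
  by apply: conv2_mulXl => z; apply: additive_l0.
rewrite !mul_form_nu.
apply: (conv2_lift (f1 := fun f => mulX (M := M1) \o f) (f2 := idfun)
  (comp_mulX0 _) (@comp_mulXD _)) => x y.
apply: (conv2_lift (f1 := @mulX _) (f2 := idfun) (g := @mulX _)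
    (mulX0 _) (@mulXD _)) => x' y'.
by apply: conv2_mulXl => z; apply: additive_l0.
Qed.

Lemma ps3conv2_mul_formr phi l a b : additive_r phi ->
  ps3conv2 phi a (mul_form l b) = mul_form l (ps3conv2 phi a b).
Proof.
move=> phiB; have phiB1 : additive_r (conv2 phi) by exact: conv2Br.
have phiB2 : additive_r (conv2 (conv2 phi)) by exact: conv2Br.
apply: (mul_form_morph (T := ps3conv2 phi a)) => [x y|{}b|{}b|{}b].
- exact: ps3conv2_additive_r.
- by rewrite !mul_form_lam; apply: conv2_mulXr => y; apply: additive_r0.
- rewrite !mul_form_mu.
  apply: (conv2_lift (f1 := idfun) (f2 := @mulX _) (g := @mulX _)
    (mulX0 _) (@mulXD _)) => x y.
  by apply: conv2_mulXr => z; apply: additive_r0.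
rewrite !mul_form_nu.
apply: (conv2_lift (f1 := idfun) (f2 := fun f => mulX (M := M2) \o f)
  (comp_mulX0 _) (@comp_mulXD _)) => x y.
apply: (conv2_lift (f1 := idfun) (f2 := @mulX _) (g := @mulX _)
    (mulX0 _) (@mulXD _)) => x' y'.
by apply: conv2_mulXr => z; apply: additive_r0.
Qed.

Lemma additive1_0 (A1 A2 A3 A : zmodType) (phi : A1 -> A2 -> A3 -> A) x y :
  additive1 phi -> phi 0 x y = 0.
Proof. by move=> phiB; have := phiB x y 0 0; rewrite !subrr. Qed.

Lemma ps3conv3_additive1 phi :
  additive1 phi -> @additive1 (ps3 M1) (ps3 M2) (ps3 M3) (ps3 N) (ps3conv3 phi).
Proof.
by move=> phiB a b c c'; exact:
  (conv3_additive1 (conv3_additive1 (conv3_additive1 phiB)) a b c c').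
Qed.

Lemma ps3conv3_mul_form1 phi l a b c : additive1 phi ->
  ps3conv3 phi (mul_form l a) b c = mul_form l (ps3conv3 phi a b c).
Proof.
move=> phiB; have phiB1 : additive1 (conv3 phi) by exact: conv3_additive1.
have phiB2 : additive1 (conv3 (conv3 phi)) by exact: conv3_additive1.
apply: (mul_form_morph (T := fun a => ps3conv3 phi a b c)) => [x y|{}a|{}a|{}a].
- exact: ps3conv3_additive1.
- by rewrite !mul_form_lam; apply: conv3_mulX1 => y z; apply: additive1_0.
- rewrite !mul_form_mu.
  apply: (conv3_lift (f1 := @mulX _) (f2 := idfun) (f3 := idfun) (g := @mulX _)
    (mulX0 _) (@mulXD _)) => x y z.
  by apply: conv3_mulX1 => *; apply: additive1_0.
rewrite !mul_form_nu.
apply: (conv3_lift (f1 := fun f => mulX (M := M1) \o f)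
  (f2 := idfun) (f3 := idfun)
  (comp_mulX0 _) (@comp_mulXD _)) => x y z.
apply: (conv3_lift (f1 := @mulX _) (f2 := idfun) (f3 := idfun) (g := @mulX _)
    (mulX0 _) (@mulXD _)) => x' y' z'.
by apply: conv3_mulX1 => *; apply: additive1_0.
Qed.

Lemma additive2_0 (A1 A2 A3 A : zmodType) (phi : A1 -> A2 -> A3 -> A) x y :
  additive2 phi -> phi x 0 y = 0.
Proof. by move=> phiB; have := phiB x y 0 0; rewrite !subrr. Qed.

Lemma ps3conv3_additive2 phi :
  additive2 phi -> @additive2 (ps3 M1) (ps3 M2) (ps3 M3) (ps3 N) (ps3conv3 phi).
Proof.
by move=> phiB a b c c'; exact:
  (conv3_additive2 (conv3_additive2 (conv3_additive2 phiB)) a b c c').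
Qed.

Lemma ps3conv3_mul_form2 phi l a b c : additive2 phi ->
  ps3conv3 phi a (mul_form l b) c = mul_form l (ps3conv3 phi a b c).
Proof.
move=> phiB; have phiB1 : additive2 (conv3 phi) by exact: conv3_additive2.
have phiB2 : additive2 (conv3 (conv3 phi)) by exact: conv3_additive2.
apply: (mul_form_morph (T := fun b => ps3conv3 phi a b c)) => [x y|{}b|{}b|{}b].
- exact: ps3conv3_additive2.
- by rewrite !mul_form_lam; apply: conv3_mulX2 => y z; apply: additive2_0.
- rewrite !mul_form_mu.
  apply: (conv3_lift (f2 := @mulX _) (f1 := idfun) (f3 := idfun) (g := @mulX _)
    (mulX0 _) (@mulXD _)) => x y z.
  by apply: conv3_mulX2 => *; apply: additive2_0.
rewrite !mul_form_nu.
apply: (conv3_lift (f2 := fun f => mulX (M := M2) \o f)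
  (f1 := idfun) (f3 := idfun)
  (comp_mulX0 _) (@comp_mulXD _)) => x y z.
apply: (conv3_lift (f2 := @mulX _) (f1 := idfun) (f3 := idfun) (g := @mulX _)
    (mulX0 _) (@mulXD _)) => x' y' z'.
by apply: conv3_mulX2 => *; apply: additive2_0.
Qed.

Lemma additive3_0 (A1 A2 A3 A : zmodType) (phi : A1 -> A2 -> A3 -> A) x y :
  additive3 phi -> phi x y 0 = 0.
Proof. by move=> phiB; have := phiB x y 0 0; rewrite !subrr. Qed.

Lemma ps3conv3_additive3 phi :
  additive3 phi -> @additive3 (ps3 M1) (ps3 M2) (ps3 M3) (ps3 N) (ps3conv3 phi).
Proof.
by move=> phiB a b c c'; exact:
  (conv3_additive3 (conv3_additive3 (conv3_additive3 phiB)) a b c c').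
Qed.

Lemma ps3conv3_mul_form3 phi l a b c : additive3 phi ->
  ps3conv3 phi a b (mul_form l c) = mul_form l (ps3conv3 phi a b c).
Proof.
move=> phiB; have phiB1 : additive3 (conv3 phi) by exact: conv3_additive3.
have phiB2 : additive3 (conv3 (conv3 phi)) by exact: conv3_additive3.
apply: (mul_form_morph (T := fun c => ps3conv3 phi a b c)) => [x y|{}c|{}c|{}c].
- exact: ps3conv3_additive3.
- by rewrite !mul_form_lam; apply: conv3_mulX3 => y z; apply: additive3_0.
- rewrite !mul_form_mu.
  apply: (conv3_lift (f3 := @mulX _) (f1 := idfun) (f2 := idfun) (g := @mulX _)
    (mulX0 _) (@mulXD _)) => x y z.
  by apply: conv3_mulX3 => *; apply: additive3_0.
rewrite !mul_form_nu.
apply: (conv3_lift (f3 := fun f => mulX (M := M3) \o f)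
  (f1 := idfun) (f2 := idfun)
  (comp_mulX0 _) (@comp_mulXD _)) => x y z.
apply: (conv3_lift (f3 := @mulX _) (f1 := idfun) (f2 := idfun) (g := @mulX _)
    (mulX0 _) (@mulXD _)) => x' y' z'.
by apply: conv3_mulX3 => *; apply: additive3_0.
Qed.

End ConvMulForm.

Lemma ps3_sumE (M : zmodType) n (F : 'I_n -> ps3 M) p q r :
  (\sum_i F i) p q r = \sum_i F i p q r.
Proof.
by rewrite (big_morph (fun f : ps3 M => f p q r) (id1 := 0) (op1 := +%R)).
Qed.

Lemma agree_iter (M : zmodType) l d k (a b : ps3 M) :
  agree d a b -> agree d (iter k (mul_form l) a) (iter k (mul_form l) b).
Proof.
move=> ab; elim: k => //= k IHk p q r lt_d.
exact: agree_mul_form IHk _ _ _ (ltnW lt_d).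
Qed.

(** * Evaluation of sesquilinear maps at linear forms and series *)

Section At.
Variables (M1 M2 M3 N : zmodType).

Lemma at2E (phi : M1 -> M2 -> ps1 N) l a b :
  at2 phi l a b = psum l (fun k => ps3conv2 (fun x y => phi x y k) a b).
Proof. by []. Qed.

(** The inner sum of [at3] is cut at the degree of the coefficient finally read. It agrees with
    [psum] up to that degree, and multiplication by powers of [l] preserves the agreement. *)
Lemma at3E (phi : M1 -> M2 -> M3 -> ps2 N) l m a b c :
  at3 phi l m a b c = psum l (fun k => psum m (fun h =>
    ps3conv3 (fun x y z => phi x y z k h) a b c)).
Proof.
apply: ps3P => p q r; apply: eq_bigr => k _.
rewrite (agree_iter l k (@psum_agree _ _ _ _) (ltnSn _)).
rewrite (big_morph (iter k (mul_form l)) (id1 := 0) (op1 := +%R)) ?ps3_sumE //.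
  move=> f g; elim: (nat_of_ord k) => //= i ->; exact: mul_formD.
by elim: (nat_of_ord k) => //= i ->; exact: mul_form0.
Qed.

Lemma ps3conv2_cps (phi : M1 -> M2 -> N) x y :
  additive_l phi -> additive_r phi -> ps3conv2 phi x%:S y%:S = (phi x y)%:S.
Proof.
have c1 (A1 A2 A : zmodType) (f : A1 -> A2 -> A) x' y' :
    additive_l f -> additive_r f ->
    conv2 f (fun n => if n == 0%N then x' else 0)
      (fun n => if n == 0%N then y' else 0)
    = fun n => if n == 0%N then f x' y' else 0.
  move=> fl fr; apply/funext => n; rewrite /conv2.
  rewrite big_ord_recl /= big1 ?addr0 => [|i _]; last by rewrite additive_l0.
  by rewrite subn0; case: n => //= n; rewrite additive_r0.
have cE (A : zmodType) (u : A) : u%:S = (fun i => if i == 0%N then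
    (fun j => if j == 0%N then (fun k => if k == 0%N then u else 0) else 0)
    else 0).
  by apply: ps3P => -[|i] [|j] [|k].
move=> phil phir; have l1 := conv2Bl phil; have r1 := conv2Br phir.
rewrite !cE; apply: etrans (c1 _ _ _ _ _ _ (conv2Bl l1) (conv2Br r1)) _.
apply/funext => -[|i] //=; apply: etrans (c1 _ _ _ _ _ _ l1 r1) _.
apply/funext => -[|j] //=; exact: c1.
Qed.

Lemma ps3conv3_cps (phi : M1 -> M2 -> M3 -> N) x y z :
  additive1 phi -> additive2 phi -> additive3 phi ->
  ps3conv3 phi x%:S y%:S z%:S = (phi x y z)%:S.
Proof.
have c1 (A1 A2 A3 A : zmodType) (f : A1 -> A2 -> A3 -> A) x' y' z' :
    additive1 f -> additive2 f -> additive3 f ->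
    conv3 f (fun n => if n == 0%N then x' else 0)
      (fun n => if n == 0%N then y' else 0)
      (fun n => if n == 0%N then z' else 0)
    = fun n => if n == 0%N then f x' y' z' else 0.
  move=> f1 f2 f3; apply/funext => n; rewrite /conv3.
  rewrite big_ord_recl /= [X in _ + X]big1 ?addr0 => [|i _]; last first.
    by rewrite big1 // => j _; rewrite additive1_0.
  rewrite subn0 big_ord_recl /= [X in _ + X]big1 ?addr0 => [|i _]; last first.
    by rewrite additive2_0.
  by rewrite subn0; case: n => //= n; rewrite additive3_0.
have cE (A : zmodType) (u : A) : u%:S = (fun i => if i == 0%N then
    (fun j => if j == 0%N then (fun k => if k == 0%N then u else 0) else 0)
    else 0).
  by apply: ps3P => -[|i] [|j] [|k].
move=> f1 f2 f3.
have g1 := conv3_additive1 f1; have g2 := conv3_additive2 f2.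
have g3 := conv3_additive3 f3.
have h1 := conv3_additive1 g1; have h2 := conv3_additive2 g2.
have h3 := conv3_additive3 g3.
rewrite !cE; apply: etrans (c1 _ _ _ _ _ _ _ _ h1 h2 h3) _.
apply/funext => -[|i] //=; apply: etrans (c1 _ _ _ _ _ _ _ _ g1 g2 g3) _.
apply/funext => -[|j] //=; exact: c1.
Qed.

Lemma at2_mul_forml (phi : M1 -> M2 -> ps1 N) l m a b : additive_l phi ->
  at2 phi l (mul_form m a) b = mul_form m (at2 phi l a b).
Proof.
move=> phiB; rewrite !at2E -psum_mul_form; congr psum; apply/funext => k.
by apply: ps3conv2_mul_forml => x x' y; rewrite phiB.
Qed.

Lemma at2_mul_formr (phi : M1 -> M2 -> ps1 N) l m a b : additive_r phi ->
  at2 phi l a (mul_form m b) = mul_form m (at2 phi l a b).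
Proof.
move=> phiB; rewrite !at2E -psum_mul_form; congr psum; apply/funext => k.
by apply: ps3conv2_mul_formr => x x' y; rewrite phiB.
Qed.

Lemma at2_cps (phi : M1 -> M2 -> ps1 N) l x y :
  additive_l phi -> additive_r phi ->
  at2 phi l x%:S y%:S = psum l (fun k => (phi x y k)%:S).
Proof.
move=> phil phir; rewrite at2E; congr psum; apply/funext => k.
by apply: ps3conv2_cps => u v w; rewrite ?phil ?phir.
Qed.

Lemma at3_cps (phi : M1 -> M2 -> M3 -> ps2 N) l m x y z :
  additive1 phi -> additive2 phi -> additive3 phi ->
  at3 phi l m x%:S y%:S z%:S = psum l (fun k => psum m (fun h =>
    (phi x y z k h)%:S)).
Proof.
move=> f1 f2 f3; rewrite at3E; congr psum; apply/funext => k.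
congr psum; apply/funext => h.
by apply: ps3conv3_cps => // ? ? ? ?; rewrite ?f1 ?f2 ?f3.
Qed.

End At.

(** * Substitution of linear forms *)

(* [subst l m] substitutes [l], [m] and [0] for [lam], [mu] and [nu]. *)
Definition subst (M : zmodType) l m (a : ps3 M) : ps3 M :=
  psum l (fun k => psum m (fun h => (a k h 0%N)%:S)).

Definition subst_form l m (f : linform) : linform := l *+ f.1.1 + m *+ f.1.2.

Lemma cpsB (M : zmodType) (x y : M) : (x - y)%:S = x%:S - y%:S.
Proof.
by apply: ps3P => p q r; rewrite ps3BE /cps; case: ifP; rewrite ?subrr.
Qed.

Lemma cps0 (M : zmodType) : (0 : M)%:S = 0.
Proof. by apply: ps3P => p q r; rewrite /cps; case: ifP. Qed.

Lemma psum_eq0 (M : zmodType) l (A : nat -> ps3 M) :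
  (forall k, A k = 0) -> psum l A = 0.
Proof. by move=> /funext ->; exact: psum0. Qed.

Lemma psum_const (M : zmodType) l (A : nat -> ps3 M) :
  (forall k, A k.+1 = 0) -> psum l A = A 0%N.
Proof. by move=> A0; rewrite psumE psum_eq0 // mul_form0 addr0. Qed.

Section Subst.
Variables (M : zmodType) (l m : linform).
Implicit Types a b : ps3 M.

Lemma substB a b : subst l m (a - b) = subst l m a - subst l m b.
Proof.
rewrite /subst -psumB; congr psum; apply/funext => k; rewrite -psumB.
by congr psum; apply/funext => h; rewrite -cpsB.
Qed.

Lemma substD a b : subst l m (a + b) = subst l m a + subst l m b.
Proof.
have -> : a + b = a - (0 - b) by zmod.
by rewrite !substB; have := substB 0 0; rewrite !subrr => ->; zmod.
Qed.

Lemma subst0 : subst l m (0 : ps3 M) = 0.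
Proof. by have := substB 0 0; rewrite !subrr. Qed.

Lemma subst_cps (x : M) : subst l m x%:S = x%:S.
Proof.
rewrite /subst psum_const => [|k]; first by apply: psum_const => h; exact: cps0.
by apply: psum_eq0 => h; exact: cps0.
Qed.

Lemma subst_mul_lam a : subst l m (mul_form lam a) = mul_form l (subst l m a).
Proof.
rewrite mul_form_lam /subst psumE /= psum_eq0 ?add0r // => h; exact: cps0.
Qed.

Lemma subst_mul_mu a : subst l m (mul_form mu a) = mul_form m (subst l m a).
Proof.
rewrite mul_form_mu /subst -psum_mul_form; congr psum; apply/funext => k.
by rewrite psumE cps0 add0r.
Qed.

Lemma subst_mul_nu a : subst l m (mul_form nu a) = 0.
Proof.
rewrite mul_form_nu; apply: psum_eq0 => k; apply: psum_eq0 => h; exact: cps0.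
Qed.

Lemma subst_mul_form f a :
  subst l m (mul_form f a) = mul_form (subst_form l m f) (subst l m a).
Proof.
have substMn b n : subst l m (b *+ n) = subst l m b *+ n.
  by elim: n => [|n IHn]; rewrite ?mulr0n ?subst0 // !mulrS substD IHn.
rewrite mul_formE !substD !substMn subst_mul_lam subst_mul_mu subst_mul_nu.
by rewrite mul0rn addr0 mul_formDl !mul_formMnl.
Qed.

Lemma subst_psum f (A : nat -> ps3 M) :
  subst l m (psum f A) = psum (subst_form l m f) (fun k => subst l m (A k)).
Proof. by apply: psum_morph; [exact: substD | exact: subst_mul_form]. Qed.

End Subst.

(** Both sides turn multiplication of an argument by a variable into multiplication by its image, so
    [ps3_ext_const], used in each argument with [nu] sent to 0, leaves only constants. *)
Lemma subst_at2 (M1 M2 N : zmodType) (phi : M1 -> M2 -> ps1 N) l m f a b :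
  additive_l phi -> additive_r phi ->
  subst l m (at2 phi f a b) =
  at2 phi (subst_form l m f) (subst l m a) (subst l m b).
Proof.
move=> phil phir.
move: a; apply: (@ps3_ext_const _ _ l m 0) => [a a'|a a'|a|a|a|a|a|a|x].
- by rewrite at2Bl // substB.
- by rewrite substB at2Bl.
- by rewrite at2_mul_forml // subst_mul_lam.
- by rewrite at2_mul_forml // subst_mul_mu.
- by rewrite at2_mul_forml // subst_mul_nu mul_0form.
- by rewrite subst_mul_lam at2_mul_forml.
- by rewrite subst_mul_mu at2_mul_forml.
- by rewrite subst_mul_nu at2_0l ?mul_0form.
rewrite subst_cps; move: b.
apply: (@ps3_ext_const _ _ l m 0) => [a a'|a a'|a|a|a|a|a|a|y].
- by rewrite at2Br // substB.
- by rewrite substB at2Br.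
- by rewrite at2_mul_formr // subst_mul_lam.
- by rewrite at2_mul_formr // subst_mul_mu.
- by rewrite at2_mul_formr // subst_mul_nu mul_0form.
- by rewrite subst_mul_lam at2_mul_formr.
- by rewrite subst_mul_mu at2_mul_formr.
- by rewrite subst_mul_nu at2_0r ?mul_0form.
rewrite subst_cps !at2_cps // subst_psum; congr psum; apply/funext => k.
by rewrite subst_cps.
Qed.

Lemma subst_form_lam l m : subst_form l m lam = l.
Proof. by rewrite /subst_form mulr1n mulr0n addr0. Qed.

Lemma subst_form_mu l m : subst_form l m mu = m.
Proof. by rewrite /subst_form mulr1n mulr0n add0r. Qed.

Lemma subst_formD l m f g :
  subst_form l m (f + g) = subst_form l m f + subst_form l m g.
Proof. by rewrite /subst_form /= !mulrnDr addrACA. Qed.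

(** Isolates what makes an expression in two forms and three series determined by its values at
    [lam], [mu] and constants. The terms of the Jacobi-type axioms have these properties, which are
    stable under differences and linear maps. *)
Record substitutive (M1 M2 M3 N : zmodType)
    (E : linform -> linform -> ps3 M1 -> ps3 M2 -> ps3 M3 -> ps3 N) : Prop :=
    Substitutive {
  subB1 : forall l m, additive1 (E l m);
  subB2 : forall l m, additive2 (E l m);
  subB3 : forall l m, additive3 (E l m);
  sub_mul1 : forall l m f a b c,
    E l m (mul_form f a) b c = mul_form f (E l m a b c);
  sub_mul2 : forall l m f a b c,
    E l m a (mul_form f b) c = mul_form f (E l m a b c);
  sub_mul3 : forall l m f a b c,
    E l m a b (mul_form f c) = mul_form f (E l m a b c);
  sub_subst : forall l m x y z,
    subst l m (E lam mu x%:S y%:S z%:S) = E l m x%:S y%:S z%:S }.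

(** The arguments are reduced to constants one at a time by [ps3_ext_const]; on constants, general
    forms are reached by substitution. *)
Lemma substitutive_ext (M1 M2 M3 N : zmodType)
    (E E' : linform -> linform -> ps3 M1 -> ps3 M2 -> ps3 M3 -> ps3 N) :
  substitutive E -> substitutive E' ->
  (forall x y z, E lam mu x%:S y%:S z%:S = E' lam mu x%:S y%:S z%:S) ->
  forall l m a b c, E l m a b c = E' l m a b c.
Proof.
move=> [B1 B2 B3 m1 m2 m3 s] [B1' B2' B3' m1' m2' m3' s'] EE' l m a b c.
move: a; apply: (ps3_ext_const (B1 l m b c) (B1' l m b c)
  (l1 := lam) (l2 := mu) (l3 := nu)) => // x.
move: b; apply: (ps3_ext_const (B2 l m _ c) (B2' l m _ c)
  (l1 := lam) (l2 := mu) (l3 := nu)) => // y.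
move: c; apply: (ps3_ext_const (B3 l m _ _) (B3' l m _ _)
  (l1 := lam) (l2 := mu) (l3 := nu)) => // z.
by rewrite -s -s' EE'.
Qed.

Section SubstitutiveTheory.
Variables (M1 M2 M3 N : zmodType).
Implicit Types E : linform -> linform -> ps3 M1 -> ps3 M2 -> ps3 M3 -> ps3 N.

Lemma substitutiveB E E' : substitutive E -> substitutive E' ->
  substitutive (fun l m a b c => E l m a b c - E' l m a b c).
Proof.
move=> [B1 B2 B3 m1 m2 m3 s] [B1' B2' B3' m1' m2' m3' s'].
have aux (V : zmodType) (x y z t : V) : x - y - (z - t) = (x - z) - (y - t).
  by zmod.
split=> [l m b c a a'|l m a c b b'|l m a b c c'|l m f a b c|l m f a b c
        |l m f a b c|l m x y z].
- by rewrite B1 B1' aux.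
- by rewrite B2 B2' aux.
- by rewrite B3 B3' aux.
- by rewrite m1 m1' mul_formB.
- by rewrite m2 m2' mul_formB.
- by rewrite m3 m3' mul_formB.
- by rewrite substB s s'.
Qed.

Lemma map_subst (A B : zmodType) (h : {additive A -> B}) l m (a : ps3 A) :
  map_ps h (subst l m a) = subst l m (map_ps h a).
Proof.
rewrite /subst map_psum; congr psum; apply/funext => k; rewrite map_psum.
by congr psum; apply/funext => i; rewrite map_cps.
Qed.

Lemma substitutive_map (A : zmodType) (h : {additive N -> A}) E :
  substitutive E -> substitutive (fun l m a b c => map_ps h (E l m a b c)).
Proof.
move=> [B1 B2 B3 m1 m2 m3 s].
have hf f (a : ps3 N) : map_ps h (mul_form f a) = mul_form f (map_ps h a).
  exact: (map_mul_form h f 1).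
split=> [l m b c a a'|l m a c b b'|l m a b c c'|l m f a b c|l m f a b c
        |l m f a b c|l m x y z].
- by rewrite B1 map_psB.
- by rewrite B2 map_psB.
- by rewrite B3 map_psB.
- by rewrite m1 hf.
- by rewrite m2 hf.
- by rewrite m3 hf.
- by rewrite -map_subst s.
Qed.

Lemma substitutive_at3 (phi : M1 -> M2 -> M3 -> ps2 N) :
  additive1 phi -> additive2 phi -> additive3 phi -> substitutive (at3 phi).
Proof.
move=> f1 f2 f3.
have g1 k h : additive1 (fun x y z => phi x y z k h).
  by move=> y z x x'; rewrite f1.
have g2 k h : additive2 (fun x y z => phi x y z k h).
  by move=> y z x x'; rewrite f2.
have g3 k h : additive3 (fun x y z => phi x y z k h).
  by move=> y z x x'; rewrite f3.
split=> [l m b c a a'|l m a c b b'|l m a b c c'|l m f a b c|l m f a b c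
        |l m f a b c|l m x y z]; rewrite !at3E.
- rewrite -psumB; congr psum; apply/funext => k; rewrite -psumB; congr psum.
  apply/funext => h; exact: ps3conv3_additive1.
- rewrite -psumB; congr psum; apply/funext => k; rewrite -psumB; congr psum.
  apply/funext => h; exact: ps3conv3_additive2.
- rewrite -psumB; congr psum; apply/funext => k; rewrite -psumB; congr psum.
  apply/funext => h; exact: ps3conv3_additive3.
- rewrite -psum_mul_form; congr psum; apply/funext => k.
  rewrite -psum_mul_form; congr psum; apply/funext => h.
  exact: ps3conv3_mul_form1.
- rewrite -psum_mul_form; congr psum; apply/funext => k.
  rewrite -psum_mul_form; congr psum; apply/funext => h.
  exact: ps3conv3_mul_form2.
- rewrite -psum_mul_form; congr psum; apply/funext => k.
  rewrite -psum_mul_form; congr psum; apply/funext => h.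
  exact: ps3conv3_mul_form3.
- rewrite subst_psum subst_form_lam; congr psum; apply/funext => k.
  rewrite subst_psum subst_form_mu; congr psum; apply/funext => h.
  by rewrite !ps3conv3_cps // subst_cps.
Qed.

End SubstitutiveTheory.

Section Nested.
Variables (M1 M2 M3 L N : zmodType).

(** This lemma and the next two cover the three shapes [x [y z]], [[x y] z] and [y [x z]] of the
    Jacobi identity. *)
Lemma substitutive_at2r (phi : M1 -> L -> ps1 N) (psi : M2 -> M3 -> ps1 L) :
  additive_l phi -> additive_r phi -> additive_l psi -> additive_r psi ->
  substitutive (fun l m a b c => at2 phi l a (at2 psi m b c)).
Proof.
move=> f1 f2 g1 g2.
split=> [l m b c a a'|l m a c b b'|l m a b c c'|l m f a b c|l m f a b c
        |l m f a b c|l m x y z].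
- by rewrite at2Bl.
- by rewrite at2Bl // at2Br.
- by rewrite at2Br // at2Br.
- by rewrite at2_mul_forml.
- by rewrite at2_mul_forml // at2_mul_formr.
- by rewrite at2_mul_formr // at2_mul_formr.
- by rewrite !subst_at2 // !subst_cps subst_form_lam subst_form_mu.
Qed.

Lemma substitutive_at2l (phi : L -> M3 -> ps1 N) (psi : M1 -> M2 -> ps1 L) :
  additive_l phi -> additive_r phi -> additive_l psi -> additive_r psi ->
  substitutive (fun l m a b c => at2 phi (l + m) (at2 psi l a b) c).
Proof.
move=> f1 f2 g1 g2.
split=> [l m b c a a'|l m a c b b'|l m a b c c'|l m f a b c|l m f a b c
        |l m f a b c|l m x y z].
- by rewrite at2Bl // at2Bl.
- by rewrite at2Br // at2Bl.
- by rewrite at2Br.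
- by rewrite at2_mul_forml // at2_mul_forml.
- by rewrite at2_mul_formr // at2_mul_forml.
- by rewrite at2_mul_formr.
- rewrite !subst_at2 // !subst_cps subst_formD.
  by rewrite subst_form_lam subst_form_mu.
Qed.

Lemma substitutive_at2_swap (phi : M2 -> L -> ps1 N) (psi : M1 -> M3 -> ps1 L) :
  additive_l phi -> additive_r phi -> additive_l psi -> additive_r psi ->
  substitutive (fun l m a b c => at2 phi m b (at2 psi l a c)).
Proof.
move=> f1 f2 g1 g2.
split=> [l m b c a a'|l m a c b b'|l m a b c c'|l m f a b c|l m f a b c
        |l m f a b c|l m x y z].
- by rewrite at2Bl // at2Br.
- by rewrite at2Bl.
- by rewrite at2Br // at2Br.
- by rewrite at2_mul_forml // at2_mul_formr.
- by rewrite at2_mul_forml.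
- by rewrite at2_mul_formr // at2_mul_formr.
- by rewrite !subst_at2 // !subst_cps subst_form_lam subst_form_mu.
Qed.

(** Exhibits the iterated bracket as a single trilinear evaluation, so that its coefficients can be
    compared with those of a Leibnizator. *)
Lemma at3_nested (phi : M1 -> L -> ps1 N) (psi : M2 -> M3 -> ps1 L) l m a b c :
  additive_l phi -> additive_r phi -> additive_l psi -> additive_r psi ->
  at3 (fun x y z k h => phi x (psi y z h) k) l m a b c =
  at2 phi l a (at2 psi m b c).
Proof.
move=> f1 f2 g1 g2.
have h1 : additive1 (fun x y z => (fun k h => phi x (psi y z h) k) : ps2 N).
  by move=> y z x x'; apply/funext => k; apply/funext => h; rewrite f1.
have h2 : additive2 (fun x y z => (fun k h => phi x (psi y z h) k) : ps2 N).
  by move=> x z y y'; apply/funext => k; apply/funext => h; rewrite g1 f2.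
have h3 : additive3 (fun x y z => (fun k h => phi x (psi y z h) k) : ps2 N).
  by move=> x y z z'; apply/funext => k; apply/funext => h; rewrite g2 f2.
apply: (substitutive_ext (substitutive_at3 h1 h2 h3)
  (substitutive_at2r f1 f2 g1 g2)) => x y z.
(* The sum over powers of [mu] must be outermost, since it is the one that can be pulled out of the
   outer bracket. *)
rewrite at3_cps // at2_cps // psumC.
rewrite (psum_morph (T := at2 phi lam x%:S) (m := mu)).
- by congr psum; apply/funext => h; rewrite at2_cps.
- by move=> u v; rewrite at2Dr.
- by move=> u; rewrite at2_mul_formr.
Qed.

End Nested.

(** Evaluation at the variables themselves loses nothing: an identity between such evaluations can
    be read back on coefficients. *)
Lemma at3_coef (M1 M2 M3 N : zmodType) (phi : M1 -> M2 -> M3 -> ps2 N)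
    x y z p q :
  additive1 phi -> additive2 phi -> additive3 phi ->
  at3 phi lam mu x%:S y%:S z%:S p q 0%N = phi x y z p q.
Proof.
move=> f1 f2 f3; rewrite at3_cps //.
move: (phi x y z) => f {x y z}.
elim: p f => [|p IHp] f.
  rewrite psumE ps3DE mul_form_lam addr0; move: (f 0%N) => {}f.
  elim: q f => [|q IHq] f; rewrite psumE ps3DE mul_form_mu /=.
    by rewrite addr0.
  rewrite {1}/cps /= add0r.
  by apply: (IHq (fun h => f h.+1)).
rewrite psumE ps3DE mul_form_lam /= (IHp (fun k => f k.+1)).
(* A series in [mu] alone has no term of positive degree in [lam]. *)
suff -> : psum mu (fun h => (f 0%N h)%:S) p.+1 q 0%N = 0 by rewrite add0r.
move: (f 0%N) => {IHp} {}f; elim: q f => [|q IHq] f.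
  by rewrite psumE ps3DE mul_form_mu /= addr0.
by rewrite psumE ps3DE mul_form_mu /= (IHq (fun h => f h.+1)) addr0.
Qed.

(** * Additivity of conformal sesquilinear maps *)

Section CSesqAdditive.
Variable K : fieldType.
Implicit Types M N : lmodType {poly K}.

Lemma csesq2Dl M1 M2 N (phi : csesq2 M1 M2 N) x x' y :
  phi (x + x') y = phi x y + phi x' y.
Proof.
have -> : x + x' = x - (0 - x') by zmod.
rewrite !csesq2Bl; have := csesq2Bl phi 0 0 y; rewrite !subrr => ->; zmod.
Qed.

Lemma csesq2Dr M1 M2 N (phi : csesq2 M1 M2 N) x y y' :
  phi x (y + y') = phi x y + phi x y'.
Proof.
have -> : y + y' = y - (0 - y') by zmod.
rewrite !csesq2Br; have := csesq2Br phi x 0 0; rewrite !subrr => ->; zmod.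
Qed.

Section ThreeArguments.
Variables (M1 M2 M3 N : lmodType {poly K}) (phi : csesq3 M1 M2 M3 N).

Lemma csesq3_additive1 : additive1 phi.
Proof.
move=> y z x x'; rewrite addrC -scaleN1r -polyCN (csesq3_lin1 (csesq3P phi)).
by rewrite polyCN scaleN1r addrC.
Qed.

Lemma csesq3_additive2 : additive2 phi.
Proof.
move=> y z x x'; rewrite addrC -scaleN1r -polyCN (csesq3_lin2 (csesq3P phi)).
by rewrite polyCN scaleN1r addrC.
Qed.

Lemma csesq3_additive3 : additive3 phi.
Proof.
move=> y z x x'; rewrite addrC -scaleN1r -polyCN (csesq3_lin3 (csesq3P phi)).
by rewrite polyCN scaleN1r addrC.
Qed.

Lemma csesq3_substitutive : substitutive (at3 phi).
Proof.
apply: substitutive_at3.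
- exact: csesq3_additive1.
- exact: csesq3_additive2.
- exact: csesq3_additive3.
Qed.

Lemma csesq3_at3_cps l m x y z : at3 phi l m x%:S y%:S z%:S =
  psum l (fun k => psum m (fun h => (phi x y z k h)%:S)).
Proof.
apply: at3_cps.
- exact: csesq3_additive1.
- exact: csesq3_additive2.
- exact: csesq3_additive3.
Qed.

Lemma csesq3_at3_coef x y z p q :
  at3 phi lam mu x%:S y%:S z%:S p q 0%N = phi x y z p q.
Proof.
apply: at3_coef.
- exact: csesq3_additive1.
- exact: csesq3_additive2.
- exact: csesq3_additive3.
Qed.

Lemma csesq3_at3B1 l m a a' b c :
  at3 phi l m (a - a') b c = at3 phi l m a b c - at3 phi l m a' b c.
Proof. exact: (subB1 csesq3_substitutive). Qed.

Lemma csesq3_at3B2 l m a b b' c :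
  at3 phi l m a (b - b') c = at3 phi l m a b c - at3 phi l m a b' c.
Proof. exact: (subB2 csesq3_substitutive). Qed.

Lemma csesq3_at3B3 l m a b c c' :
  at3 phi l m a b (c - c') = at3 phi l m a b c - at3 phi l m a b c'.
Proof. exact: (subB3 csesq3_substitutive). Qed.

Lemma csesq3_at3_01 l m b c : at3 phi l m 0 b c = 0.
Proof. by have := csesq3_at3B1 l m 0 0 b c; rewrite !subrr. Qed.

Lemma csesq3_at3_02 l m a c : at3 phi l m a 0 c = 0.
Proof. by have := csesq3_at3B2 l m a 0 0 c; rewrite !subrr. Qed.

Lemma csesq3_at3_03 l m a b : at3 phi l m a b 0 = 0.
Proof. by have := csesq3_at3B3 l m a b 0 0; rewrite !subrr. Qed.

End ThreeArguments.

End CSesqAdditive.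

Lemma map_ps0 (M N : zmodType) (h : {additive M -> N}) : map_ps h 0 = 0.
Proof. by apply: ps3P => p q r; exact: raddf0. Qed.

Lemma map_psN (M N : zmodType) (h : {additive M -> N}) a :
  map_ps h (- a) = - map_ps h a.
Proof. by apply: ps3P => p q r; exact: raddfN. Qed.

Lemma map_ps_inj (M N : Type) (h : M -> N) :
  injective h -> injective (map_ps h).
Proof.
move=> hI a b ab; apply/funext => p; apply/funext => q; apply/funext => r.
exact: hI (congr1 (fun f : ps3 N => f p q r) ab).
Qed.

(** * The interchange law for the bracket *)

Section Bracket.
Variables (K : fieldType) (C : two_vect K).
Variables (b0 : csesq2 (vob C) (vob C) (vob C)).
Variables (b1 : csesq2 (vmor C) (vmor C) (vmor C)).
Hypothesis bP : bracket_functor b0 b1.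

(** Write [f] as the identity of 0 followed by [f], and [g] as [g] followed by the identity of its
    target. Functoriality factors the bracket, and the first factor, a bracket with the zero
    morphism, is the identity of 0. *)
Lemma br_vtgt_r f g : vsrc f = 0 -> b1 f g = b1 f (vid (vtgt g)).
Proof.
move=> sf; have [s1 t1 sc tc c1f cf1 cA cL] := two_vectP C.
have [bs bt bi bc] := bP; apply/funext => k.
have c1 : composable (vid 0) f by rewrite /composable t1 sf.
have c2 : composable g (vid (vtgt g)) by rewrite /composable s1.
have := bc _ _ _ _ c1 c2 k; rewrite -{1}sf c1f cf1 => ->.
have b10 : b1 (vid 0) g = 0 by rewrite linear0 additive_l0 //; exact: csesq2Bl.
have s0 : vsrc (b1 f (vid (vtgt g)) k) = 0.
  have /= -> := congr1 (fun h : ps1 _ => h k) (bs f (vid (vtgt g))).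
  by rewrite sf additive_l0 //; exact: csesq2Bl.
by rewrite b10 -[X in vcmp X](linear0 vid) -s0 c1f.
Qed.

Lemma br_vtgt_l f g : vsrc g = 0 -> b1 f g = b1 (vid (vtgt f)) g.
Proof.
move=> sg; have [s1 t1 sc tc c1f cf1 cA cL] := two_vectP C.
have [bs bt bi bc] := bP; apply/funext => k.
have c1 : composable (vid 0) g by rewrite /composable t1 sg.
have c2 : composable f (vid (vtgt f)) by rewrite /composable s1.
have := bc _ _ _ _ c2 c1 k; rewrite -{1}sg c1f cf1 => ->.
have b10 : b1 f (vid 0) = 0 by rewrite linear0 additive_r0 //; exact: csesq2Br.
have s0 : vsrc (b1 (vid (vtgt f)) g k) = 0.
  have /= -> := congr1 (fun h : ps1 _ => h k) (bs (vid (vtgt f)) g).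
  by rewrite sg additive_r0 //; exact: csesq2Br.
by rewrite b10 -[X in vcmp X](linear0 vid) -s0 c1f.
Qed.

End Bracket.

(** * Leibniz conformal 2-algebras in terms of arrow parts *)

(* [iota] and [arr] identify [G1] with the kernel of the source map; this is
   used both for the kernel itself and for the second factor of a product. *)
Section SplitLeibniz.
Variables (K : fieldType) (C : two_vect K) (G1 : lmodType {poly K}).
Variables (iota : {linear G1 -> vmor C}) (arr : {linear vmor C -> G1}).
Hypothesis iotaK : cancel iota arr.
Hypothesis arrE : forall f, iota (arr f) = f - vid (vsrc f).

Lemma split_morE f : f = vid (vsrc f) + iota (arr f).
Proof. by rewrite arrE; zmod. Qed.

Lemma vsrc_iota u : vsrc (iota u) = 0.
Proof.
have := arrE (iota u); rewrite iotaK => /eqP; rewrite -subr_eq0.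
rewrite opprB addrC subrK => /eqP /(congr1 vsrc).
by rewrite vsrc_vid linear0.
Qed.

Lemma arr_vid x : arr (vid x) = 0.
Proof.
by apply: (can_inj iotaK); rewrite arrE vsrc_vid subrr linear0.
Qed.

Lemma map_src_iota u : map_ps vsrc (map_ps iota u) = 0.
Proof. by apply: ps3P => p q r; exact: vsrc_iota. Qed.

Lemma map_arr_iota u : map_ps arr (map_ps iota u) = u.
Proof. by apply: ps3P => p q r; exact: iotaK. Qed.

Lemma map_arr_id a : map_ps arr (id_ps a) = 0.
Proof. by apply: ps3P => p q r; exact: arr_vid. Qed.

Variables (b0 : csesq2 (vob C) (vob C) (vob C)).
Variables (b1 : csesq2 (vmor C) (vmor C) (vmor C)).
Hypothesis bP : bracket_functor b0 b1.
Variables (d : {linear G1 -> vob C}).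
Hypothesis dE : forall u, d u = vtgt (iota u).
Variables (r01 : csesq2 (vob C) G1 G1) (r10 : csesq2 G1 (vob C) G1).
Hypothesis r01E : forall x u k, iota (r01 x u k) = b1 (vid x) (iota u) k.
Hypothesis r10E : forall u x k, iota (r10 u x k) = b1 (iota u) (vid x) k.

Lemma map_tgt_iota u : map_ps vtgt (map_ps iota u) = map_ps d u.
Proof. by apply: ps3P => p q r; rewrite /map_ps dE. Qed.

Lemma split_d01 x u : d \o r01 x u = b0 x (d u).
Proof.
apply/funext => k; rewrite /= !dE r01E.
have /= -> := congr1 (fun h : ps1 _ => h k) (br_tgt bP (vid x) (iota u)).
by rewrite vtgt_vid.
Qed.

Lemma split_d10 u x : d \o r10 u x = b0 (d u) x.
Proof.
apply/funext => k; rewrite /= !dE r10E.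
have /= -> := congr1 (fun h : ps1 _ => h k) (br_tgt bP (iota u) (vid x)).
by rewrite vtgt_vid.
Qed.

(** Both sides are the bracket of the morphisms [iota u] and [iota v], with the interchange law
    applied on one side or the other. *)
Lemma split_11 u v : r01 (d u) v = r10 u (d v).
Proof.
apply/funext => k; apply: (can_inj iotaK); rewrite r01E r10E !dE.
by rewrite -(br_vtgt_l bP) ?vsrc_iota // (br_vtgt_r bP) ?vsrc_iota.
Qed.

(** Bilinear expansion of [f] and then of [g]. The asymmetry between source and target is a choice:
    the bracket of [iota (arr f)] with [g] is left whole and rewritten with the target of [g] by
    [br_vtgt_r]. *)
Lemma split_b1 f g k : b1 f g k = vid (b0 (vsrc f) (vsrc g) k)
  + iota (r01 (vsrc f) (arr g) k) + iota (r10 (arr f) (vtgt g) k).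
Proof.
rewrite r01E r10E -(br_vtgt_r bP) ?vsrc_iota //.
have /= <- := congr1 (fun h : ps1 _ => h k) (br_id bP (vsrc f) (vsrc g)).
by rewrite -2!ps1DE -csesq2Dr -split_morE -csesq2Dl -split_morE.
Qed.

Lemma split_at2_b1 l f g : at2 b1 l f g =
  id_ps (at2 b0 l (map_ps vsrc f) (map_ps vsrc g))
  + map_ps iota (at2 r01 l (map_ps vsrc f) (map_ps arr g))
  + map_ps iota (at2 r10 l (map_ps arr f) (map_ps vtgt g)).
Proof.
rewrite /id_ps !map_at2 !at2_map -!at2Df; congr (at2 _ _ _ _).
by apply/funext => u; apply/funext => v; apply/funext => k; exact: split_b1.
Qed.

Variables (r3 : csesq3 (vob C) (vob C) (vob C) G1).
Variables (L : csesq3 (vob C) (vob C) (vob C) (vmor C)).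
Hypothesis LE : forall x y z p q,
  L x y z p q = vid (b0 x (b0 y z q) p) - iota (r3 x y z p q).

(** The passage from diagrams to arrow parts: once the identity parts of two composites cancel,
    their difference lies in the image of the injective map [iota]. *)
Lemma eq_iota_iff X Y u v :
  X - Y = map_ps iota (v - u) -> X = Y <-> u = v.
Proof.
move=> XY; split=> [E|E]; last first.
  by apply/eqP; rewrite -subr_eq0 XY E subrr map_ps0.
apply/eqP; rewrite eq_sym -subr_eq0; apply/eqP.
by apply: (map_ps_inj (can_inj iotaK)); rewrite -XY E subrr map_ps0.
Qed.

Let P l a b := at2 b0 l a b.
Let jacobi := forall l m a b c, map_ps d (at3 r3 l m a b c) =
  P l a (P m b c) - P (l + m) (P l a b) c - P m b (P l a c).

(** [LE] gives this on coefficients, hence at [lam], [mu] and constants; both sides being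
    substitutive, it extends to all forms and series. *)
Lemma split_at3 l m a b c :
  at3 L l m a b c = id_ps (P l a (P m b c)) - map_ps iota (at3 r3 l m a b c).
Proof.
have bl := csesq2Bl b0; have br := csesq2Br b0.
have s1 := substitutive_map vid (substitutive_at2r bl br bl br).
have s2 := substitutive_map iota (csesq3_substitutive r3).
apply: (substitutive_ext (csesq3_substitutive L) (substitutiveB s1 s2)).
move=> x y z /=; rewrite !csesq3_at3_cps -at3_nested //.
rewrite at3_cps; first last.
- by move=> u v w w'; apply/funext => p; apply/funext => q; rewrite br br.
- by move=> u v w w'; apply/funext => p; apply/funext => q; rewrite bl br.
- by move=> u v w w'; apply/funext => p; apply/funext => q; rewrite bl.
rewrite /id_ps !map_psum -psumB; congr psum; apply/funext => k.
rewrite !map_psum -psumB; congr psum; apply/funext => h.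
by rewrite !map_cps -cpsB LE.
Qed.

Lemma split_src_at3 l m a b c :
  map_ps vsrc (at3 L l m a b c) = P l a (P m b c).
Proof. by rewrite split_at3 map_psB map_src_id map_src_iota subr0. Qed.

Lemma jacobi_general :
  (forall x y z, map_ps d (at3 r3 lam mu x%:S y%:S z%:S) =
    P lam x%:S (P mu y%:S z%:S) - P (lam + mu) (P lam x%:S y%:S) z%:S
    - P mu y%:S (P lam x%:S z%:S)) -> jacobi.
Proof.
have bl := csesq2Bl b0; have br := csesq2Br b0.
move=> jac; apply: (substitutive_ext
  (substitutive_map d (csesq3_substitutive r3))) => //.
apply: substitutiveB; last exact: substitutive_at2_swap.
by apply: substitutiveB; [exact: substitutive_at2r | exact: substitutive_at2l].
Qed.

Lemma split_tgt_at3 l m a b c : jacobi ->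
  map_ps vtgt (at3 L l m a b c) = P (l + m) (P l a b) c + P m b (P l a c).
Proof.
move=> jac; rewrite split_at3 map_psB map_tgt_id map_tgt_iota jac; zmod.
Qed.

Lemma map_src_b1 l f g : map_ps vsrc (at2 b1 l f g) =
  P l (map_ps vsrc f) (map_ps vsrc g).
Proof.
rewrite /P map_at2 at2_map; congr (at2 _ _ _ _).
by apply/funext => u; apply/funext => v; rewrite (br_src bP).
Qed.

Lemma map_tgt_b1 l f g : map_ps vtgt (at2 b1 l f g) =
  P l (map_ps vtgt f) (map_ps vtgt g).
Proof.
rewrite /P map_at2 at2_map; congr (at2 _ _ _ _).
by apply/funext => u; apply/funext => v; rewrite (br_tgt bP).
Qed.

Lemma map_arr_b1 l f g : map_ps arr (at2 b1 l f g) =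
  at2 r01 l (map_ps vsrc f) (map_ps arr g)
  + at2 r10 l (map_ps arr f) (map_ps vtgt g).
Proof. by rewrite split_at2_b1 !map_psD !map_arr_iota map_arr_id add0r. Qed.

(** The right-hand side collects the arrow parts of the three iterated brackets of [f], [g], [h],
    computed by [split_b1]; [jacobi] supplies the target of [L], hence the composability of the
    second composite. *)
Lemma split_nat f g h : jacobi ->
  let sf := map_ps vsrc f in let sg := map_ps vsrc g in
  let sh := map_ps vsrc h in let af := map_ps arr f in
  let ag := map_ps arr g in let ah := map_ps arr h in
  let tf := map_ps vtgt f in let tg := map_ps vtgt g in
  let th := map_ps vtgt h in
  (cmp_ps (at2 b1 lam f (at2 b1 mu g h)) (at3 L lam mu tf tg th) =
   cmp_ps (at3 L lam mu sf sg sh) (at2 b1 (lam + mu) (at2 b1 lam f g) h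
                                   + at2 b1 mu g (at2 b1 lam f h))) <->
  at3 r3 lam mu tf tg th - at3 r3 lam mu sf sg sh =
    (at2 r01 lam sf (at2 r01 mu sg ah + at2 r10 mu ag th)
     + at2 r10 lam af (P mu tg th))
  - (at2 r01 (lam + mu) (P lam sf sg) ah
     + at2 r10 (lam + mu) (at2 r01 lam sf ag + at2 r10 lam af tg) th)
  - (at2 r01 mu sg (at2 r01 lam sf ah + at2 r10 lam af th)
     + at2 r10 mu ag (P lam tf th)).
Proof.
move=> jac sf sg sh af ag ah tf tg th.
rewrite cmp_psE; last by rewrite split_src_at3 !map_tgt_b1.
rewrite cmp_psE; last first.
  by rewrite split_tgt_at3 // map_psD !map_src_b1.
rewrite split_tgt_at3 // !map_tgt_b1 !split_at3.
rewrite !(split_at2_b1 _ _ (at2 b1 _ _ _)) !(split_at2_b1 _ (at2 b1 _ _ _) h).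
rewrite !map_src_b1 !map_tgt_b1 !map_arr_b1 -/sf -/sg -/sh -/af -/ag -/ah.
rewrite -/tf -/tg -/th.
have idD (a b : ps3 (vob C)) : id_ps (a + b) = id_ps a + id_ps b.
  exact: map_psD.
set A1 := at3 r3 _ _ _ _ _; set A2 := at3 r3 _ _ _ _ _.
set B1 := at2 r01 lam sf _; set B2 := at2 r10 lam af (P _ _ _).
set B3 := at2 r01 _ (P _ _ _) ah; set B4 := at2 r10 _ _ th.
set B5 := at2 r01 mu sg _; set B6 := at2 r10 mu ag _.
by apply: eq_iota_iff; rewrite !(map_psB, map_psD) !idD; zmod.
Qed.

Lemma split_at2_id01 l a u :
  at2 b1 l (id_ps a) (map_ps iota u) = map_ps iota (at2 r01 l a u).
Proof.
rewrite split_at2_b1 map_src_id map_src_iota map_arr_id map_arr_iota.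
rewrite (at2_0r _ _ (csesq2Br b0)) (at2_0l _ _ (csesq2Bl r10)).
by rewrite /id_ps !map_ps0 add0r addr0.
Qed.

Lemma split_at2_id10 l u a :
  at2 b1 l (map_ps iota u) (id_ps a) = map_ps iota (at2 r10 l u a).
Proof.
rewrite split_at2_b1 map_src_id map_src_iota map_arr_id map_arr_iota map_tgt_id.
rewrite (at2_0l _ _ (csesq2Bl b0)) (at2_0r _ _ (csesq2Br r01)).
by rewrite /id_ps !map_ps0 !add0r.
Qed.

Lemma split_at2_id l a b : at2 b1 l (id_ps a) (id_ps b) = id_ps (P l a b).
Proof.
rewrite split_at2_b1 !map_src_id !map_arr_id map_tgt_id.
rewrite (at2_0r _ _ (csesq2Br r01)) (at2_0l _ _ (csesq2Bl r10)).
by rewrite !map_ps0 !addr0.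
Qed.

Lemma split_coh x y z w : jacobi ->
  let X := id_ps x in let Y := id_ps y in let Z := id_ps z in
  let W := id_ps w in
  (cmp_ps (cmp_ps (at2 b1 lam X (at3 L mu nu y z w))
      (at3 L lam (mu + nu) x (P mu y z) w + at3 L lam nu x z (P mu y w)))
      (at2 b1 (lam + mu + nu) (at3 L lam mu x y z) W
          + id_ps (P (mu + nu) (P mu y z) (P lam x w))
          + id_ps (P (lam + nu) (P lam x z) (P mu y w))
          + at2 b1 nu Z (at3 L lam mu x y w)) =
   cmp_ps (cmp_ps (at3 L lam mu x y (P nu z w))
      (id_ps (P (lam + mu) (P lam x y) (P nu z w))
          + at2 b1 mu Y (at3 L lam nu x z w)))
      (at3 L (lam + mu) nu (P lam x y) z w
          + at3 L mu (lam + nu) y (P lam x z) w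
          + at3 L mu nu y z (P lam x w))) <->
      at2 r01 lam x (at3 r3 mu nu y z w)
    - at2 r01 mu y (at3 r3 lam nu x z w)
    + at2 r01 nu z (at3 r3 lam mu x y w)
    + at2 r10 (lam + mu + nu) (at3 r3 lam mu x y z) w
    - at3 r3 (lam + mu) nu (P lam x y) z w
    - at3 r3 mu (lam + nu) y (P lam x z) w
    - at3 r3 mu nu y z (P lam x w)
    + at3 r3 lam (mu + nu) x (P mu y z) w
    + at3 r3 lam nu x z (P mu y w)
    - at3 r3 lam mu x y (P nu z w) = 0.
Proof.
move=> jac X Y Z W.
have bl := csesq2Bl b0; have br := csesq2Br b0.
have idD (a b : ps3 (vob C)) : id_ps (a + b) = id_ps a + id_ps b.
  exact: map_psD.
(* The target formula of [L] at [lam] and [mu + nu] produces the left form, the coherence diagram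
   uses the right one. *)
have lmn : lam + (mu + nu) = lam + mu + nu by rewrite addrA.
have T l m a b c := split_tgt_at3 l m a b c jac.
have c1 : map_ps vtgt (at2 b1 lam X (at3 L mu nu y z w)) = map_ps vsrc
    (at3 L lam (mu + nu) x (P mu y z) w + at3 L lam nu x z (P mu y w)).
  by rewrite map_tgt_b1 map_tgt_id T map_psD !split_src_at3 /P at2Dr.
have t1 : map_ps vtgt (at3 L lam (mu + nu) x (P mu y z) w
      + at3 L lam nu x z (P mu y w)) =
    P (lam + mu + nu) (P lam x (P mu y z)) w
    + P (mu + nu) (P mu y z) (P lam x w)
    + (P (lam + nu) (P lam x z) (P mu y w) + P nu z (P lam x (P mu y w))).
  by rewrite map_psD !T lmn.
have c2 : map_ps vtgt (cmp_ps (at2 b1 lam X (at3 L mu nu y z w))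
      (at3 L lam (mu + nu) x (P mu y z) w + at3 L lam nu x z (P mu y w))) =
    map_ps vsrc (at2 b1 (lam + mu + nu) (at3 L lam mu x y z) W
          + id_ps (P (mu + nu) (P mu y z) (P lam x w))
          + id_ps (P (lam + nu) (P lam x z) (P mu y w))
          + at2 b1 nu Z (at3 L lam mu x y w)).
  rewrite map_tgt_cmp // t1 !map_psD !map_src_b1 !map_src_id !split_src_at3.
  zmod.
have c3 : map_ps vtgt (at3 L lam mu x y (P nu z w)) = map_ps vsrc
    (id_ps (P (lam + mu) (P lam x y) (P nu z w))
          + at2 b1 mu Y (at3 L lam nu x z w)).
  by rewrite T !map_psD !map_src_b1 !map_src_id !split_src_at3.
have t3 : map_ps vtgt (id_ps (P (lam + mu) (P lam x y) (P nu z w))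
          + at2 b1 mu Y (at3 L lam nu x z w)) =
    P (lam + mu) (P lam x y) (P nu z w)
    + (P mu y (P (lam + nu) (P lam x z) w) + P mu y (P nu z (P lam x w))).
  by rewrite map_psD map_tgt_b1 !map_tgt_id T /P at2Dr.
have c4 : map_ps vtgt (cmp_ps (at3 L lam mu x y (P nu z w))
      (id_ps (P (lam + mu) (P lam x y) (P nu z w))
          + at2 b1 mu Y (at3 L lam nu x z w))) =
    map_ps vsrc (at3 L (lam + mu) nu (P lam x y) z w
          + at3 L mu (lam + nu) y (P lam x z) w
          + at3 L mu nu y z (P lam x w)).
  rewrite map_tgt_cmp // t3 !map_psD !split_src_at3; zmod.
rewrite (cmp_psE c2) (cmp_psE c4) (map_tgt_cmp c1) (map_tgt_cmp c3) t1 t3.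
rewrite (cmp_psE c1) (cmp_psE c3) map_tgt_b1 map_tgt_id !T.
rewrite !split_at3 !(at2Br _ _ _ _ (csesq2Br b1)).
rewrite !(at2Bl _ _ _ _ (csesq2Bl b1)).
rewrite /X /Y /Z /W !split_at2_id !split_at2_id01 !split_at2_id10.
set e := (X in _ <-> X = 0).
apply: eq_iota_iff; rewrite /e !(map_psB, map_psD, map_psN, map_ps0) !idD.
(* The targets of the first arrows contain brackets of sums; expanding them lets all the identity
   parts cancel. *)
rewrite /P !(at2Dr _ _ _ _ br) !idD.
zmod.
Qed.

(** From left to right, naturality is tested on triples made of two identities and one morphism
    [iota v], which yields (vi)-(viii). Conversely, an arbitrary triple is moved from sources to
    targets one argument at a time. *)
Lemma split_leibnizatorP :
  leibnizator_axioms b0 b1 L <-> leib_infty_axioms d b0 r01 r10 r3.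
Proof.
have tgtL x y z : map_ps vtgt (at3 L lam mu x%:S y%:S z%:S) =
    P lam x%:S (P mu y%:S z%:S) - map_ps d (at3 r3 lam mu x%:S y%:S z%:S).
  by rewrite split_at3 map_psB map_tgt_id map_tgt_iota.
split=> [[zs zt zn zi zc]|[_ _ l11 lj lj3 lj2 lj1 lc]].
- have jac : jacobi.
    apply: jacobi_general => x y z.
    have aux (V : zmodType) (t s e : V) : t = s - e -> e = s - t.
      by move=> ->; zmod.
    by rewrite (aux _ _ _ _ (tgtL x y z)) zt /P; zmod.
  have nat f g h := proj1 (split_nat f%:S g%:S h%:S jac).
  (* On the test triples two arrow parts and one source vanish, and these rules remove the
     corresponding terms. *)
  have simp := (cps0,
    (fun l a => at2_0l l a (csesq2Bl r10)),
    (fun l a => at2_0r l a (csesq2Br r01)),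
    (fun l a => at2_0r l a (csesq2Br b0)),
    (fun l a => at2_0l l a (csesq2Bl b0)),
    (fun l a => at2_0l l a (csesq2Bl r01)),
    (fun l a => at2_0r l a (csesq2Br r10)),
    csesq3_at3_01, csesq3_at3_02, csesq3_at3_03, addr0, add0r, subr0).
  split.
  + exact: split_d01.
  + exact: split_d10.
  + exact: split_11.
  + by move=> x y z; exact: jac.
  + move=> x y v; have := nat (vid x) (vid y) (iota v).
    rewrite !map_cps /= => /(_ (zn _ _ _)).
    by rewrite !vsrc_vid !vtgt_vid !arr_vid vsrc_iota iotaK -dE /P !simp.
  + move=> x v y; have := nat (vid x) (iota v) (vid y).
    rewrite !map_cps /= => /(_ (zn _ _ _)).
    by rewrite !vsrc_vid !vtgt_vid !arr_vid vsrc_iota iotaK -dE /P !simp.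
  + move=> v x y; have := nat (iota v) (vid x) (vid y).
    rewrite !map_cps /= => /(_ (zn _ _ _)).
    by rewrite !vsrc_vid !vtgt_vid !arr_vid vsrc_iota iotaK -dE /P !simp.
  + move=> x y z w; apply: (proj1 (split_coh _ _ _ _ jac)).
    by rewrite /id_ps !map_cps; exact: zc.
have jac : jacobi := jacobi_general lj.
split.
- by move=> x y z; rewrite split_src_at3.
- by move=> x y z; rewrite split_tgt_at3.
- move=> f g h; have := proj2 (split_nat f%:S g%:S h%:S jac).
  rewrite !map_cps /=; apply.
  have tE k : vtgt k = vsrc k + d (arr k).
    by rewrite {1}[k]split_morE linearD /= vtgt_vid dE.
  have cpsD (V : zmodType) (x y : V) : (x + y)%:S = x%:S + y%:S.
    by apply: ps3P => p q r; rewrite ps3DE /cps; case: ifP; rewrite ?addr0.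
  set x := vsrc f; set y := vsrc g; set z := vsrc h.
  set u := arr f; set v := arr g; set w := arr h.
  (* Telescoping: the first argument changes while the others are at their targets, then the second,
     then the third, so each summand is the left-hand side of one of (viii), (vii), (vi). *)
  have E3 : at3 r3 lam mu (vtgt f)%:S (vtgt g)%:S (vtgt h)%:S
      - at3 r3 lam mu x%:S y%:S z%:S =
      at3 r3 lam mu (d u)%:S (vtgt g)%:S (vtgt h)%:S
      + at3 r3 lam mu x%:S (d v)%:S (vtgt h)%:S
      + at3 r3 lam mu x%:S y%:S (d w)%:S.
    have -> : d u = vtgt f - x by rewrite tE /x /u; zmod.
    have -> : d v = vtgt g - y by rewrite tE /y /v; zmod.
    have -> : d w = vtgt h - z by rewrite tE /z /w; zmod.
    rewrite !cpsB csesq3_at3B1 csesq3_at3B2 csesq3_at3B3; zmod.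
  rewrite E3 lj1 lj2 lj3.
  have l11' l (a b : ps3 G1) :
      at2 r01 l (map_ps d a) b = at2 r10 l a (map_ps d b).
    rewrite at2_mapl at2_mapr; congr (at2 _ _ _ _).
    by apply/funext => a'; apply/funext => b'; exact: l11.
  have ld10' l (a : ps3 G1) b :
      map_ps d (at2 r10 l a b) = at2 b0 l (map_ps d a) b.
    rewrite map_at2 at2_mapl; congr (at2 _ _ _ _).
    by apply/funext => a'; apply/funext => b'; exact: split_d10.
  (* The single cross term that multilinearity does not match: (iv) moves [d] onto the inner
     bracket, and (iii) moves it on to [u]. *)
  have key : at2 r01 mu (d v)%:S (at2 r10 lam u%:S (vtgt h)%:S) =
      at2 r10 mu v%:S (at2 b0 lam (d u)%:S (vtgt h)%:S).
    by rewrite -!(map_cps d) l11' ld10'.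
  rewrite (_ : (vtgt g)%:S = y%:S + (d v)%:S) in key *;
    last by rewrite -cpsD tE.
  rewrite (_ : (vtgt f)%:S = x%:S + (d u)%:S) in key *;
    last by rewrite -cpsD tE.
  rewrite /P !(at2Dr _ _ _ _ (csesq2Br r01)) !(at2Dr _ _ _ _ (csesq2Br r10)).
  rewrite !(at2Dl _ _ _ _ (csesq2Bl r10)) !(at2Dl _ _ _ _ (csesq2Bl b0)).
  rewrite !(at2Dl _ _ _ _ (csesq2Bl r01)) !(at2Dr _ _ _ _ (csesq2Br r10)).
  by rewrite key; zmod.
(* Every morphism of a 2-vector space is invertible: the inverse of f is 1_(s f) + 1_(t f) - f. *)
- by move=> x y z; eexists => i j; exact: inverse_morphismsP.
- move=> x y z w.
  have := proj2 (split_coh x%:S y%:S z%:S w%:S jac) (lc x y z w).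
  by rewrite /id_ps !map_cps.
Qed.

End SplitLeibniz.

(** * The functor to 2-term algebras *)

Section FullyFaithful.
Variables (A B : category) (F : functor A B).
Variable lift : forall a a', hom (F a) (F a') -> hom a a'.
Hypothesis liftK : forall a a', cancel (@lift a a') (@fmap A B F a a').
Hypothesis fmapK : forall a a', cancel (@fmap A B F a a') (@lift a a').
Variables (g : B -> A) (e : forall b, hom (F (g b)) b).
Variable e' : forall b, hom b (F (g b)).
Hypothesis e'K : forall b, compm (e' b) (e b) = idm (F (g b)).
Hypothesis eK : forall b, compm (e b) (e' b) = idm b.

Let fmap_inj a a' : injective (@fmap A B F a a') := can_inj (@fmapK a a').

Let inverse_fmap b b' (h : hom b b') : hom (g b) (g b') :=
  lift (compm (e' b') (compm h (e b))).

Lemma inverse_fmap1 b : inverse_fmap (idm b) = idm (g b).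
Proof. by apply: fmap_inj; rewrite liftK fmap1 comp1m e'K. Qed.

Lemma inverse_fmapM b1 b2 b3 (h : hom b2 b3) (k : hom b1 b2) :
  inverse_fmap (compm h k) = compm (inverse_fmap h) (inverse_fmap k).
Proof.
apply: fmap_inj; rewrite fmapM !liftK.
by rewrite -!compmA (compmA (e b2)) eK comp1m.
Qed.

Definition inverse_functor : functor B A := Functor inverse_fmap1 inverse_fmapM.

(** The isomorphisms [e] serve on the side of [B] and their lifts on the side of [A]; faithfulness
    allows every equation in [A] to be checked after applying [F]. Explicit inverses and preimages
    are part of the data, so nothing has to be chosen. *)
Lemma fully_faithful_equivalence : equivalent_categories A B.
Proof.
exists F, inverse_functor; split.
- exists (fun a => lift (e (F a))); split => [a a' h|a].
    apply: fmap_inj; rewrite !fmapM /= !liftK.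
    by rewrite compmA eK comp1m.
  exists (lift (e' (F a))); split; apply: fmap_inj.
    by rewrite fmapM !liftK e'K fmap1.
  by rewrite fmapM !liftK eK fmap1.
- exists e; split => [b b' h|b].
    by rewrite /= liftK compmA eK comp1m.
  by exists (e' b); split; [exact: e'K | exact: eK].
Qed.

End FullyFaithful.

(** * The kernel of a linear map as a module *)

Section Kernel.
Variables (R : nzRingType) (M N : lmodType R) (f : {linear M -> N}).

Definition ker_pred : {pred M} := [pred x | f x == 0].

Lemma ker_submod_closed : submod_closed ker_pred.
Proof.
split=> [|a x y]; rewrite !inE ?linear0 // => /eqP fx /eqP fy.
by rewrite linearP fx fy scaler0 addr0.
Qed.

HB.instance Definition _ :=
  GRing.isSubmodClosed.Build R M ker_pred ker_submod_closed.

Record kernel := Kernel { kernel_val : M; kernelP : kernel_val \in ker_pred }.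

HB.instance Definition _ := [isSub for kernel_val].
HB.instance Definition _ := [Choice of kernel by <:].
HB.instance Definition _ := [SubChoice_isSubLmodule of kernel by <:].

Lemma kernel_val_linear : linear kernel_val.
Proof. by []. Qed.

Lemma kernel_val0 (x : kernel) : f (kernel_val x) = 0.
Proof. exact/eqP/kernelP. Qed.
End Kernel.

Section Csesq3Theory.
Variables (K : fieldType).

Lemma is_csesq3_post (M1 M2 M3 N N' : lmodType {poly K}) (h : {linear N -> N'})
    (phi : M1 -> M2 -> M3 -> ps2 N) :
  is_csesq3 phi -> is_csesq3 (fun x y z p => h \o phi x y z p).
Proof.
case=> h1 h2 h3 h4 h5 h6.
split=> *; apply/funext => p; apply/funext => q;
  rewrite ?(h1, h2, h3, h4, h5, h6) /= !fctE ?linearD ?linearN ?linearZ //.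
- by case: p => [|p] //=; rewrite linear0.
- by case: q => [|q] //=; rewrite linear0.
- congr (_ + _ + _); first by case: p => [|p] //=; rewrite linear0.
  by case: q => [|q] //=; rewrite linear0.
Qed.

Lemma nested_coef (M1 M2 M3 L N : lmodType {poly K})
    (phi : csesq2 M1 L N) (psi : csesq2 M2 M3 L) x y z p q :
  at2 phi lam x%:S (at2 psi mu y%:S z%:S) p q 0%N = phi x (psi y z q) p.
Proof.
have fl := csesq2Bl phi; have fr := csesq2Br phi.
have gl := csesq2Bl psi; have gr := csesq2Br psi.
rewrite -at3_nested // at3_coef // => u v w w';
  apply/funext => i; apply/funext => j.
- by rewrite fl.
- by rewrite gl fr.
- by rewrite gr fr.
Qed.

(** In the last argument the derivation passes the inner bracket as 'X + mu and then the outer one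
    as 'X + lam, giving the required 'X + lam + mu. *)
Lemma is_csesq3_nested (M1 M2 M3 L N : lmodType {poly K})
    (phi : csesq2 M1 L N) (psi : csesq2 M2 M3 L) :
  is_csesq3 (fun x y z p q => phi x (psi y z q) p).
Proof.
have [f1 f2 f3 f4] := csesq2P phi; have [g1 g2 g3 g4] := csesq2P psi.
have fB := csesq2Br phi.
have f0 x : phi x 0 = 0 by apply: additive_r0.
split=> *; apply/funext => p; apply/funext => q.
- by rewrite f1.
- by rewrite g1 f2.
- by rewrite g2 f2.
- by rewrite f3; case: p.
- rewrite g3 -[(- _ : ps1 L) q]/(- _ : L) -sub0r fB f0 sub0r.
  by case: q => [|q] //=; rewrite f0.
- rewrite g4 -[(_ + _ : ps1 L) q]/('X *: psi _ _ q + mulX (psi _ _) q) csesq2Dr.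
  rewrite f4 -[RHS]/(_ + _ + _ : N); congr (_ + _).
    by case: p.
  by case: q => [|q] //=; rewrite f0.
Qed.

End Csesq3Theory.

HB.instance Definition _ (R : nzRingType) (M N : lmodType R)
    (f : {linear M -> N}) :=
  GRing.isLinear.Build R (kernel f) M *:%R (@kernel_val R M N f)
    (kernel_val_linear (f := f)).

(** * Arrow parts and the 2-term algebra of a Leibniz conformal 2-algebra *)

Section ArrowPart.
Variables (K : fieldType) (C : two_vect K).

Definition src_ker : lmodType {poly K} :=
  kernel (vsrc : {linear vmor C -> vob C}).

Definition src_ker_val : {linear src_ker -> vmor C} := @kernel_val _ _ _ vsrc.

Lemma arrow_part_subproof (f : vmor C) : f - vid (vsrc f) \in ker_pred vsrc.
Proof. by rewrite inE linearB /= vsrc_vid subrr. Qed.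

Definition arrow_part_fun (f : vmor C) : src_ker :=
  Kernel (arrow_part_subproof f).

Lemma arrow_part_linear : linear arrow_part_fun.
Proof.
move=> a f g; apply: val_inj; rewrite /= !linearP /= !(scalerDr, scalerN); zmod.
Qed.

HB.instance Definition _ :=
  GRing.isLinear.Build {poly K} (vmor C) src_ker *:%R arrow_part_fun
    arrow_part_linear.

Definition arrow_part : {linear vmor C -> src_ker} := arrow_part_fun.

Lemma vsrc_src_ker_val u : vsrc (src_ker_val u) = 0.
Proof. exact: kernel_val0. Qed.

Lemma src_ker_valD u v :
  src_ker_val (u + v) = src_ker_val u + src_ker_val v.
Proof. exact: linearD. Qed.

Lemma src_ker_valK : cancel src_ker_val arrow_part.
Proof.
move=> u; apply: val_inj.
by rewrite /= (kernel_val0 u) linear0 subr0.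
Qed.

Lemma arrow_partE f : src_ker_val (arrow_part f) = f - vid (vsrc f).
Proof. by []. Qed.

End ArrowPart.
Arguments src_ker_val {K C} : simpl never.
Arguments arrow_part {K C} : simpl never.

Section LeibInftyOfLeib2.
Variables (K : fieldType) (C : leib2 K).

Definition arrow_d : {linear src_ker C -> vob C} := vtgt \o @src_ker_val K C.

Lemma arrow_r01_subproof :
  is_csesq2 (fun x u => @arrow_part K C \o b1 (vid x) (src_ker_val u)).
Proof. exact/is_csesq2_post/is_csesq2_pre/csesq2P. Qed.
Definition arrow_r01 := CSesq2 arrow_r01_subproof.

Lemma arrow_r10_subproof :
  is_csesq2 (fun u x => @arrow_part K C \o b1 (src_ker_val u) (vid x)).
Proof. exact/is_csesq2_post/is_csesq2_pre/csesq2P. Qed.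
Definition arrow_r10 := CSesq2 arrow_r10_subproof.

Let narr : {linear vmor C -> src_ker C} := -%R \o @arrow_part K C.

Lemma arrow_r3_subproof :
  is_csesq3 (fun x y z p => narr \o @lz K C x y z p).
Proof. exact/is_csesq3_post/csesq3P. Qed.
Definition arrow_r3 := CSesq3 arrow_r3_subproof.

(** The bracket has source [x, 0] = 0, so it already lies in the kernel and taking its arrow part
    does not change it. *)
Lemma arrow_r01E x u k :
  src_ker_val (arrow_r01 x u k) = b1 (vid x) (src_ker_val u) k.
Proof.
have E : vsrc (b1 (vid x) (src_ker_val u) k) = 0.
  apply: etrans (congr1 (fun h : ps1 _ => h k) (br_src (b_functor C) _ _)) _.
  by rewrite vsrc_src_ker_val additive_r0 //; exact: csesq2Br.
by apply: etrans (arrow_partE _) _; rewrite E linear0 subr0.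
Qed.

Lemma arrow_r10E u x k :
  src_ker_val (arrow_r10 u x k) = b1 (src_ker_val u) (vid x) k.
Proof.
have E : vsrc (b1 (src_ker_val u) (vid x) k) = 0.
  apply: etrans (congr1 (fun h : ps1 _ => h k) (br_src (b_functor C) _ _)) _.
  by rewrite vsrc_src_ker_val additive_l0 //; exact: csesq2Bl.
by apply: etrans (arrow_partE _) _; rewrite E linear0 subr0.
Qed.

(** The source axiom, stated for series, is read on the coefficient of index [(p, q, 0)] to give the
    identity part of [lz]. *)
Lemma arrow_r3E x y z p q :
  lz x y z p q = vid (b0 x (b0 y z q) p) - src_ker_val (arrow_r3 x y z p q).
Proof.
have E : vsrc (lz x y z p q) = b0 x (b0 y z q) p.
  have := congr1 (fun h : ps3 _ => h p q 0%N) (lz_src (lzP C) x y z).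
  by rewrite nested_coef /map_ps csesq3_at3_coef.
rewrite -E -[arrow_r3 _ _ _ _ _]/(- arrow_part (lz x y z p q)) linearN /=; zmod.
Qed.

Lemma arrow_leib_inftyP :
  leib_infty_axioms arrow_d b0 arrow_r01 arrow_r10 arrow_r3.
Proof.
apply: (proj1 (split_leibnizatorP (@src_ker_valK K C) (@arrow_partE K C)
  (b_functor C) _ arrow_r01E arrow_r10E arrow_r3E)) => //.
exact: lzP.
Qed.

Definition leib_infty_of_leib2 : leib_infty K := LeibInfty arrow_leib_inftyP.

End LeibInftyOfLeib2.

Section ArrowSeries.
Variables (K : fieldType) (C : leib2 K).
Let G := leib_infty_of_leib2 C.

Lemma arrow_at3 l m a b c : at3 (@lz K C) l m a b c =
  id_ps (at2 b0 l a (at2 b0 m b c))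
  - map_ps (@src_ker_val K C) (at3 (@r3 K G) l m a b c).
Proof. exact: (split_at3 (@arrow_r3E K C)). Qed.

Lemma arrow_at2_id01 l a u : at2 (@b1 K C) l (id_ps a) (map_ps src_ker_val u) =
  map_ps src_ker_val (at2 (@r01 K G) l a u).
Proof.
exact: (split_at2_id01 (@src_ker_valK K C) (@arrow_partE K C)
  (b_functor C) (@arrow_r01E K C) (@arrow_r10E K C)).
Qed.

Lemma arrow_at2_id10 l u a : at2 (@b1 K C) l (map_ps src_ker_val u) (id_ps a) =
  map_ps src_ker_val (at2 (@r10 K G) l u a).
Proof.
exact: (split_at2_id10 (@src_ker_valK K C) (@arrow_partE K C)
  (b_functor C) (@arrow_r01E K C) (@arrow_r10E K C)).
Qed.

Lemma arrow_at2_id l a b :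
  at2 (@b1 K C) l (id_ps a) (id_ps b) = id_ps (at2 b0 l a b).
Proof.
exact: (split_at2_id (@src_ker_valK K C) (@arrow_partE K C)
  (b_functor C) (@arrow_r01E K C) (@arrow_r10E K C)).
Qed.

Lemma arrow_b1 (f g : vmor C) k : b1 f g k = vid (b0 (vsrc f) (vsrc g) k)
  + src_ker_val (r01 (l := G) (vsrc f) (arrow_part g) k)
  + src_ker_val (r10 (l := G) (arrow_part f) (vtgt g) k).
Proof.
exact: (split_b1 (@src_ker_valK K C) (@arrow_partE K C)
  (b_functor C) (@arrow_r01E K C) (@arrow_r10E K C)).
Qed.

End ArrowSeries.

(** * Homomorphisms in terms of arrow parts *)

Section HomCorrespondence.
Variables (K : fieldType) (A B : leib2 K).
Let GA := leib_infty_of_leib2 A.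
Let GB := leib_infty_of_leib2 B.
Variables (F0 : {linear vob A -> vob B}) (F1 : {linear vmor A -> vmor B}).
Variables (F2 : csesq2 (vob A) (vob A) (vmor B)).
Variables (f1 : {linear li1 GA -> li1 GB}).
Variables (f2 : csesq2 (vob A) (vob A) (li1 GB)).
Hypothesis F1E : forall f,
  F1 f = vid (F0 (vsrc f)) + src_ker_val (f1 (arrow_part f)).
Hypothesis F2E : forall x y k,
  F2 x y k = vid (b0 (F0 x) (F0 y) k) - src_ker_val (f2 x y k).

Lemma hom_F1_vid x : F1 (vid x) = vid (F0 x).
Proof.
rewrite F1E vsrc_vid (arr_vid (@src_ker_valK K A) (@arrow_partE K A)).
by rewrite !linear0 addr0.
Qed.

Lemma hom_F1_val u : F1 (src_ker_val u) = src_ker_val (f1 u).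
Proof.
rewrite F1E src_ker_valK.
by rewrite vsrc_src_ker_val !linear0 add0r.
Qed.

Lemma hom_F1_src f : vsrc (F1 f) = F0 (vsrc f).
Proof.
by rewrite F1E linearD /= vsrc_vid vsrc_src_ker_val addr0.
Qed.

Lemma hom_F2_src x y : vsrc \o F2 x y = b0 (F0 x) (F0 y).
Proof.
apply/funext => k; rewrite /= F2E linearB /= vsrc_vid.
by rewrite vsrc_src_ker_val subr0.
Qed.

Lemma hom_F2_tgtE x y k :
  vtgt (F2 x y k) = b0 (F0 x) (F0 y) k - lid (l := GB) (f2 x y k).
Proof. by rewrite F2E linearB /= vtgt_vid. Qed.

Lemma hom_F1_tgtE f :
  vtgt (F1 f) = F0 (vsrc f) + lid (l := GB) (f1 (arrow_part f)).
Proof. by rewrite F1E linearD /= vtgt_vid. Qed.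

Lemma vtgt_split (C : leib2 K) (f : vmor C) :
  vtgt f = vsrc f + lid (l := leib_infty_of_leib2 C) (arrow_part f).
Proof.
by rewrite -[lid _]/(vtgt (f - vid (vsrc f))) linearB /= vtgt_vid; zmod.
Qed.

(** Composition is the linear expression f + g - 1_(t f), so a linear map compatible with sources,
    targets and identities preserves it. *)
Lemma hom_functor :
  (forall u, lid (f1 u) = F0 (lid u)) -> is_functor F0 F1.
Proof.
move=> fd; have tF f : vtgt (F1 f) = F0 (vtgt f).
  by rewrite hom_F1_tgtE fd [in RHS]vtgt_split linearD.
split=> [f|//|x|f g fg].
- exact: hom_F1_src.
- exact: hom_F1_vid.
rewrite !vcmpE //; last by rewrite /composable tF hom_F1_src fg.
by rewrite linearB linearD /= hom_F1_vid tF.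
Qed.

Lemma at2_F2 l a b : at2 F2 l a b =
  id_ps (at2 b0 l (map_ps F0 a) (map_ps F0 b))
  - map_ps src_ker_val (at2 f2 l a b).
Proof.
rewrite /id_ps !map_at2 at2_map -at2Bf; congr (at2 _ _ _ _).
by apply/funext => x; apply/funext => y; apply/funext => k; exact: F2E.
Qed.

Lemma map_F1_at3 l m a b c : map_ps F1 (at3 (@lz K A) l m a b c) =
  id_ps (map_ps F0 (at2 b0 l a (at2 b0 m b c)))
  - map_ps src_ker_val (map_ps f1 (at3 (@r3 K GA) l m a b c)).
Proof.
rewrite arrow_at3 map_psB; congr (_ - _).
  by apply: ps3P => p q r; exact: hom_F1_vid.
by apply: ps3P => p q r; exact: hom_F1_val.
Qed.

Lemma arrow_part_F1 f : arrow_part (F1 f) = f1 (arrow_part f).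
Proof.
rewrite F1E linearD /= (arr_vid (@src_ker_valK K B) (@arrow_partE K B)) add0r.
exact: src_ker_valK.
Qed.

Lemma hom_coh_iff x y z : is_functor F0 F1 ->
  (forall x y, vtgt \o F2 x y = F0 \o b0 x y) ->
  let X := x%:S in let Y := y%:S in let Z := z%:S in
  let FX := map_ps F0 X in let FY := map_ps F0 Y in let FZ := map_ps F0 Z in
  (cmp_ps (cmp_ps (at3 lz lam mu FX FY FZ)
    (at2 b1 (lam + mu) (at2 F2 lam X Y) (id_ps FZ)
          + at2 b1 mu (id_ps FY) (at2 F2 lam X Z)))
    (at2 F2 (lam + mu) (at2 b0 lam X Y) Z + at2 F2 mu Y (at2 b0 lam X Z)) =
   cmp_ps (cmp_ps (at2 b1 lam (id_ps FX) (at2 F2 mu Y Z))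
     (at2 F2 lam X (at2 b0 mu Y Z)))
     (map_ps F1 (at3 lz lam mu X Y Z))) <->
      at3 (@r3 K GB) lam mu FX FY FZ
    - map_ps f1 (at3 (@r3 K GA) lam mu X Y Z) =
      at2 (@r01 K GB) lam FX (at2 f2 mu Y Z)
    - at2 (@r10 K GB) (lam + mu) (at2 f2 lam X Y) FZ
    - at2 (@r01 K GB) mu FY (at2 f2 lam X Z)
    + at2 f2 lam X (at2 b0 mu Y Z)
    - at2 f2 (lam + mu) (at2 b0 lam X Y) Z
    - at2 f2 mu Y (at2 b0 lam X Z).
Proof.
move=> Ff Ft X Y Z FX FY FZ.
apply: iff_trans (coh_linear x y z Ff hom_F2_src Ft) _.
rewrite -/X -/Y -/Z -/FX -/FY -/FZ map_F1_at3 !arrow_at3 !at2_F2.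
rewrite !(at2Br _ _ _ _ (csesq2Br b1)) !(at2Bl _ _ _ _ (csesq2Bl b1)).
rewrite !arrow_at2_id !arrow_at2_id01 !arrow_at2_id10 -/GA -/GB.
have idD (a b : ps3 (vob B)) : id_ps (a + b) = id_ps a + id_ps b.
  exact: map_psD.
apply: (eq_iota_iff (@src_ker_valK K B)).
rewrite !(map_psB, map_psD) !idD; zmod.
Qed.

Lemma hom_nat_iff f g k : is_functor F0 F1 ->
  (forall x y, vtgt \o F2 x y = F0 \o b0 x y) ->
  vcmp (b1 (F1 f) (F1 g) k) (F2 (vtgt f) (vtgt g) k) =
    vcmp (F2 (vsrc f) (vsrc g) k) (F1 (b1 f g k)) <->
  r01 (l := GB) (F0 (vsrc f)) (f1 (arrow_part g)) k
    + r10 (l := GB) (f1 (arrow_part f)) (F0 (vtgt g)) k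
    + f2 (vsrc f) (vsrc g) k =
  f2 (vtgt f) (vtgt g) k + f1 (r01 (l := GA) (vsrc f) (arrow_part g) k)
    + f1 (r10 (l := GA) (arrow_part f) (vtgt g) k).
Proof.
move=> Ff Ft; have [Ffs Fft Ffi _] := Ff.
have Ftk x y : vtgt (F2 x y k) = F0 (b0 x y k).
  by have := congr1 (fun h : ps1 _ => h k) (Ft x y).
have bsk (C : leib2 K) (u v : vmor C) :
    vsrc (b1 u v k) = b0 (vsrc u) (vsrc v) k.
  by have := congr1 (fun h : ps1 _ => h k) (br_src (b_functor C) u v).
have btk (C : leib2 K) (u v : vmor C) :
    vtgt (b1 u v k) = b0 (vtgt u) (vtgt v) k.
  by have := congr1 (fun h : ps1 _ => h k) (br_tgt (b_functor C) u v).
have F2sk x y : vsrc (F2 x y k) = b0 (F0 x) (F0 y) k.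
  by have := congr1 (fun h : ps1 _ => h k) (hom_F2_src x y).
rewrite !vcmpE; first last.
- by rewrite /composable btk !Fft F2sk.
- by rewrite /composable Ftk Ffs bsk.
rewrite btk !Fft Ftk !F2E (arrow_b1 (F1 f)) !arrow_part_F1 !Ffs Fft.
have -> : F1 (b1 f g k) = vid (F0 (b0 (vsrc f) (vsrc g) k))
    + src_ker_val (f1 (r01 (l := GA) (vsrc f) (arrow_part g) k))
    + src_ker_val (f1 (r10 (l := GA) (arrow_part f) (vtgt g) k)).
  have F1D u v : F1 (u + v) = F1 u + F1 v by exact: linearD.
  rewrite (arrow_b1 f) -/GA; move: (r01 _ _ _) (r10 _ _ _) => Q1 Q2.
  by rewrite !F1D Ffi !hom_F1_val.
rewrite -/GA -/GB.
(* What remains is linear in these terms, which are generalized to serve as atoms. *)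
move: (@r01 K GB _ _ _) (@r10 K GB _ _ _) (f1 (r01 _ _ _)) (f1 (r10 _ _ _)).
move: (f2 (vsrc f) _ _) (f2 _ _ _) => R1 R2 P1 P2 Q1 Q2.
have valI := can_inj (@src_ker_valK K B).
set V := vid (b0 _ _ _); set V' := vid (b0 _ _ _); set W := vid (F0 _).
have eqB (U : zmodType) (x y : U) : x - y = 0 -> x = y.
  by move=> /eqP; rewrite subr_eq0 => /eqP.
split=> E.
  apply/valI/eqB; rewrite !src_ker_valD.
  by move/eqP: E; rewrite -subr_eq0 => /eqP E; apply: etrans E; zmod.
move: E => /(congr1 src_ker_val); rewrite !src_ker_valD => /eqP.
by rewrite -subr_eq0 => /eqP E; apply: eqB; apply: etrans E; zmod.
Qed.

(** The two triples are only related by [F1E] and [F2E], neither being defined from the other, so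
    that this one equivalence serves both to extract a homomorphism of 2-term algebras and to lift
    one. Naturality on an identity and a morphism of the kernel gives the two mixed conditions on
    f_2. *)
Lemma l2_hom_axiomsP :
  l2_hom_axioms F0 F1 F2 <-> li_hom_axioms (G := GA) (G' := GB) F0 f1 f2.
Proof.
split=> [[Ff Fs Ft Fn _ Fc]|[fd f00 f01 f10 fc]].
- have arr0 (C : leib2 K) (x : vob C) : arrow_part (vid x) = 0.
    exact: (arr_vid (@src_ker_valK K C) (@arrow_partE K C)).
  have f1z : f1 0 = 0 by exact: linear0.
  have r10z (G : leib_infty K) x k : @r10 K G 0 x k = 0.
    by rewrite additive_l0 //; exact: csesq2Bl.
  have r01z (G : leib_infty K) x k : @r01 K G x 0 k = 0.
    by rewrite additive_r0 //; exact: csesq2Br.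
  have f2zl x k : f2 0 x k = 0 by rewrite additive_l0 //; exact: csesq2Bl.
  have f2zr x k : f2 x 0 k = 0 by rewrite additive_r0 //; exact: csesq2Br.
  have nat f g k := proj1 (hom_nat_iff f g k Ff Ft) (Fn f g k).
  split.
  + move=> u; have := fun_tgt Ff (src_ker_val u).
    by rewrite hom_F1_val.
  + move=> x y; apply/funext => k; have := hom_F2_tgtE x y k.
    have /= -> := congr1 (fun h : ps1 _ => h k) (Ft x y).
    by rewrite !fctE /= => ->; zmod.
  + move=> x v; apply/funext => k; have := nat (vid x) (src_ker_val v) k.
    rewrite !vsrc_vid !vtgt_vid !arr0 src_ker_valK vsrc_src_ker_val.
    rewrite f1z !r10z f2zr f1z !addr0 => E.
    by rewrite !fctE; apply/eqP; rewrite subr_eq; apply/eqP.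
  + move=> v x; apply/funext => k; have := nat (src_ker_val v) (vid x) k.
    rewrite !vsrc_vid !vtgt_vid !arr0 src_ker_valK vsrc_src_ker_val.
    rewrite f1z !r01z f2zl f1z !addr0 add0r => E.
    by rewrite !fctE; apply/eqP; rewrite subr_eq; apply/eqP.
  + move=> x y z; rewrite -!(map_cps F0).
    apply: (proj1 (hom_coh_iff x y z Ff Ft)).
    by rewrite /id_ps !map_cps; exact: Fc.
have Ff := hom_functor fd.
have Ft x y : vtgt \o F2 x y = F0 \o b0 x y.
  apply/funext => k; rewrite /= hom_F2_tgtE.
  have /= <- := congr1 (fun h : ps1 _ => h k) (f00 x y).
  by rewrite !fctE /=; zmod.
split=> //.
- exact: hom_F2_src.
- move=> f g k; apply/(hom_nat_iff f g k Ff Ft).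
  have dE (h : vmor A) : lid (l := GA) (arrow_part h) = vtgt h - vsrc h.
    by rewrite vtgt_split -/GA; zmod.
  (* Naturality is recovered along the path from the sources of [f] and [g] to their targets that
     moves [g] first, matching the asymmetry of the bracket formula. *)
  have e01 : r01 (l := GB) (F0 (vsrc f)) (f1 (arrow_part g)) k
      - f1 (r01 (l := GA) (vsrc f) (arrow_part g) k) =
      f2 (vsrc f) (vtgt g) k - f2 (vsrc f) (vsrc g) k.
    rewrite -[RHS]/((f2 (vsrc f) (vtgt g) - f2 (vsrc f) (vsrc g)) k).
    by rewrite -csesq2Br -dE; exact: (congr1 (fun h : ps1 _ => h k) (f01 _ _)).
  have e10 : r10 (l := GB) (f1 (arrow_part f)) (F0 (vtgt g)) k
      - f1 (r10 (l := GA) (arrow_part f) (vtgt g) k) =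
      f2 (vtgt f) (vtgt g) k - f2 (vsrc f) (vtgt g) k.
    rewrite -[RHS]/((f2 (vtgt f) (vtgt g) - f2 (vsrc f) (vtgt g)) k).
    by rewrite -csesq2Bl -dE; exact: (congr1 (fun h : ps1 _ => h k) (f10 _ _)).
  have aux (U : zmodType) (p1 q1 p2 q2 r s t : U) :
      p1 - q1 = s - t -> p2 - q2 = r - s -> p1 + p2 + t = r + q1 + q2.
    by move=> /(canRL (subrK _)) -> /(canRL (subrK _)) ->; zmod.
  exact: (aux _ _ _ _ _ _ _ _ e01 e10).
- by move=> x y; eexists => k; exact: inverse_morphismsP.
- move=> x y z; have := proj2 (hom_coh_iff x y z Ff Ft).
  rewrite /id_ps !map_cps; apply; exact: fc.
Qed.

End HomCorrespondence.

Lemma arrow_part_vid (K : fieldType) (C : two_vect K) (x : vob C) :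
  arrow_part (vid x) = 0.
Proof. exact: (arr_vid (@src_ker_valK K C) (@arrow_partE K C)). Qed.

Lemma mor_split (K : fieldType) (C : two_vect K) (f : vmor C) :
  f = vid (vsrc f) + src_ker_val (arrow_part f).
Proof. exact: (split_morE (@arrow_partE K C)). Qed.

Section ArrowHom.
Variables (K : fieldType) (A B : leib2 K).

Section OfL2Hom.
Variable F : l2_hom A B.

Definition arrow_hom1 : {linear src_ker A -> src_ker B} :=
  arrow_part \o l2h1 F \o src_ker_val.

Let narr : {linear vmor B -> src_ker B} := -%R \o @arrow_part K B.

Lemma arrow_hom2_subproof : is_csesq2 (fun x y => narr \o l2h2 F x y).
Proof. exact/is_csesq2_post/csesq2P. Qed.
Definition arrow_hom2 := CSesq2 arrow_hom2_subproof.

Lemma arrow_hom2E x y k : arrow_hom2 x y k = - arrow_part (l2h2 F x y k).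
Proof. by []. Qed.

Lemma arrow_hom_F1E f : l2h1 F f =
  vid (l2h0 F (vsrc f)) + src_ker_val (arrow_hom1 (arrow_part f)).
Proof.
have Ff := l2h_functor (l2_homP F).
have E : vsrc (l2h1 F (src_ker_val (arrow_part f))) = 0.
  by rewrite (fun_src Ff) vsrc_src_ker_val linear0.
have -> : src_ker_val (arrow_hom1 (arrow_part f)) =
    l2h1 F (src_ker_val (arrow_part f)).
  by apply: etrans (arrow_partE _) _; rewrite E linear0 subr0.
by rewrite -(fun_id Ff) -linearD -mor_split.
Qed.

Lemma arrow_hom_F2E x y k : l2h2 F x y k =
  vid (b0 (l2h0 F x) (l2h0 F y) k) - src_ker_val (arrow_hom2 x y k).
Proof.
have E : vsrc (l2h2 F x y k) = b0 (l2h0 F x) (l2h0 F y) k.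
  exact: (congr1 (fun h : ps1 _ => h k) (l2h_src (l2_homP F) x y)).
rewrite arrow_hom2E -E [src_ker_val (- _)]linearN opprK; exact: mor_split.
Qed.

Definition arrow_hom :
    li_hom (leib_infty_of_leib2 A) (leib_infty_of_leib2 B) :=
  LiHom (proj1 (l2_hom_axiomsP arrow_hom_F1E arrow_hom_F2E) (l2_homP F)).

(** The identity part of [f] is sent to an identity, which has no arrow part. This makes extraction
    of arrow parts compatible with composition. *)
Lemma arrow_part_l2h1 f :
  arrow_part (l2h1 F f) = arrow_part (l2h1 F (src_ker_val (arrow_part f))).
Proof.
rewrite {1}[f]mor_split [l2h1 F (_ + _)]linearD [arrow_part (_ + _)]linearD.
have -> : arrow_part (l2h1 F (vid (vsrc f))) = 0.
  by rewrite (fun_id (l2h_functor (l2_homP F))) arrow_part_vid.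
by rewrite add0r.
Qed.

End OfL2Hom.

Section OfLiHom.
Variable f : li_hom (leib_infty_of_leib2 A) (leib_infty_of_leib2 B).

Definition lift_hom1 : {linear vmor A -> vmor B} :=
  (vid \o lih0 f \o vsrc) \+ (src_ker_val \o lih1 f \o arrow_part).

Let nval : {linear src_ker B -> vmor B} := -%R \o @src_ker_val K B.

Lemma lift_hom2_subproof : is_csesq2 (fun x y =>
  (fun x y : vob A => vid \o b0 (lih0 f x) (lih0 f y)) x y
  + (nval \o lih2 f x y)).
Proof.
apply: is_csesq2D; first exact/is_csesq2_post/is_csesq2_pre/csesq2P.
exact/is_csesq2_post/csesq2P.
Qed.
Definition lift_hom2 := CSesq2 lift_hom2_subproof.

Lemma lift_hom_F1E h : lift_hom1 h =
  vid (lih0 f (vsrc h)) + src_ker_val (lih1 f (arrow_part h)).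
Proof. by []. Qed.

Lemma lift_hom_F2E x y k : lift_hom2 x y k =
  vid (b0 (lih0 f x) (lih0 f y) k) - src_ker_val (lih2 f x y k).
Proof. by []. Qed.

Definition lift_hom : l2_hom A B :=
  L2Hom (proj2 (l2_hom_axiomsP lift_hom_F1E lift_hom_F2E) (li_homP f)).

End OfLiHom.

Lemma arrow_homK : cancel arrow_hom lift_hom.
Proof.
move=> F; apply: l2_hom_ext => // [f|x y k].
  by rewrite [RHS]arrow_hom_F1E.
by rewrite [RHS]arrow_hom_F2E.
Qed.

Lemma lift_homK : cancel lift_hom arrow_hom.
Proof.
move=> f; apply: li_hom_ext => // [u|x y k].
  apply: etrans (_ : arrow_part (lift_hom1 f (src_ker_val u)) = _) => //.
  rewrite lift_hom_F1E [arrow_part (_ + _)]linearD arrow_part_vid add0r.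
  by rewrite !src_ker_valK.
apply: etrans (_ : - arrow_part (lift_hom2 f x y k) = _) => //.
rewrite lift_hom_F2E [arrow_part (_ - _)]linearB arrow_part_vid sub0r opprK.
exact: src_ker_valK.
Qed.

End ArrowHom.

Section ArrowFunctor.
Variable K : fieldType.

Lemma arrow_hom_id (A : leib2 K) :
  arrow_hom (l2_id A) = li_id (leib_infty_of_leib2 A).
Proof.
apply: li_hom_ext => // [u|x y k]; first exact: src_ker_valK.
apply: etrans (_ : - arrow_part (vid (b0 x y k)) = _) => //.
by rewrite arrow_part_vid oppr0.
Qed.

(** The composite of G_2 and G_1(F_2) is their sum minus an identity; arrow parts kill the identity
    and leave the sum that defines composition of 2-term homomorphisms. *)
Lemma arrow_hom_comp (A B C : leib2 K) (G : l2_hom B C) (F : l2_hom A B) :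
  arrow_hom (l2_comp G F) = li_comp (arrow_hom G) (arrow_hom F).
Proof.
apply: li_hom_ext => // [u|x y k].
  exact: (arrow_part_l2h1 G (l2h1 F (src_ker_val u))).
apply: etrans (_ : - arrow_part (l2_comp_2_fun G F x y k) = _) => //.
rewrite l2_comp_2E ![arrow_part (_ + _)]linearD arrow_part_vid addr0 opprD.
congr (_ + _); rewrite arrow_part_l2h1.
by symmetry; exact: (linearN (arrow_hom1 G) (arrow_part (l2h2 F x y k))).
Qed.

Definition arrow_functor : functor (LeibConf2 K) (TwoLeibInftyConf K) :=
  @Functor (LeibConf2 K) (TwoLeibInftyConf K) (@leib_infty_of_leib2 K)
    (@arrow_hom K) arrow_hom_id arrow_hom_comp.

End ArrowFunctor.

Lemma is_csesq3D (K : fieldType) (M1 M2 M3 N : lmodType {poly K})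
    (phi psi : M1 -> M2 -> M3 -> ps2 N) :
  is_csesq3 phi -> is_csesq3 psi ->
  is_csesq3 (fun x y z => phi x y z + psi x y z).
Proof.
have X1 (a b : ps2 N) p q : mulX (a + b) p q = mulX a p q + mulX b p q.
  by case: p => [|p] //=; rewrite -[RHS]/(0 + 0 : N) addr0.
have X2 (a b : ps2 N) p q :
    mulX ((a + b) p) q = mulX (a p) q + mulX (b p) q.
  by case: q => [|q] //=; rewrite addr0.
case=> h1 h2 h3 h4 h5 h6 [g1 g2 g3 g4 g5 g6].
split=> [c x x' y z|c x y y' z|c x y z z'|x y z|x y z|x y z];
  rewrite ?(h1, h2, h3, h4, h5, h6) ?(g1, g2, g3, g4, g5, g6).
- by rewrite scalerDr addrACA.
- by rewrite scalerDr addrACA.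
- by rewrite scalerDr addrACA.
- by apply/funext => p; apply/funext => q; 
  rewrite -[RHS]/(- mulX (phi x y z + psi x y z) p q) X1 opprD.
- by apply/funext => p; apply/funext => q; 
  rewrite -[RHS]/(- mulX ((phi x y z + psi x y z) p) q) X2 opprD.
- apply/funext => p; apply/funext => q; rewrite scalerDr.
  rewrite -[RHS]/(('X *: phi x y z + 'X *: psi x y z) p q
    + mulX (phi x y z + psi x y z) p q + mulX ((phi x y z + psi x y z) p) q).
  rewrite X1 X2 -[LHS]/(_ + _ + _ + (_ + _ + _) : N).
  by rewrite addrACA; congr (_ + _); exact: addrACA.
Qed.

(** * Essential surjectivity *)

Section PairMorphisms.
Variables (K : fieldType) (G : leib_infty K).

Definition pair_mor : lmodType {poly K} := (li0 G * li1 G)%type.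

Definition pair_id_fun (x : li0 G) : pair_mor := (x, 0).

Lemma pair_id_linear : linear pair_id_fun.
Proof.
by move=> a x y; apply: injective_projections; rewrite /= ?scaler0 ?addr0.
Qed.

HB.instance Definition _ :=
  GRing.isLinear.Build {poly K} (li0 G) pair_mor *:%R pair_id_fun
    pair_id_linear.

Definition pair_arrow_fun (u : li1 G) : pair_mor := (0, u).

Lemma pair_arrow_linear : linear pair_arrow_fun.
Proof.
by move=> a x y; apply: injective_projections; rewrite /= ?scaler0 ?addr0.
Qed.

HB.instance Definition _ :=
  GRing.isLinear.Build {poly K} (li1 G) pair_mor *:%R pair_arrow_fun
    pair_arrow_linear.

Definition pair_src : {linear pair_mor -> li0 G} := fst.
Definition pair_arr : {linear pair_mor -> li1 G} := snd.
Definition pair_tgt : {linear pair_mor -> li0 G} :=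
  pair_src \+ (lid \o pair_arr).
Definition pair_id : {linear li0 G -> pair_mor} := pair_id_fun.
Definition pair_arrow : {linear li1 G -> pair_mor} := pair_arrow_fun.
Definition pair_cmp (f g : pair_mor) : pair_mor := (f.1, f.2 + g.2).

Lemma pair_two_vect_axioms : two_vect_axioms pair_src pair_tgt pair_id pair_cmp.
Proof.
split=> //=.
- by move=> x; rewrite linear0 addr0.
- by move=> f g /= fg; rewrite linearD addrA fg.
- by move=> [x u]; rewrite /pair_cmp /= add0r.
- by move=> [x u]; rewrite /pair_cmp /= addr0.
- by move=> f g h _ _; rewrite /pair_cmp /= addrA.
- move=> p f g f' g' _ _; apply: injective_projections; rewrite //= scalerDr.
  by rewrite addrACA.
Qed.

Definition pair_two_vect : two_vect K := TwoVect pair_two_vect_axioms.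

(** The formula is forced by [split_b1], with the two factors as source and arrow part; hence
    [pair_tgt] in the last term. *)
Lemma pair_b1_subproof : is_csesq2 (fun f g : pair_mor =>
  (fun f g : pair_mor =>
    (pair_id \o r00 (pair_src f) (pair_src g))
    + (pair_arrow \o r01 (pair_src f) (pair_arr g))) f g
  + (pair_arrow \o r10 (pair_arr f) (pair_tgt g))).
Proof.
by do 2?[apply: is_csesq2D]; apply/is_csesq2_post/is_csesq2_pre/csesq2P.
Qed.
Definition pair_b1 := CSesq2 pair_b1_subproof.

Lemma pair_b1E f g k : pair_b1 f g k =
  (r00 f.1 g.1 k, r01 f.1 g.2 k + r10 f.2 (g.1 + lid g.2) k).
Proof.
by apply: injective_projections; rewrite /= ?addr0 ?add0r.
Qed.

Let d01 x u k : lid (r01 (l := G) x u k) = r00 x (lid u) k.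
Proof. exact: (congr1 (fun h : ps1 _ => h k) (li_d01 (leib_inftyP G) x u)). Qed.

Let d10 u x k : lid (r10 (l := G) u x k) = r00 (lid u) x k.
Proof. exact: (congr1 (fun h : ps1 _ => h k) (li_d10 (leib_inftyP G) u x)). Qed.

(** Targets are preserved by (ii) and (iii). For composites the two sides differ by one cross term,
    in the arrow of the first factor on one side and of the second on the other, and (iv) identifies
    the two versions. *)
Lemma pair_bracket_functor :
  bracket_functor (C := pair_two_vect) (@r00 K G) pair_b1.
Proof.
split.
- by move=> f g; apply/funext => k; rewrite /= !addr0.
- move=> [x u] [y v]; apply/funext => k.
  rewrite -[LHS]/(pair_tgt (pair_b1 (x, u) (y, v) k)) pair_b1E.
  rewrite -[RHS]/(r00 (x + lid u) (y + lid v) k) /= linearD /= d01 d10.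
  by rewrite [in RHS]csesq2Dl [r00 x (y + _)]csesq2Dr !ps1DE addrA.
- move=> x y; apply/funext => k; rewrite pair_b1E /=.
  have -> : r01 (l := G) x 0 = 0 by apply: additive_r0; exact: csesq2Br.
  have -> : r10 (l := G) 0 (y + lid 0) = 0.
    by apply: additive_l0; exact: csesq2Bl.
  by apply: injective_projections => //=; exact: addr0.
- move=> [x u] [x' u'] [y v] [y' v'] fg gh k.
  have {fg} <- : x + lid u = x' := fg; have {gh} <- : y + lid v = y' := gh.
  rewrite -[LHS]/(pair_b1 (x, u + u') (y, v + v') k).
  rewrite -[RHS]/(pair_cmp (pair_b1 (x, u) (y, v) k)
    (pair_b1 (x + lid u, u') (y + lid v, v') k)) !pair_b1E /pair_cmp /=.
  congr (_, _); rewrite [lid (v + v')]linearD addrA !csesq2Dl !csesq2Dr !ps1DE.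
  by rewrite (li_11 (leib_inftyP G)); zmod.
Qed.

Let narrow : {linear li1 G -> pair_mor} := -%R \o pair_arrow.

Lemma pair_lz_subproof : is_csesq3 (fun x y z : li0 G =>
  ((fun p => pair_id \o (fun q => r00 x (r00 y z q) p)) : ps2 pair_mor)
  + ((fun p => narrow \o r3 x y z p) : ps2 pair_mor)).
Proof.
apply: is_csesq3D; last exact/is_csesq3_post/csesq3P.
apply: (@is_csesq3_post _ _ _ _ _ _ pair_id
  (fun x y z p q => r00 x (r00 y z q) p)).
exact: is_csesq3_nested.
Qed.
Definition pair_lz : csesq3 (vob pair_two_vect) (vob pair_two_vect)
  (vob pair_two_vect) (vmor pair_two_vect) := CSesq3 pair_lz_subproof.

Lemma pair_leibnizator_axioms :
  leibnizator_axioms (C := pair_two_vect) (@r00 K G) pair_b1 pair_lz.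
Proof.
have r00z x k : r00 (l := G) x 0 k = 0.
  by rewrite additive_r0 //; exact: csesq2Br.
have r00z' x k : r00 (l := G) 0 x k = 0.
  by rewrite additive_l0 //; exact: csesq2Bl.
have r10z x k : r10 (l := G) 0 x k = 0.
  by rewrite additive_l0 //; exact: csesq2Bl.
have r01z x k : r01 (l := G) x 0 k = 0.
  by rewrite additive_r0 //; exact: csesq2Br.
apply: (proj2 (split_leibnizatorP (C := pair_two_vect) (iota := pair_arrow)
  (arr := pair_arr) _ _ pair_bracket_functor (d := lid) _ _ _ _)
  (leib_inftyP G)).
- by [].
- by move=> [x u]; apply: injective_projections; rewrite /= ?subrr ?subr0.
- by move=> u; rewrite [RHS]add0r.
- by move=> x u k; rewrite [RHS]pair_b1E /= r00z r10z addr0.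
- by move=> u x k; rewrite [RHS]pair_b1E /= linear0 addr0 r00z' r01z add0r.
- by [].
Qed.

Definition leib2_of_leib_infty : leib2 K :=
  Leib2 pair_bracket_functor pair_leibnizator_axioms.

End PairMorphisms.

(** * Homomorphisms with zero f_2 *)

Section StrictHom.
Variables (K : fieldType) (G G' : leib_infty K).
Variables (f0 : {linear li0 G -> li0 G'}) (f1 : {linear li1 G -> li1 G'}).
Hypothesis f_d : forall u, lid (f1 u) = f0 (lid u).
Hypothesis f_00 : forall x y k, r00 (f0 x) (f0 y) k = f0 (r00 x y k).
Hypothesis f_01 : forall x u k, r01 (f0 x) (f1 u) k = f1 (r01 x u k).
Hypothesis f_10 : forall u x k, r10 (f1 u) (f0 x) k = f1 (r10 u x k).
Hypothesis f_3 : forall x y z p q,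
  r3 (f0 x) (f0 y) (f0 z) p q = f1 (r3 x y z p q).

Definition zero_csesq2 : csesq2 (li0 G) (li0 G) (li1 G') :=
  CSesq2 (is_csesq2_0 (li0 G) (li0 G) (li1 G')).

Lemma strict_hom_axioms : li_hom_axioms f0 f1 zero_csesq2.
Proof.
split=> [//|x y|x u|u x|x y z].
- by apply/funext => k; rewrite /= linear0 !fctE /= f_00 subrr.
- by apply/funext => k; rewrite !fctE /= f_01 subrr.
- by apply/funext => k; rewrite !fctE /= f_10 subrr.
rewrite !at2_0f (at2_0r _ _ (csesq2Br r01)) (at2_0l _ _ (csesq2Bl r10)).
rewrite (at2_0r _ _ (csesq2Br r01)).
rewrite !csesq3_at3_cps map_psum.
set A := psum _ _; set B := psum _ _; have -> : A = B; last by zmod.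
congr psum; apply/funext => k; rewrite map_psum; congr psum.
by apply/funext => h; rewrite map_cps f_3.
Qed.

Definition strict_hom : li_hom G G' := LiHom strict_hom_axioms.

End StrictHom.

(** * The isomorphism between a 2-term algebra and the one rebuilt from its pairs *)

Section Counit.
Variables (K : fieldType) (G : leib_infty K).
Let C := leib2_of_leib_infty G.
Let G' := leib_infty_of_leib2 C.

Definition counit0 : {linear li0 G' -> li0 G} := idfun.
Definition counit1 : {linear li1 G' -> li1 G} :=
  pair_arr G \o @src_ker_val K C.
Definition counit_inv0 : {linear li0 G -> li0 G'} := idfun.
Definition counit_inv1 : {linear li1 G -> li1 G'} :=
  @arrow_part K C \o pair_arrow G.

Lemma pair_arrow_counit1 u : pair_arrow G (counit1 u) = src_ker_val u.
Proof.
apply: injective_projections => //=.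
by have := vsrc_src_ker_val u.
Qed.

Lemma counit_invK : cancel counit_inv1 counit1.
Proof. by move=> u; rewrite [LHS]/= subr0. Qed.

Lemma counitK : cancel counit1 counit_inv1.
Proof.
move=> u; rewrite -[LHS]/(arrow_part (C := C) (pair_arrow G (counit1 u))).
by rewrite pair_arrow_counit1; exact: (@src_ker_valK K C).
Qed.

Lemma counit_d u : lid (counit1 u) = counit0 (lid u).
Proof.
rewrite -[RHS]/(pair_tgt G (src_ker_val u)) -pair_arrow_counit1.
by rewrite [RHS]add0r.
Qed.

Lemma counit_01 x u k :
  r01 (counit0 x) (counit1 u) k = counit1 (r01 (l := G') x u k).
Proof.
have E : src_ker_val (r01 (l := G') x u k) = _ := arrow_r01E (C := C) x u k.
rewrite -[RHS]/((src_ker_val (r01 (l := G') x u k)).2) E.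
rewrite -[b1 _ _ k]/(pair_b1 G _ _ k) pair_b1E /=.
have r10z y : r10 (l := G) 0 y = 0 by apply: additive_l0; exact: csesq2Bl.
by rewrite r10z [RHS]addr0.
Qed.

Lemma counit_10 u x k :
  r10 (counit1 u) (counit0 x) k = counit1 (r10 (l := G') u x k).
Proof.
have E : src_ker_val (r10 (l := G') u x k) = _ := arrow_r10E (C := C) u x k.
rewrite -[RHS]/((src_ker_val (r10 (l := G') u x k)).2) E.
rewrite -[b1 _ _ k]/(pair_b1 G _ _ k) pair_b1E /= linear0 addr0.
have r01z y : r01 (l := G) y 0 = 0 by apply: additive_r0; exact: csesq2Br.
by rewrite r01z [RHS]add0r.
Qed.

(** The sign put into [pair_lz] cancels the one in the definition of [arrow_r3]. *)
Lemma counit_3 x y z p q :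
  r3 (counit0 x) (counit0 y) (counit0 z) p q = counit1 (r3 (l := G') x y z p q).
Proof.
rewrite -[RHS]/((src_ker_val (r3 (l := G') x y z p q)).2).
have := congr1 snd (arrow_r3E (C := C) x y z p q).
rewrite -[r3 (l := G') x y z p q]/(arrow_r3 C x y z p q).
rewrite -[LHS]/(0 - r3 (l := G) x y z p q) -[RHS]/(0 - _).
by rewrite !sub0r => /oppr_inj.
Qed.

Definition counit : li_hom G' G :=
  strict_hom counit_d (fun _ _ _ => erefl) counit_01 counit_10 counit_3.

Lemma counit_inv_d u : lid (counit_inv1 u) = counit_inv0 (lid u).
Proof. by rewrite -{2}[u]counit_invK counit_d. Qed.

Lemma counit_inv_01 x u k :
  r01 (counit_inv0 x) (counit_inv1 u) k = counit_inv1 (r01 x u k).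
Proof.
by apply: (can_inj counitK); rewrite counit_invK -counit_01 counit_invK.
Qed.

Lemma counit_inv_10 u x k :
  r10 (counit_inv1 u) (counit_inv0 x) k = counit_inv1 (r10 u x k).
Proof.
by apply: (can_inj counitK); rewrite counit_invK -counit_10 counit_invK.
Qed.

Lemma counit_inv_3 x y z p q :
  r3 (counit_inv0 x) (counit_inv0 y) (counit_inv0 z) p q =
  counit_inv1 (r3 x y z p q).
Proof. by apply: (can_inj counitK); rewrite counit_invK -counit_3. Qed.

Definition counit_inv : li_hom G G' :=
  strict_hom counit_inv_d (fun _ _ _ => erefl) counit_inv_01 counit_inv_10
    counit_inv_3.

Lemma comp_counit_inv : li_comp counit_inv counit = li_id G'.
Proof.
apply: li_hom_ext => [x|u|x y k] //; first exact: counitK.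
by apply: etrans (add0r _) _; exact: linear0.
Qed.

Lemma comp_counit : li_comp counit counit_inv = li_id G.
Proof.
apply: li_hom_ext => [x|u|x y k] //; first exact: counit_invK.
by apply: etrans (add0r _) _; exact: linear0.
Qed.

End Counit.

Theorem theorem5p3 (R : realType) :
  equivalent_categories (LeibConf2 R[i]) (TwoLeibInftyConf R[i]).
Proof.
exact: (fully_faithful_equivalence (F := arrow_functor R[i])
  (@lift_homK R[i]) (@arrow_homK R[i])
  (@comp_counit_inv R[i]) (@comp_counit R[i])).
Qed.
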